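(* Let $q>1$ be a real number, let $\mathbb{E}\neq\{0\}$ be a complex Banach space, and let $m=(m_p)_{p\ge0}$ be a sequence of positive real numbers with $m_0=1$. Then $m$ preserves $q$-Gevrey asymptotic expansions if and only if for every $s>0$ and every $\theta\in\mathbb{R}$ with $\theta\neq 0 \mod 2\pi$, the formal power series $\mathcal{B}_{m,t}\left(\sum_{p\ge0}t^p\right)=\sum_{p\ge0}\frac{t^p}{m_p}$ and $\mathcal{B}_{m^{-1},t}\left(\sum_{p\ge0}t^p\right)=\sum_{p\ge0}m_pt^p$ belong to $\mathbb{C}\{t\}$ and each of them can be extended to an infinite sector of bisecting direction $\theta$ with $q$-exponential growth of order $1/s$.
   Context: $\mathbb{E}$ is a complex Banach space with norm $\|\cdot\|_{\mathbb{E}}$; $\mathbb{E}[[t]]$ is the space of formal power series in $t$ with coefficients in $\mathbb{E}$ and $\mathbb{E}\{t\}$ is the subspace of those power series which converge on some neighborhood of the origin (similarly $\mathbb{C}\{t\}$). Infinite sector: for $d\in\mathbb{R}$, an infinite sector with vertex at the origin, bisecting direction $d$ and positive opening $\delta>0$ is $S=\{re^{i\varphi}: r>0,\ |\varphi-d|<\delta/2\}$. A convergent power series $g$ can be extended on $S$ if there are $\rho>0$ and a holomorphic function on $S\cup D_\rho$ ($D_\rho$ the open disc of radius $\rho$ centered at $0$) which coincides with the sum of $g$ on $D_\rho$; ''can be extended on an infinite sector of bisecting direction $d$'' means that this holds for some such $S$ (some positive opening). $q$-exponential growth: for $s>0$, a holomorphic function $f:S\to\mathbb{E}$ is of $q$-exponential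 growth of order $1/s$ on $S$ if there exist $C,h>0$ and $\alpha\in\mathbb{R}$ such that $\|f(z)\|_{\mathbb{E}}\le C\exp\left(\frac{\log^2(|z|+h)}{2s\log(q)}\right)(|z|+h)^{\alpha}$ for every $z\in S$. Formal Borel operators: for a sequence $m=(m_p)_{p\ge0}$ of positive real numbers, $\mathcal{B}_{m,t}\left(\sum_{p\ge0}a_pt^p\right)=\sum_{p\ge0}\frac{a_p}{m_p}t^p$; $m^{-1}=(1/m_p)_{p\ge0}$. For $s>0$, $\mathcal{B}_{q;s}\left(\sum_{p\ge0}a_pt^p\right)=\sum_{p\ge0}\frac{a_p}{q^{s p(p-1)/2}}t^p$. Definition: $m$ preserves $q$-Gevrey asymptotic expansions if for every $s>0$, $d\in\mathbb{R}$ and $\hat{u}\in\mathbb{E}[[t]]$ the following two statements are equivalent: (i) $\mathcal{B}_{q;s}(\hat{u})\in\mathbb{E}\{t\}$, and this function can be extended on an infinite sector of bisecting direction $d$ with $q$-exponential growth of order $1/s$ on such sector; (ii) $\mathcal{B}_{q;s}\mathcal{B}_{m,t}(\hat{u})\in\mathbb{E}\{t\}$, and this function can be extended on an infinite sector of bisecting direction $d$ with $q$-exponential growth of order $1/s$ on such sector. *)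

(* Defs.v *)
(* Stdlib reals with Coquelicot: a complex Banach space is a
   [CompleteNormedModule C_AbsRing]. *)
From Stdlib Require Export Reals ZArith.
From Coquelicot Require Export Coquelicot.
Open Scope R_scope.

Definition in_sector (d delta : R) (z : C) : Prop :=
  exists r phi : R,
    0 < r /\ Rabs (phi - d) < delta / 2 /\ z = (r * cos phi, r * sin phi).

Definition in_disc (rho : R) (z : C) : Prop := Cmod z < rho.

(* Used only for open sets U. [f] is a total function whose values outside U
   are irrelevant; [ex_derive] over [C_AbsRing] is complex differentiability. *)
Definition holomorphic_on {E : NormedModule C_AbsRing}
    (U : C -> Prop) (f : C -> E) : Prop :=
  forall z : C, U z -> ex_derive (K := C_AbsRing) f z.

Definition q_exp_growth {E : NormedModule C_AbsRing}
    (q s : R) (S : C -> Prop) (f : C -> E) : Prop :=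
  exists K h alpha : R, 0 < K /\ 0 < h /\
    forall z : C, S z ->
      norm (f z) <= K * exp ((ln (Cmod z + h)) ^ 2 / (2 * s * ln q))
                      * Rpower (Cmod z + h) alpha.

(* A formal power series with coefficients in E is its sequence of
   coefficients [nat -> E]. *)

Definition convergent_ps {E : NormedModule C_AbsRing} (a : nat -> E) : Prop :=
  exists rho : R, 0 < rho /\
    forall z : C, in_disc rho z -> ex_pseries (K := C_AbsRing) a z.

(* The bound is asked on the sector only; the opening of the sector, like the
   constants of the bound, may depend on the series and on s. *)
Definition extends_with_q_exp_growth {E : NormedModule C_AbsRing}
    (q s d : R) (a : nat -> E) : Prop :=
  exists (delta rho : R) (f : C -> E),
    0 < delta /\ 0 < rho /\
    holomorphic_on (fun z => in_sector d delta z \/ in_disc rho z) f /\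
    (forall z : C, in_disc rho z -> is_pseries (K := C_AbsRing) a z (f z)) /\
    q_exp_growth q s (in_sector d delta) f.

Definition formal_borel {E : NormedModule C_AbsRing}
    (m : nat -> R) (a : nat -> E) : nat -> E :=
  fun p => scal (RtoC (/ m p)) (a p).

Definition q_borel {E : NormedModule C_AbsRing}
    (q s : R) (a : nat -> E) : nat -> E :=
  formal_borel (fun p => Rpower q (s * (INR p * (INR p - 1) / 2))) a.

Definition preserves_q_Gevrey (q : R) (E : NormedModule C_AbsRing)
    (m : nat -> R) : Prop :=
  forall (s d : R) (u : nat -> E), 0 < s ->
    (convergent_ps (q_borel q s u) /\
     extends_with_q_exp_growth q s d (q_borel q s u))
    <->
    (convergent_ps (q_borel q s (formal_borel m u)) /\
     extends_with_q_exp_growth q s d (q_borel q s (formal_borel m u))).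

Definition geometric_ps : nat -> C_NormedModule := fun _ => RtoC 1.

(* Main.v *)
(** The termwise product [sum b_p a_p t^p] of two power series with sums [G] and [F]
    is the Hadamard integral [(2 i pi)^-1 int F(w) G(z/w) dw/w].  If [F] extends to a
    sector of direction [d] and [G] extends in every direction except the positive
    half-line, the circle of integration can be pushed outwards inside the sector,
    along two rays up to radius about [|z|], while [z/w] stays in the domain of [G];
    this extends the product to a smaller sector.  The order of growth is kept because
    [log^2 |w| + log^2 |z/w| <= log^2 |z|] up to linear terms.  Applied to the series
    [1/m_p] and [m_p] this gives one implication; the other one follows by testing the
    definition on the series [e/(1-t)], whose only singular direction is [0], and
    on the fact that an extension of [sum b_p e t^p] takes its values in the line [C e]. *)

(* All contours are drawn in the coordinate [t = log w]: circles become vertical segments, rays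
   horizontal ones and [dw / w] becomes [dt], so Goursat on rectangles together with the period
   [2 i pi] replaces winding numbers and residues. The obstacle is that [G] is known only one
   direction at a time, with an opening and growth constants that depend on the direction.
   Uniqueness along rays lets these extensions be glued, and compactness of [[eps, 2 pi - eps]]
   gives common constants; the product is therefore built on a sector narrower than that of [F],
   which keeps [z / w] at a fixed angle from the positive half-line. Growth is measured with
   [log (1 + |z|) >= 0], so that [a^2 + b^2 <= (a + b)^2]; the length of the contour, of order
   [log |z|], then costs one factor [1 + |z|]. The contour depends on [z], and holomorphy is checked
   locally, where a fixed radius gives the same value. A single identity theorem, for values in a
   closed subspace, serves twice: with [{0}] for uniqueness, and with [C e] to pass from [E] to
   scalar series without any linear functional. *)
Require Import Defs.
From Stdlib Require Import Lra Lia Psatz Classical ClassicalEpsilon FunctionalExtensionality.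

(** * Linear combinations in modules and restriction of scalars *)

Section Vec.
Context {V : NormedModule C_AbsRing}.
(** Reified linear combinations: atoms are indices into an environment of vectors, so two
    expressions agree as soon as their coefficients do. *)
Inductive vexp := VAtom (n : nat) | VPlus (a b : vexp) | VOpp (a : vexp)
  | VMinus (a b : vexp) | VScal (c : C) (a : vexp) | VZero.
Fixpoint veval (env : nat -> V) (e : vexp) : V :=
  match e with
  | VAtom n => env n
  | VPlus a b => plus (veval env a) (veval env b)
  | VOpp a => opp (veval env a)
  | VMinus a b => minus (veval env a) (veval env b)
  | VScal c a => scal c (veval env a)
  | VZero => zero
  end.
Fixpoint vcoef (e : vexp) (i : nat) : C :=
  match e with
  | VAtom n => if Nat.eqb n i then RtoC 1 else RtoC 0
  | VPlus a b => (vcoef a i + vcoef b i)%C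
  | VOpp a => (- vcoef a i)%C
  | VMinus a b => (vcoef a i - vcoef b i)%C
  | VScal c a => (c * vcoef a i)%C
  | VZero => RtoC 0
  end.
Fixpoint vbound (e : vexp) (k : nat) : Prop :=
  match e with
  | VAtom n => (n < k)%nat
  | VPlus a b | VMinus a b => vbound a k /\ vbound b k
  | VOpp a | VScal _ a => vbound a k
  | VZero => True
  end.
(** Normal form of the reflexive tactic; with [c n = h ^ n] it is also the partial sum, of [k]
    terms, of a power series, and is used as such throughout. *)
Fixpoint lcomb (env : nat -> V) (c : nat -> C) (k : nat) : V :=
  match k with
  | O => zero
  | S k => plus (lcomb env c k) (scal (c k) (env k))
  end.

Lemma lcomb_ext env c d k :
  (forall i, (i < k)%nat -> c i = d i) -> lcomb env c k = lcomb env d k.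
Proof.
induction k as [|k IH]; intros H; simpl; trivial.
rewrite IH, (H k); trivial; try lia.
intros i Hi; apply H; lia.
Qed.

Lemma plus_shuffle (a b c d : V) :
  plus (plus a b) (plus c d) = plus (plus a c) (plus b d).
Proof.
rewrite <- !plus_assoc; f_equal. rewrite !plus_assoc; f_equal. apply plus_comm.
Qed.

Lemma lcomb_plus env c d k :
  lcomb env (fun i => c i + d i)%C k = plus (lcomb env c k) (lcomb env d k).
Proof.
induction k as [|k IH]; simpl.
- now rewrite plus_zero_l.
- rewrite IH, (scal_distr_r (c k) (d k) (env k) : scal (c k + d k)%C _ = _). apply plus_shuffle.
Qed.

Lemma lcomb_opp env c k :
  lcomb env (fun i => - c i)%C k = opp (lcomb env c k).
Proof.
induction k as [|k IH]; simpl.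
- exact (eq_sym (@opp_zero V)).
- now rewrite IH, (@opp_plus V), (scal_opp_l (c k) (env k) : scal (- c k)%C _ = _).
Qed.

Lemma lcomb_scal env l c k :
  lcomb env (fun i => l * c i)%C k = scal l (lcomb env c k).
Proof.
induction k as [|k IH]; simpl.
- exact (eq_sym (@scal_zero_r _ V l)).
- rewrite IH. rewrite (@scal_distr_l _ V). f_equal. exact (eq_sym (scal_assoc l (c k) (env k))).
Qed.

Lemma lcomb_zero env k : lcomb env (fun _ => RtoC 0) k = zero.
Proof.
induction k as [|k IH]; simpl; trivial. now rewrite IH, (scal_zero_l (env k) : scal (RtoC 0) _ = _), plus_zero_l.
Qed.

Lemma lcomb_atom env n k : (n < k)%nat ->
  lcomb env (fun i => if Nat.eqb n i then RtoC 1 else RtoC 0) k = env n.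
Proof.
induction k as [|k IH]; intros Hn; [lia|]; simpl.
destruct (Nat.eqb_spec n k) as [->|Hk].
- rewrite (scal_one (env k) : scal (RtoC 1) _ = _). rewrite (lcomb_ext _ _ (fun _ => RtoC 0)), lcomb_zero, plus_zero_l; trivial.
  intros i Hi. destruct (Nat.eqb_spec k i); trivial; lia.
- rewrite IH by lia. now rewrite (scal_zero_l (env k) : scal (RtoC 0) _ = _), plus_zero_r.
Qed.

Lemma veval_lcomb env k e : vbound e k -> veval env e = lcomb env (vcoef e) k.
Proof.
induction e as [n|a IHa b IHb|a IHa|a IHa b IHb|c a IHa|]; simpl; intros Hb.
- now rewrite lcomb_atom.
- rewrite lcomb_plus, IHa, IHb; tauto.
- rewrite lcomb_opp, IHa; tauto.
- unfold minus, Cminus. rewrite lcomb_plus, lcomb_opp, IHa, IHb; tauto.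
- rewrite lcomb_scal, IHa; tauto.
- now rewrite lcomb_zero.
Qed.

Fixpoint coef_eq (c d : nat -> C) (k : nat) : Prop :=
  match k with O => True | S k => c k = d k /\ coef_eq c d k end.

Lemma veval_eq env k e1 e2 : vbound e1 k -> vbound e2 k ->
  coef_eq (vcoef e1) (vcoef e2) k -> veval env e1 = veval env e2.
Proof.
intros H1 H2 H. rewrite (veval_lcomb env k), (veval_lcomb env k e2) by trivial.
apply lcomb_ext. clear H1 H2.
induction k as [|k IH]; intros i Hi; [lia|].
destruct H as [Hk H]. destruct (Nat.eq_dec i k) as [->|]; trivial.
apply IH; trivial; lia.
Qed.
End Vec.

Ltac vlookup x l :=
  lazymatch l with
  | cons x _ => constr:(O)
  | cons _ ?l' => let n := vlookup x l' in constr:(S n)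
  end.
Ltac vmem x l :=
  lazymatch l with
  | nil => constr:(false)
  | cons x _ => constr:(true)
  | cons _ ?l' => vmem x l'
  end.
Ltac vatoms e l :=
  lazymatch e with
  | plus ?a ?b => let l := vatoms a l in vatoms b l
  | minus ?a ?b => let l := vatoms a l in vatoms b l
  | opp ?a => vatoms a l
  | scal _ ?a => vatoms a l
  | zero => l
  | ?x => let b := vmem x l in
          lazymatch b with true => l | false => constr:(cons x l) end
  end.
Ltac vquote e l :=
  lazymatch e with
  | plus ?a ?b => let a := vquote a l in let b := vquote b l in constr:(VPlus a b)
  | minus ?a ?b => let a := vquote a l in let b := vquote b l in constr:(VMinus a b)
  | opp ?a => let a := vquote a l in constr:(VOpp a)
  | scal ?c ?a => let a := vquote a l in constr:(VScal c a)
  | zero => constr:(VZero)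
  | ?x => let n := vlookup x l in constr:(VAtom n)
  end.

(* Reduces an equality of linear combinations in a normed module over [C] to
   the equalities of their coefficients. *)
Ltac vcoefs :=
  lazymatch goal with
  | |- @eq _ ?a ?b =>
    let T := type of a in
    let l := vatoms a (@nil T) in
    let l := vatoms b l in
    let e1 := vquote a l in
    let e2 := vquote b l in
    let k := eval compute in (length l) in
    refine (@veval_eq _ (fun i => List.nth i l zero) k e1 e2 _ _ _);
    [cbn; auto 20 with arith | cbn; auto 20 with arith |];
    cbv [vcoef coef_eq Nat.eqb]; repeat split
  end.

Ltac vring := vcoefs; try (simpl; ring).

Section RestrictScalars.
Context (E : CompleteNormedModule C_AbsRing).

(** Riemann integrals are taken in real normed modules. [ER] below is [E] with the same group, norm
    and uniform structure, so the real theory of integration applies to it by conversion. *)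
Definition scalR (r : R) (x : E) : E := scal (RtoC r) x.

Lemma scalR_assoc (x y : R) (u : E) : scalR x (scalR y u) = scalR (x * y) u.
Proof. unfold scalR. rewrite RtoC_mult. vring. Qed.
Lemma scalR_one (u : E) : scalR 1 u = u.
Proof. unfold scalR. vring. Qed.
Lemma scalR_distr_l (x : R) (u v : E) :
  scalR x (plus u v) = plus (scalR x u) (scalR x v).
Proof. unfold scalR. vring. Qed.
Lemma scalR_distr_r (x y : R) (u : E) :
  scalR (x + y) u = plus (scalR x u) (scalR y u).
Proof. unfold scalR. rewrite RtoC_plus. vring. Qed.

Definition ER_module_mixin : ModuleSpace.mixin_of R_Ring E :=
  ModuleSpace.Mixin R_Ring E scalR scalR_assoc scalR_one scalR_distr_l scalR_distr_r.
Definition ER_module : ModuleSpace.class_of R_Ring E :=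
  ModuleSpace.Class R_Ring E (AbelianGroup.class E) ER_module_mixin.
Definition ER_aux : NormedModuleAux.class_of R_AbsRing E :=
  NormedModuleAux.Class R_AbsRing E ER_module (UniformSpace.class E).

Lemma norm_scalR (l : R) (x : E) : norm (scalR l x) <= Rabs l * norm x.
Proof.
unfold scalR. rewrite <- Cmod_R. apply (@norm_scal C_AbsRing E (RtoC l) x).
Qed.

Definition ER_normed_mixin :
    NormedModule.mixin_of R_AbsRing (NormedModuleAux.Pack R_AbsRing E ER_aux E) :=
  NormedModule.Mixin R_AbsRing (NormedModuleAux.Pack R_AbsRing E ER_aux E)
    (fun x : E => norm x) (@norm_factor C_AbsRing E)
    (@norm_triangle C_AbsRing E) norm_scalR
    (@norm_compat1 C_AbsRing E) (@norm_compat2 C_AbsRing E) (@norm_eq_zero C_AbsRing E).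
Definition ER_normed : NormedModule.class_of R_AbsRing E :=
  NormedModule.Class R_AbsRing E ER_aux ER_normed_mixin.
Definition ER : CompleteNormedModule R_AbsRing :=
  CompleteNormedModule.Pack R_AbsRing E
    (CompleteNormedModule.Class R_AbsRing E ER_normed
      (CompleteSpace.mixin _ (CompleteSpace.class E))) E.
End RestrictScalars.

(* Canonical structure inference reaches the group structure of [E] along
   several convertible paths; this makes them syntactically equal. *)
Ltac norm_struct E :=
  change (ModuleSpace.AbelianGroup C_Ring (CompleteNormedModule.ModuleSpace C_AbsRing E))
    with (CompleteNormedModule.AbelianGroup C_AbsRing E) in *;
  change (ModuleSpace.AbelianMonoid C_Ring (CompleteNormedModule.ModuleSpace C_AbsRing E))
    with (CompleteNormedModule.AbelianMonoid C_AbsRing E) in *;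
  change (NormedModule.AbelianGroup C_AbsRing (CompleteNormedModule.NormedModule C_AbsRing E))
    with (CompleteNormedModule.AbelianGroup C_AbsRing E) in *;
  change (NormedModule.AbelianMonoid C_AbsRing (CompleteNormedModule.NormedModule C_AbsRing E))
    with (CompleteNormedModule.AbelianMonoid C_AbsRing E) in *;
  change (NormedModule.ModuleSpace C_AbsRing (CompleteNormedModule.NormedModule C_AbsRing E))
    with (CompleteNormedModule.ModuleSpace C_AbsRing E) in *.

(** * Integrals of functions with values in a complex Banach space *)

Section NormLemmas.
Context {E : CompleteNormedModule C_AbsRing}.
Implicit Types x y : E.

Lemma norm_plus_le x y : norm (plus x y) <= norm x + norm y.
Proof. apply (@norm_triangle C_AbsRing E). Qed.

Lemma norm_minus_le x y : norm (minus x y) <= norm x + norm y.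
Proof.
rewrite <- (@norm_opp C_AbsRing E y). apply (@norm_triangle C_AbsRing E x (opp y)).
Qed.

Lemma norm_minus_sym x y : norm (minus x y) = norm (minus y x).
Proof.
replace (minus x y) with (opp (minus y x)) by vring. apply (@norm_opp C_AbsRing E).
Qed.

Lemma norm_scal_le (c : C) x : norm (scal c x) <= Cmod c * norm x.
Proof. apply (@norm_scal C_AbsRing E c x). Qed.

(** The missing inequality is [norm_scal_le] applied to the scalar [/ c]. *)
Lemma norm_scal_eq (c : C) x : norm (scal c x) = Cmod c * norm x.
Proof.
apply Rle_antisym; [apply norm_scal_le|].
destruct (Ceq_dec c 0) as [->|Hc].
- rewrite Cmod_0, Rmult_0_l. apply norm_ge_0.
- replace x with (scal (/ c)%C (scal c x)) at 1 by (vcoefs; field; trivial).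
  assert (H := norm_scal_le (/ c)%C (scal c x)). rewrite Cmod_inv in H by trivial.
  assert (Hp : 0 < Cmod c) by now apply Cmod_gt_0.
  apply Rmult_le_compat_l with (r := Cmod c) in H; [|lra].
  rewrite <- Rmult_assoc, Rinv_r, Rmult_1_l in H by lra. exact H.
Qed.

Lemma norm_zero_E : norm (@zero E) = 0.
Proof. exact (@norm_zero C_AbsRing E). Qed.

Lemma norm_pos x : 0 <= norm x.
Proof. apply norm_ge_0. Qed.

Lemma norm_eq_zero_E x : norm x <= 0 -> x = zero.
Proof. intros H. apply (@norm_eq_zero C_AbsRing E). apply Rle_antisym; trivial. apply norm_pos. Qed.

Lemma minus_zero_eq x y : minus x y = zero -> x = y.
Proof. intros H. replace x with (plus (minus x y) y) by vring. rewrite H. vring. Qed.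

Lemma norm_eps_zero x k : (forall eps, 0 < eps -> norm x <= eps * k) -> x = zero.
Proof.
intros H. apply norm_eq_zero_E, Rnot_lt_le. intros Hx.
assert (Hk : 0 < 1 + Rabs k) by (generalize (Rabs_pos k); lra).
specialize (H (norm x / (2 * (1 + Rabs k)))).
assert (H0 : 0 < norm x / (2 * (1 + Rabs k))) by (apply Rdiv_lt_0_compat; lra).
specialize (H H0).
assert (norm x / (2 * (1 + Rabs k)) * k <= norm x / 2); [|lra].
apply Rle_trans with (norm x / (2 * (1 + Rabs k)) * (1 + Rabs k)).
- apply Rmult_le_compat_l; [lra|]. generalize (Rle_abs k); lra.
- apply Req_le. field. lra.
Qed.
End NormLemmas.

Section Integral.
Context {E : CompleteNormedModule C_AbsRing}.

Definition Cex (f : R -> E) (a b : R) : Prop := @ex_RInt (ER E) f a b.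
Definition CInt (f : R -> E) (a b : R) : E := @RInt (ER E) f a b.

Lemma Cex_continuous (f : R -> E) a b :
  (forall t, Rmin a b <= t <= Rmax a b -> continuous f t) -> Cex f a b.
Proof. exact (@ex_RInt_continuous (ER E) f a b). Qed.

Lemma Cex_minus (f g : R -> E) a b : Cex f a b -> Cex g a b ->
  Cex (fun t => minus (f t) (g t)) a b.
Proof. exact (@ex_RInt_minus (ER E) f g a b). Qed.

Lemma Cex_const (v : E) a b : Cex (fun _ => v) a b.
Proof. exact (@ex_RInt_const (ER E) a b v). Qed.

Lemma CInt_plus (f g : R -> E) a b : Cex f a b -> Cex g a b ->
  CInt (fun t => plus (f t) (g t)) a b = plus (CInt f a b) (CInt g a b).
Proof. exact (@RInt_plus (ER E) f g a b). Qed.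

Lemma CInt_minus (f g : R -> E) a b : Cex f a b -> Cex g a b ->
  CInt (fun t => minus (f t) (g t)) a b = minus (CInt f a b) (CInt g a b).
Proof. exact (@RInt_minus (ER E) f g a b). Qed.

Lemma CInt_ext (f g : R -> E) a b :
  (forall t, Rmin a b < t < Rmax a b -> f t = g t) -> CInt f a b = CInt g a b.
Proof. exact (@RInt_ext (ER E) f g a b). Qed.

Lemma CInt_const (v : E) a b : CInt (fun _ => v) a b = scal (RtoC (b - a)) v.
Proof. exact (@RInt_const (ER E) a b v). Qed.

Lemma CInt_Chasles (f : R -> E) a b c : Cex f a b -> Cex f b c ->
  plus (CInt f a b) (CInt f b c) = CInt f a c.
Proof. exact (@RInt_Chasles (ER E) f a b c). Qed.

Lemma CInt_norm_le (f : R -> E) a b M : a <= b -> Cex f a b ->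
  (forall t, a <= t <= b -> norm (f t) <= M) -> norm (CInt f a b) <= (b - a) * M.
Proof.
intros Hab Hf HM.
exact (@norm_RInt_le_const (ER E) f a b _ M Hab HM (@RInt_correct (ER E) f a b Hf)).
Qed.

Lemma Cex_bounded (f : R -> E) a b : a <= b -> Cex f a b ->
  exists M, forall t, a <= t <= b -> norm (f t) <= M.
Proof.
intros Hab Hf. destruct (@ex_RInt_ub (ER E) f a b Hf) as [M HM].
exists M. intros t Ht. apply HM. now rewrite Rmin_left, Rmax_right.
Qed.

(** Real linearity does not cover complex scalars: the identity is checked on Riemann sums and
    passes to the limit by continuity of [scal c]. *)
Lemma is_CInt_scal (c : C) (f : R -> E) a b (l : E) :
  @is_RInt (ER E) f a b l -> @is_RInt (ER E) (fun t => scal c (f t)) a b (scal c l).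
Proof.
intros Hf. unfold is_RInt.
apply (filterlim_ext (fun ptd : SF_seq =>
   scal c (@scal _ (ER E) (sign (b - a)) (@Riemann_sum (ER E) f ptd) : E))).
- intros ptd.
  assert (HS : @Riemann_sum (ER E) (fun t => scal c (f t)) ptd
     = scal c (@Riemann_sum (ER E) f ptd : E)).
  { apply (SF_cons_ind (fun s => @Riemann_sum (ER E) (fun t => scal c (f t)) s
     = scal c (@Riemann_sum (ER E) f s : E))).
    - intros x0. symmetry. exact (@scal_zero_r _ E c).
    - intros h s IH. rewrite !Riemann_sum_cons, IH.
      change (@eq E (plus (scal (RtoC (SF_h s - fst h)) (scal c (f (snd h))))
                (scal c (@Riemann_sum (ER E) f s : E)))
             (scal c (plus (scal (RtoC (SF_h s - fst h)) (f (snd h)))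
                           (@Riemann_sum (ER E) f s : E)))).
      vring. }
  refine (eq_trans _ (f_equal (fun x : E => scal (RtoC (sign (b - a))) x) (eq_sym HS))).
  change (@eq E (scal c (scal (RtoC (sign (b - a))) (@Riemann_sum (ER E) f ptd : E)))
   (scal (RtoC (sign (b - a))) (scal c (@Riemann_sum (ER E) f ptd : E)))).
  vring.
- eapply filterlim_comp; [exact Hf|]. exact (@filterlim_scal_r C_AbsRing E c l).
Qed.

Lemma Cex_scal (c : C) (f : R -> E) a b : Cex f a b -> Cex (fun t => scal c (f t)) a b.
Proof. intros [l Hl]. exists (scal c l). now apply is_CInt_scal. Qed.

Lemma CInt_scal (c : C) (f : R -> E) a b : Cex f a b ->
  CInt (fun t => scal c (f t)) a b = scal c (CInt f a b).
Proof.
intros Hf. apply (@is_RInt_unique (ER E)), is_CInt_scal.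
exact (@RInt_correct (ER E) f a b Hf).
Qed.

Lemma is_derive_eps (f : C -> E) (z : C) (l : E) :
  is_derive (K := C_AbsRing) f z l <->
  forall eps, 0 < eps -> exists delta, 0 < delta /\ forall h : C, Cmod h < delta ->
    norm (minus (minus (f (z + h)%C) (f z)) (scal h l)) <= eps * Cmod h.
Proof.
split.
- intros [_ H] eps Heps.
  specialize (H z (fun P HP => HP) (mkposreal eps Heps)).
  destruct H as [[d Hd] H]. exists d. split; trivial. intros h Hh.
  assert (Hz : @minus C_AbsRing (z + h)%C z = h).
  { change (@eq C (z + h - z) h)%C. ring. }
  assert (HB : Cmod (@minus C_AbsRing (z + h)%C z) < d) by (rewrite Hz; exact Hh).
  specialize (H (z + h)%C HB).
  exact (eq_ind _ (fun k : C => norm (minus (minus (f (z + h)%C) (f z)) (scal k l))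
     <= eps * Cmod k) H _ Hz).
- intros H. split; [apply @is_linear_scal_l|].
  intros y Hy. assert (y = z) as ->.
  { symmetry. apply (@is_filter_lim_locally_unique C_AbsRing (AbsRing_NormedModule C_AbsRing)). exact Hy. }
  intros [eps Heps]. destruct (H eps Heps) as [d [Hd Hh]].
  exists (mkposreal d Hd). intros w Hw. simpl.
  specialize (Hh (@minus C_AbsRing w z) Hw).
  assert (Hzw : forall w : C, (z + (w - z))%C = w) by (intros; ring).
  exact (eq_ind _ (fun k : C => norm (minus (minus (f k) (f z))
     (scal (@minus C_AbsRing w z) l)) <= eps * Cmod (@minus C_AbsRing w z)) Hh _ (Hzw w)).
Qed.

Lemma ex_derive_eps (f : C -> E) (z : C) : ex_derive (K := C_AbsRing) f z ->
  exists l : E, forall eps, 0 < eps -> exists delta, 0 < delta /\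
    forall h : C, Cmod h < delta ->
    norm (minus (minus (f (z + h)%C) (f z)) (scal h l)) <= eps * Cmod h.
Proof. intros [l Hl]. exists l. now apply is_derive_eps. Qed.

Lemma continuous_norm {U : UniformSpace} (f : U -> E) (x : U) :
  continuous f x <-> forall eps, 0 < eps -> locally x (fun y => norm (minus (f y) (f x)) < eps).
Proof.
split.
- intros H eps Heps.
  assert (Hn := @norm_factor_gt_0 _ E).
  assert (He : 0 < eps / @norm_factor _ E) by now apply Rdiv_lt_0_compat.
  specialize (H (ball (f x) (mkposreal _ He)) (locally_ball _ _)).
  unfold filtermap in H. revert H. apply filter_imp. intros y Hy.
  apply (@norm_compat2 _ E) in Hy. simpl in Hy.
  replace eps with (@norm_factor _ E * (eps / @norm_factor _ E)) by (field; lra).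
  exact Hy.
- intros H P [[eps Heps] HP]. unfold filtermap. generalize (H eps Heps).
  apply filter_imp. intros y Hy. apply HP. now apply (@norm_compat1 _ E).
Qed.

Lemma CInt_derive (F f : R -> E) a b :
  (forall x, Rmin a b <= x <= Rmax a b ->
     forall eps, 0 < eps -> exists delta, 0 < delta /\ forall h : R, Rabs h < delta ->
     norm (minus (minus (F (x + h)) (F x)) (scal (RtoC h) (f x))) <= eps * Rabs h) ->
  (forall x, Rmin a b <= x <= Rmax a b -> continuous f x) ->
  CInt f a b = minus (F b) (F a).
Proof.
intros HF Hf. apply (@is_RInt_unique (ER E)). apply (@is_RInt_derive (ER E)); trivial.
intros x Hx. split; [apply @is_linear_scal_l|].
intros y Hy. assert (y = x) as ->.
{ symmetry. apply (@is_filter_lim_locally_unique R_AbsRing R_NormedModule). exact Hy. }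
intros [eps Heps]. destruct (HF x Hx eps Heps) as [d [Hd Hh]].
exists (mkposreal d Hd). intros w Hw. simpl.
specialize (Hh (w - x) Hw).
assert (Hxw : forall w : R, x + (w - x) = w) by (intros; ring).
rewrite Hxw in Hh. exact Hh.
Qed.

End Integral.

(** * The Cauchy-Goursat theorem on rectangles *)

Lemma nested_intervals (a b : nat -> R) :
  (forall n, a n <= a (S n)) -> (forall n, b (S n) <= b n) -> (forall n, a n <= b n) ->
  exists x, forall n, a n <= x <= b n.
Proof.
intros Ha Hb Hab.
assert (Ha' : forall n k, a n <= a (n + k)%nat).
{ intros n k; induction k as [|k IH]; [rewrite Nat.add_0_r; lra|].
  rewrite Nat.add_succ_r. specialize (Ha (n + k)%nat). lra. }
assert (Hb' : forall n k, b (n + k)%nat <= b n).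
{ intros n k; induction k as [|k IH]; [rewrite Nat.add_0_r; lra|].
  rewrite Nat.add_succ_r. specialize (Hb (n + k)%nat). lra. }
assert (Hnm : forall n m, a n <= b m).
{ intros n m. apply Rle_trans with (a (n + m)%nat); [apply Ha'|].
  apply Rle_trans with (b (n + m)%nat); [apply Hab|].
  rewrite Nat.add_comm. apply Hb'. }
destruct (completeness (fun x => exists n, x = a n)) as [x [Hx1 Hx2]].
- exists (b O). intros y [n ->]. apply Hnm.
- exists (a O), O. reflexivity.
- exists x. intros n. split.
  + apply Hx1. now exists n.
  + apply Hx2. intros y [m ->]. apply Hnm.
Qed.

(** Compactness by bisection: if [P] failed, some quarter would fail, and so on; the failing
    quarters shrink to a point, near which [P] holds. *)
Lemma rectangle_bisection (P : R -> R -> R -> R -> Prop) (a0 b0 c0 d0 : R) :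
  (forall a b c d, a0 <= a -> a <= b -> b <= b0 -> c0 <= c -> c <= d -> d <= d0 ->
     P a ((a + b) / 2) c ((c + d) / 2) -> P ((a + b) / 2) b c ((c + d) / 2) ->
     P a ((a + b) / 2) ((c + d) / 2) d -> P ((a + b) / 2) b ((c + d) / 2) d ->
     P a b c d) ->
  (forall x y, a0 <= x <= b0 -> c0 <= y <= d0 -> exists delta, 0 < delta /\
     forall a b c d, a0 <= a -> a <= x <= b -> b <= b0 ->
       c0 <= c -> c <= y <= d -> d <= d0 ->
       b - a < delta -> d - c < delta -> P a b c d) ->
  a0 <= b0 -> c0 <= d0 -> P a0 b0 c0 d0.
Proof.
intros Hsplit Hloc H0 H1. apply NNPP. intros HP.
set (Inv := fun q : (R * R) * (R * R) =>
  let '((a, b), (c, d)) := q in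
  (a0 <= a /\ a <= b /\ b <= b0 /\ c0 <= c /\ c <= d /\ d <= d0) /\ ~ P a b c d).
set (Rel := fun q q' : (R * R) * (R * R) =>
  let '((a, b), (c, d)) := q in let '((a', b'), (c', d')) := q' in
  a <= a' /\ b' <= b /\ b' - a' = (b - a) / 2 /\
  c <= c' /\ d' <= d /\ d' - c' = (d - c) / 2).
(* If no quarter failed, [Hsplit] would give [P] on the whole rectangle. *)
assert (step : forall q : {q | Inv q}, exists q' : {q | Inv q}, Rel (proj1_sig q) (proj1_sig q')).
{ intros [[[a b] [c d]] [Hq HPq]]. simpl.
  apply NNPP. intros Hn. apply HPq.
  apply Hsplit; try lra; apply NNPP; intros HQ; apply Hn.
  - assert (HI : Inv ((a, (a + b) / 2), (c, (c + d) / 2))) by (split; trivial; lra).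
    exists (exist _ _ HI). simpl. lra.
  - assert (HI : Inv (((a + b) / 2, b), (c, (c + d) / 2))) by (split; trivial; lra).
    exists (exist _ _ HI). simpl. lra.
  - assert (HI : Inv ((a, (a + b) / 2), ((c + d) / 2, d))) by (split; trivial; lra).
    exists (exist _ _ HI). simpl. lra.
  - assert (HI : Inv (((a + b) / 2, b), ((c + d) / 2, d))) by (split; trivial; lra).
    exists (exist _ _ HI). simpl. lra. }
set (next := fun q => proj1_sig (constructive_indefinite_description _ (step q))).
assert (Hnext : forall q, Rel (proj1_sig q) (proj1_sig (next q))).
{ intros q. exact (proj2_sig (constructive_indefinite_description _ (step q))). }
assert (HI0 : Inv ((a0, b0), (c0, d0))) by (split; trivial; lra).
set (s := fun n => Nat.iter n next (exist _ _ HI0)).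
set (a := fun n => fst (fst (proj1_sig (s n)))).
set (b := fun n => snd (fst (proj1_sig (s n)))).
set (c := fun n => fst (snd (proj1_sig (s n)))).
set (d := fun n => snd (snd (proj1_sig (s n)))).
assert (HIn : forall n, (a0 <= a n /\ a n <= b n /\ b n <= b0 /\
   c0 <= c n /\ c n <= d n /\ d n <= d0) /\ ~ P (a n) (b n) (c n) (d n)).
{ intros n. unfold a, b, c, d. destruct (s n) as [[[? ?] [? ?]] Hs]. exact Hs. }
assert (HRn : forall n, a n <= a (S n) /\ b (S n) <= b n /\ b (S n) - a (S n) = (b n - a n) / 2
  /\ c n <= c (S n) /\ d (S n) <= d n /\ d (S n) - c (S n) = (d n - c n) / 2).
{ intros n. specialize (Hnext (s n)). unfold a, b, c, d.
  change (s (S n)) with (next (s n)).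
  destruct (next (s n)) as [[[? ?] [? ?]] ?], (s n) as [[[? ?] [? ?]] ?]. exact Hnext. }
destruct (nested_intervals a b) as [x Hx]; try (intros n; generalize (HRn n) (HIn n); tauto).
destruct (nested_intervals c d) as [y Hy]; try (intros n; generalize (HRn n) (HIn n); tauto).
destruct (Hloc x y) as [delta [Hd HPd]].
{ generalize (Hx O) (HIn O). lra. }
{ generalize (Hy O) (HIn O). lra. }
assert (Hw : forall n, b n - a n = (b0 - a0) * (/ 2) ^ n /\ d n - c n = (d0 - c0) * (/ 2) ^ n).
{ induction n as [|n IH]; [simpl; split; unfold a, b, c, d; simpl; ring|].
  generalize (HRn n). simpl. intros HR. split; nra. }
(* Bounds both side lengths; the summand 1 keeps it positive for a degenerate rectangle. *)
set (w := (b0 - a0) + (d0 - c0) + 1).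
destruct (pow_lt_1_zero (/ 2)) with (y := delta / w) as [N HN].
{ rewrite Rabs_right; lra. }
{ apply Rdiv_lt_0_compat; unfold w; lra. }
specialize (HN N (le_n N)). rewrite Rabs_right in HN by (apply Rle_ge, pow_le; lra).
assert (HN' : w * (/ 2) ^ N < delta).
{ apply Rmult_lt_compat_r with (r := w) in HN; [|unfold w; lra].
  replace (delta / w * w) with delta in HN by (field; unfold w; lra). lra. }
assert (Hp : 0 < (/ 2) ^ N) by (apply pow_lt; lra).
destruct (Hw N) as [Hw1 Hw2]. unfold w in HN'.
apply (proj2 (HIn N)). generalize (HIn N) (Hx N) (Hy N). intros HI HX HY.
apply HPd; try lra; nra.
Qed.

Lemma Cmod_le_abs (z : C) : Cmod z <= Rabs (fst z) + Rabs (snd z).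
Proof.
destruct z as [x y]. simpl.
replace (x, y) with (RtoC x + Ci * RtoC y)%C.
2:{ unfold RtoC, Ci, Cplus, Cmult; simpl; f_equal; ring. }
eapply Rle_trans; [apply Cmod_triangle|].
rewrite Cmod_mult, Cmod_Ci, !Cmod_R. lra.
Qed.

Section Rectangles.
Context {E : CompleteNormedModule C_AbsRing}.
Implicit Types f g F : C -> E.

Lemma ex_derive_near f z : ex_derive (K := C_AbsRing) f z ->
  forall eps, 0 < eps -> exists delta, 0 < delta /\ forall h : C, Cmod h < delta ->
    norm (minus (f (z + h)%C) (f z)) < eps.
Proof.
intros Hf eps Heps. destruct (ex_derive_eps f z Hf) as [l Hl].
destruct (Hl 1 Rlt_0_1) as [d [Hd H]].
assert (Hn := norm_ge_0 l).
exists (Rmin d (eps / (2 + norm l))). split.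
{ apply Rmin_pos; trivial. apply Rdiv_lt_0_compat; lra. }
intros h Hh. specialize (H h (Rlt_le_trans _ _ _ Hh (Rmin_l _ _))).
assert (Hh2 := Rlt_le_trans _ _ _ Hh (Rmin_r _ _)).
replace (minus (f (z + h)%C) (f z)) with
  (plus (minus (minus (f (z + h)%C) (f z)) (scal h l)) (scal h l)) by vring.
eapply Rle_lt_trans; [apply norm_plus_le|].
assert (Hs := norm_scal_le h l).
apply Rmult_lt_compat_r with (r := 2 + norm l) in Hh2; [|lra].
replace (eps / (2 + norm l) * (2 + norm l)) with eps in Hh2 by (field; lra).
generalize (Cmod_ge_0 h). nra.
Qed.

Lemma continuous_path f (g : R -> C) t : ex_derive (K := C_AbsRing) f (g t) ->
  (forall eps, 0 < eps -> exists delta, 0 < delta /\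
     forall u, Rabs (u - t) < delta -> Cmod (g u - g t)%C < eps) ->
  continuous (fun u => f (g u)) t.
Proof.
intros Hf Hg. rewrite continuous_norm. intros eps Heps.
destruct (ex_derive_near f (g t) Hf eps Heps) as [d [Hd H]].
destruct (Hg d Hd) as [d' [Hd' H']].
exists (mkposreal d' Hd'). intros u Hu. specialize (H _ (H' u Hu)).
replace (g t + (g u - g t))%C with (g u) in H by ring. exact H.
Qed.

Lemma Cmod_hline (u t y : R) : Cmod ((u, y) - (t, y))%C = Rabs (u - t).
Proof.
rewrite <- Cmod_R. f_equal. unfold Cminus, Cplus, Copp, RtoC; simpl; f_equal; ring.
Qed.

Lemma Cmod_vline (x u t : R) : Cmod ((x, u) - (x, t))%C = Rabs (u - t).
Proof.
replace ((x, u) - (x, t))%C with (Ci * RtoC (u - t))%C.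
- rewrite Cmod_mult, Cmod_Ci, Cmod_R. ring.
- unfold Cminus, Cplus, Copp, RtoC, Ci, Cmult; simpl; f_equal; ring.
Qed.

Lemma continuous_hline f x y : ex_derive (K := C_AbsRing) f (x, y) ->
  continuous (fun u => f (u, y)) x.
Proof.
intros Hf. apply (continuous_path f (fun u => (u, y))); trivial.
intros eps Heps. exists eps. split; trivial. intros u. now rewrite Cmod_hline.
Qed.

Lemma continuous_vline f x y : ex_derive (K := C_AbsRing) f (x, y) ->
  continuous (fun u => f (x, u)) y.
Proof.
intros Hf. apply (continuous_path f (fun u => (x, u))); trivial.
intros eps Heps. exists eps. split; trivial. intros u. now rewrite Cmod_vline.
Qed.

(** The integral of [f dz] along the counterclockwise boundary of [[a,b] x [c,d]]; the factor [Ci]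
    comes from [dz = i dy] on the vertical sides. *)
Definition oint f a b c d : E :=
  minus (plus (CInt (fun x => f (x, c)) a b) (scal Ci (CInt (fun y => f (b, y)) c d)))
        (plus (CInt (fun x => f (x, d)) a b) (scal Ci (CInt (fun y => f (a, y)) c d))).

Definition edges f a b c d : Prop :=
  Cex (fun x => f (x, c)) a b /\ Cex (fun y => f (b, y)) c d /\
  Cex (fun x => f (x, d)) a b /\ Cex (fun y => f (a, y)) c d.

Lemma Cex_hline f y a b : a <= b ->
  (forall x, a <= x <= b -> ex_derive (K := C_AbsRing) f (x, y)) ->
  Cex (fun x => f (x, y)) a b.
Proof.
intros Hab Hf. apply Cex_continuous. intros t Ht.
rewrite Rmin_left, Rmax_right in Ht by trivial. now apply continuous_hline, Hf.
Qed.

Lemma Cex_vline f x c d : c <= d ->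
  (forall y, c <= y <= d -> ex_derive (K := C_AbsRing) f (x, y)) ->
  Cex (fun y => f (x, y)) c d.
Proof.
intros Hab Hf. apply Cex_continuous. intros t Ht.
rewrite Rmin_left, Rmax_right in Ht by trivial. now apply continuous_vline, Hf.
Qed.

Lemma edges_holo f a b c d : a <= b -> c <= d ->
  (forall x y, a <= x <= b -> c <= y <= d -> ex_derive (K := C_AbsRing) f (x, y)) ->
  edges f a b c d.
Proof.
intros Hab Hcd Hf.
refine (conj (Cex_hline f c a b _ _) (conj (Cex_vline f b c d _ _)
  (conj (Cex_hline f d a b _ _) (Cex_vline f a c d _ _)))); trivial;
  intros; apply Hf; lra.
Qed.

Lemma oint_split_x f a m b c d :
  Cex (fun x => f (x, c)) a m -> Cex (fun x => f (x, c)) m b ->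
  Cex (fun x => f (x, d)) a m -> Cex (fun x => f (x, d)) m b ->
  oint f a b c d = plus (oint f a m c d) (oint f m b c d).
Proof.
intros H1 H2 H3 H4. unfold oint.
rewrite <- (CInt_Chasles (fun x => f (x, c)) a m b) by trivial.
rewrite <- (CInt_Chasles (fun x => f (x, d)) a m b) by trivial. vring.
Qed.

Lemma oint_split_y f a b c m d :
  Cex (fun y => f (a, y)) c m -> Cex (fun y => f (a, y)) m d ->
  Cex (fun y => f (b, y)) c m -> Cex (fun y => f (b, y)) m d ->
  oint f a b c d = plus (oint f a b c m) (oint f a b m d).
Proof.
intros H1 H2 H3 H4. unfold oint.
rewrite <- (CInt_Chasles (fun y => f (a, y)) c m d) by trivial.
rewrite <- (CInt_Chasles (fun y => f (b, y)) c m d) by trivial. vring.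
Qed.

Lemma oint_minus f g a b c d : edges f a b c d -> edges g a b c d ->
  oint (fun z => minus (f z) (g z)) a b c d = minus (oint f a b c d) (oint g a b c d).
Proof.
intros [F1 [F2 [F3 F4]]] [G1 [G2 [G3 G4]]]. unfold oint.
rewrite !CInt_minus by trivial. vring.
Qed.

Lemma norm_oint_le f a b c d M : a <= b -> c <= d -> edges f a b c d ->
  (forall x y, a <= x <= b -> c <= y <= d -> (x = a \/ x = b \/ y = c \/ y = d) ->
     norm (f (x, y)) <= M) ->
  norm (oint f a b c d) <= 2 * ((b - a) + (d - c)) * M.
Proof.
intros Hab Hcd [F1 [F2 [F3 F4]]] HM. unfold oint.
assert (B1 := CInt_norm_le _ a b M Hab F1).
assert (B2 := CInt_norm_le _ c d M Hcd F2).
assert (B3 := CInt_norm_le _ a b M Hab F3).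
assert (B4 := CInt_norm_le _ c d M Hcd F4).
assert (Hi : forall v : E, norm (scal Ci v) <= norm v).
{ intros v. generalize (norm_scal_le Ci v). rewrite Cmod_Ci. lra. }
eapply Rle_trans; [apply norm_minus_le|].
eapply Rle_trans; [apply Rplus_le_compat; apply norm_plus_le|].
generalize (Hi (CInt (fun y => f (b, y)) c d)) (Hi (CInt (fun y => f (a, y)) c d)).
assert (norm (CInt (fun x => f (x, c)) a b) <= (b - a) * M) by (apply B1; intros; apply HM; auto; lra).
assert (norm (CInt (fun x => f (x, d)) a b) <= (b - a) * M) by (apply B3; intros; apply HM; auto; lra).
assert (norm (CInt (fun y => f (a, y)) c d) <= (d - c) * M) by (apply B4; intros; apply HM; auto; lra).
assert (norm (CInt (fun y => f (b, y)) c d) <= (d - c) * M) by (apply B2; intros; apply HM; auto; lra).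
lra.
Qed.

Lemma is_derive_primitive_hline F f a b y : a <= b ->
  (forall x, a <= x <= b -> is_derive (K := C_AbsRing) F (x, y) (f (x, y))) ->
  (forall x, a <= x <= b -> ex_derive (K := C_AbsRing) f (x, y)) ->
  CInt (fun x => f (x, y)) a b = minus (F (b, y)) (F (a, y)).
Proof.
intros Hab HF Hf. apply (CInt_derive (fun x => F (x, y))); rewrite Rmin_left, Rmax_right by trivial.
- intros x Hx eps Heps. specialize (HF x Hx). rewrite is_derive_eps in HF.
  destruct (HF eps Heps) as [d [Hd H]]. exists d. split; trivial. intros h Hh.
  specialize (H (RtoC h)). rewrite Cmod_R in H.
  replace ((x, y) + RtoC h)%C with (x + h, y) in H; [now apply H|].
  unfold RtoC, Cplus; simpl; f_equal; ring.
- intros x Hx. apply continuous_hline; auto.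
Qed.

Lemma is_derive_primitive_vline F f x c d : c <= d ->
  (forall y, c <= y <= d -> is_derive (K := C_AbsRing) F (x, y) (f (x, y))) ->
  (forall y, c <= y <= d -> ex_derive (K := C_AbsRing) f (x, y)) ->
  scal Ci (CInt (fun y => f (x, y)) c d) = minus (F (x, d)) (F (x, c)).
Proof.
intros Hcd HF Hf.
assert (Hc : forall y, c <= y <= d -> continuous (fun y => f (x, y)) y).
{ intros y Hy. apply continuous_vline; auto. }
rewrite <- CInt_scal.
2:{ apply Cex_continuous. now rewrite Rmin_left, Rmax_right. }
apply (CInt_derive (fun y => F (x, y))); rewrite Rmin_left, Rmax_right by trivial.
- intros y Hy eps Heps. specialize (HF y Hy). rewrite is_derive_eps in HF.
  destruct (HF eps Heps) as [dl [Hd H]]. exists dl. split; trivial. intros h Hh.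
  specialize (H (Ci * RtoC h)%C). rewrite Cmod_mult, Cmod_Ci, Cmod_R, Rmult_1_l in H.
  replace ((x, y) + Ci * RtoC h)%C with (x, y + h) in H.
  2:{ unfold RtoC, Cplus, Cmult, Ci; simpl; f_equal; ring. }
  replace (scal (RtoC h) (scal Ci (f (x, y)))) with (scal (Ci * RtoC h)%C (f (x, y))) by vring.
  now apply H.
- intros y Hy. apply (@continuous_scal_r _ C_AbsRing E). now apply Hc.
Qed.

Lemma oint_primitive F f a b c d : a <= b -> c <= d ->
  (forall x y, a <= x <= b -> c <= y <= d -> is_derive (K := C_AbsRing) F (x, y) (f (x, y))) ->
  (forall x y, a <= x <= b -> c <= y <= d -> ex_derive (K := C_AbsRing) f (x, y)) ->
  oint f a b c d = zero.
Proof.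
intros Hab Hcd HF Hf. unfold oint.
rewrite (is_derive_primitive_hline F f a b c), (is_derive_primitive_hline F f a b d),
  (is_derive_primitive_vline F f b c d), (is_derive_primitive_vline F f a c d);
  trivial; try (intros; (apply HF || apply Hf); lra).
vring.
Qed.

Lemma is_derive_affine (p : C) (u v : E) (z : C) :
  is_derive (K := C_AbsRing) (fun z : C => plus u (scal (z - p)%C v)) z v.
Proof.
rewrite is_derive_eps. intros eps Heps. exists 1. split; [lra|]. intros h _.
replace (minus _ _) with (@zero E) by vring.
rewrite norm_zero_E. generalize (Cmod_ge_0 h); nra.
Qed.

(** The first-order expansion of [f] at a point thus has a primitive, and subtracting it in
    Goursat's argument leaves boundary integrals unchanged. *)
Lemma is_derive_affine_primitive (p : C) (u v : E) (z : C) :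
  is_derive (K := C_AbsRing)
    (fun z : C => plus (scal (z - p)%C u) (scal ((z - p) * (z - p) / 2)%C v)) z
    (plus u (scal (z - p)%C v)).
Proof.
rewrite is_derive_eps. intros eps Heps. assert (Hn := norm_ge_0 v).
exists (eps / (1 + norm v)). split; [apply Rdiv_lt_0_compat; lra|]. intros h Hh.
replace (minus _ _) with (scal (h * (h / 2))%C v) by (vcoefs; field).
eapply Rle_trans; [apply norm_scal_le|].
assert (H2 : Cmod (RtoC 2) = 2) by (rewrite Cmod_R, Rabs_right; lra).
rewrite Cmod_mult, Cmod_div, H2 by (intros K; injection K; lra).
apply Rmult_lt_compat_r with (r := 1 + norm v) in Hh; [|lra].
replace (eps / (1 + norm v) * (1 + norm v)) with eps in Hh by (field; lra).
generalize (Cmod_ge_0 h); intros Hc.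
assert (Cmod h * norm v / 2 <= eps) by nra. nra.
Qed.

(* The bound [eps * (width + height)^2] is exactly preserved when a rectangle is cut
   into four equal ones. *)
Theorem goursat f a b c d : a <= b -> c <= d ->
  (forall x y, a <= x <= b -> c <= y <= d -> ex_derive (K := C_AbsRing) f (x, y)) ->
  oint f a b c d = zero.
Proof.
intros Hab Hcd Hf. apply (norm_eps_zero _ (((b - a) + (d - c)) ^ 2)). intros eps Heps.
  apply (rectangle_bisection
    (fun a b c d => norm (oint f a b c d) <= eps * ((b - a) + (d - c)) ^ 2) a b c d); trivial.
  - intros a' b' c' d' A1 A2 A3 A4 A5 A6 H1 H2 H3 H4.
    set (m := (a' + b') / 2) in *. set (n := (c' + d') / 2) in *.
    assert (Hm : a' <= m <= b') by (unfold m; lra).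
    assert (Hn : c' <= n <= d') by (unfold n; lra).
    rewrite (oint_split_x f a' m b' c' d'); [|apply Cex_hline; [lra|intros; apply Hf; lra] ..].
    rewrite (oint_split_y f a' m c' n d'); [|apply Cex_vline; [lra|intros; apply Hf; lra] ..].
    rewrite (oint_split_y f m b' c' n d'); [|apply Cex_vline; [lra|intros; apply Hf; lra] ..].
    eapply Rle_trans; [apply norm_plus_le|].
    eapply Rle_trans; [apply Rplus_le_compat; apply norm_plus_le|].
    replace (eps * (b' - a' + (d' - c')) ^ 2) with
      (4 * (eps * ((b' - a') / 2 + (d' - c') / 2) ^ 2)) by field.
    replace (m - a') with ((b' - a') / 2) in * by (unfold m; field).
    replace (b' - m) with ((b' - a') / 2) in * by (unfold m; field).
    replace (n - c') with ((d' - c') / 2) in * by (unfold n; field).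
    replace (d' - n) with ((d' - c') / 2) in * by (unfold n; field).
    lra.
  - intros x y Hx Hy. destruct (ex_derive_eps f _ (Hf x y Hx Hy)) as [l Hl].
    (* The perimeter is twice [width + height], hence the half of [eps]; likewise [dl / 2] below
       makes [width + height] smaller than [dl]. *)
    assert (He : 0 < eps / 2) by lra.
    destruct (Hl (eps / 2) He) as [dl [Hd H]].
    exists (dl / 2). split; [lra|]. intros a' b' c' d' A1 A2 A3 A4 A5 A6 A7 A8.
    set (A := fun z : C => plus (f (x, y)) (scal (z - (x, y))%C l)).
    assert (HA : forall z, ex_derive (K := C_AbsRing) A z).
    { intros z. exists l. apply is_derive_affine. }
    assert (HfE : edges f a' b' c' d') by (apply edges_holo; try lra; intros; apply Hf; lra).
    assert (HAE : edges A a' b' c' d') by (apply edges_holo; try lra; intros; apply HA).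
    replace (oint f a' b' c' d') with (oint (fun z => minus (f z) (A z)) a' b' c' d').
    2:{ rewrite oint_minus by trivial.
        replace (oint A a' b' c' d') with (@zero E); [vring|]. symmetry.
        eapply oint_primitive; try lra; intros; [apply is_derive_affine_primitive|apply HA]. }
    replace (eps * (b' - a' + (d' - c')) ^ 2) with
      (2 * ((b' - a') + (d' - c')) * (eps / 2 * ((b' - a') + (d' - c')))) by field.
    apply norm_oint_le; try lra.
    { destruct HfE as [? [? [? ?]]], HAE as [? [? [? ?]]].
      refine (conj _ (conj _ (conj _ _))); apply Cex_minus; trivial. }
    intros x' y' Hx' Hy' _.
    assert (Hh : Cmod ((x', y') - (x, y))%C <= (b' - a') + (d' - c')).
    { eapply Rle_trans; [apply Cmod_le_abs|]. simpl.
      apply Rplus_le_compat; apply Rabs_le; lra. }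
    specialize (H ((x', y') - (x, y))%C).
    assert (Hr : forall p r : C, (p + (r - p))%C = r) by (intros; ring).
    rewrite Hr in H.
    replace (minus (f (x', y')) (A (x', y'))) with
      (minus (minus (f (x', y')) (f (x, y))) (scal ((x', y') - (x, y))%C l)) by (unfold A; vring).
    eapply Rle_trans; [apply H; lra|]. apply Rmult_le_compat_l; lra.
Qed.

(** The rectangle is cut into five around the exceptional point. The four outer pieces give zero,
    and the central square of side [2 * eta] has perimeter [8 * eta] with integrand bounded by [B];
    [eta] is arbitrarily small. *)
Lemma goursat_exceptional f a b c d p1 p2 eta0 B : a < p1 < b -> c < p2 < d ->
  0 < eta0 ->
  (forall x y, a <= x <= b -> c <= y <= d -> (x, y) <> (p1, p2) ->
     ex_derive (K := C_AbsRing) f (x, y)) ->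
  (forall x y, Rabs (x - p1) <= eta0 -> Rabs (y - p2) <= eta0 -> (x, y) <> (p1, p2) ->
     norm (f (x, y)) <= B) ->
  oint f a b c d = zero.
Proof.
intros Hp1 Hp2 Heta0 Hf HfB.
assert (Hsmall : forall eta, 0 < eta -> eta <= eta0 -> eta < p1 - a -> eta < b - p1 -> eta < p2 - c ->
   eta < d - p2 -> norm (oint f a b c d) <= 8 * eta * B).
{ intros eta E0 E00 E1 E2 E3 E4.
  assert (Hx : forall x y, a <= x <= b -> c <= y <= d -> x <> p1 -> ex_derive (K := C_AbsRing) f (x, y)).
  { intros x y H1 H2 H3. apply Hf; trivial. intros K; injection K; tauto. }
  assert (Hy : forall x y, a <= x <= b -> c <= y <= d -> y <> p2 -> ex_derive (K := C_AbsRing) f (x, y)).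
  { intros x y H1 H2 H3. apply Hf; trivial. intros K; injection K; tauto. }
  rewrite (oint_split_y f a b c (p2 - eta) d); [|apply Cex_vline; [lra|intros; apply Hx; lra] ..].
  rewrite (oint_split_y f a b (p2 - eta) (p2 + eta) d);
    [|apply Cex_vline; [lra|intros; apply Hx; lra] ..].
  rewrite (oint_split_x f a (p1 - eta) b (p2 - eta) (p2 + eta));
    [|apply Cex_hline; [lra|intros; apply Hy; lra] ..].
  rewrite (oint_split_x f (p1 - eta) (p1 + eta) b (p2 - eta) (p2 + eta));
    [|apply Cex_hline; [lra|intros; apply Hy; lra] ..].
  rewrite (goursat f a b c (p2 - eta)), (goursat f a b (p2 + eta) d),
    (goursat f a (p1 - eta) (p2 - eta) (p2 + eta)), (goursat f (p1 + eta) b (p2 - eta) (p2 + eta));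
    try lra; try (intros; (apply Hx; lra) || (apply Hy; lra)).
  replace (plus _ _) with (oint f (p1 - eta) (p1 + eta) (p2 - eta) (p2 + eta)) by vring.
  replace (8 * eta * B) with
    (2 * ((p1 + eta - (p1 - eta)) + (p2 + eta - (p2 - eta))) * B) by ring.
  apply norm_oint_le; try lra.
  - refine (conj (Cex_hline f _ _ _ _ _) (conj (Cex_vline f _ _ _ _ _)
      (conj (Cex_hline f _ _ _ _ _) (Cex_vline f _ _ _ _ _)))); try lra;
      intros; (apply Hx; lra) || (apply Hy; lra).
  - intros x y H1 H2 H3. apply HfB; try (apply Rabs_le; lra). intros K; injection K; lra. }
apply (norm_eps_zero _ (8 * Rabs B)). intros eps Heps.
set (eta := Rmin (Rmin eps eta0) (Rmin (Rmin ((p1 - a) / 2) ((b - p1) / 2))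
   (Rmin ((p2 - c) / 2) ((d - p2) / 2)))).
assert (Heta : 0 < eta) by (unfold eta; repeat apply Rmin_pos; lra).
assert (Hr0 : eta <= Rmin eps eta0) by apply Rmin_l.
assert (Hr01 := Rle_trans _ _ _ Hr0 (Rmin_l _ _)).
assert (Hr02 := Rle_trans _ _ _ Hr0 (Rmin_r _ _)).
assert (Hr : eta <= Rmin (Rmin ((p1 - a) / 2) ((b - p1) / 2))
   (Rmin ((p2 - c) / 2) ((d - p2) / 2))) by apply Rmin_r.
assert (Hr1 := Rle_trans _ _ _ Hr (Rmin_l _ _)).
assert (Hr2 := Rle_trans _ _ _ Hr (Rmin_r _ _)).
assert (Hr3 := Rle_trans _ _ _ Hr1 (Rmin_l _ _)).
assert (Hr4 := Rle_trans _ _ _ Hr1 (Rmin_r _ _)).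
assert (Hr5 := Rle_trans _ _ _ Hr2 (Rmin_l _ _)).
assert (Hr6 := Rle_trans _ _ _ Hr2 (Rmin_r _ _)).
eapply Rle_trans; [apply (Hsmall eta); lra|].
generalize (Rle_abs B) (Rabs_pos B). nra.
Qed.

End Rectangles.

(** * The complex exponential *)

Definition Cexp (z : C) : C := (exp (fst z) * cos (snd z), exp (fst z) * sin (snd z)).

Lemma Cexp_plus (z w : C) : Cexp (z + w)%C = (Cexp z * Cexp w)%C.
Proof.
destruct z as [a b], w as [c d]. unfold Cexp, Cplus, Cmult; simpl.
rewrite exp_plus, cos_plus, sin_plus. f_equal; ring.
Qed.

Lemma Cmod_Cexp (z : C) : Cmod (Cexp z) = exp (fst z).
Proof.
destruct z as [a b]. unfold Cexp, Cmod; simpl.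
replace (_ + _) with (exp a * exp a * ((sin b)² + (cos b)²)) by (unfold Rsqr; ring).
rewrite sin2_cos2, Rmult_1_r. apply sqrt_square. generalize (exp_pos a); lra.
Qed.

Lemma Cexp_neq_0 (z : C) : Cexp z <> 0%C.
Proof. apply Cmod_gt_0. rewrite Cmod_Cexp. apply exp_pos. Qed.

Lemma Cexp_0 : Cexp 0%C = 1%C.
Proof. unfold Cexp; simpl. rewrite exp_0, cos_0, sin_0. unfold RtoC; f_equal; ring. Qed.

Lemma Cexp_opp (z : C) : Cexp (- z)%C = (/ Cexp z)%C.
Proof.
assert (H : (Cexp (- z) * Cexp z = 1)%C).
{ rewrite <- Cexp_plus, <- Cexp_0. f_equal. ring. }
assert (Hz := Cexp_neq_0 z).
replace (Cexp (- z))%C with (Cexp (- z) * Cexp z / Cexp z)%C by (field; trivial).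
rewrite H. field; trivial.
Qed.

Lemma Cexp_period x y : Cexp (x, y + 2 * PI) = Cexp (x, y).
Proof. unfold Cexp; simpl. rewrite cos_plus, sin_plus, cos_2PI, sin_2PI. f_equal; ring. Qed.

Lemma cos_eq_1 x : cos x = 1 -> exists k : Z, x = IZR k * (2 * PI).
Proof.
intros H. assert (Hs : sin (x / 2) = 0).
{ assert (H2 : cos (2 * (x / 2)) = 1) by (replace (2 * (x / 2)) with x by field; trivial).
  rewrite cos_2a_sin in H2. nra. }
destruct (sin_eq_0_0 _ Hs) as [k Hk]. exists k. lra.
Qed.

Lemma Cexp_inj x y x' y' : Rabs (y - y') < 2 * PI -> Cexp (x, y) = Cexp (x', y') ->
  (x, y) = (x', y').
Proof.
intros Hy H. assert (Hx : x = x').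
{ apply exp_inv. generalize (f_equal Cmod H). now rewrite !Cmod_Cexp. }
subst x'. unfold Cexp in H; simpl in H. injection H; intros Hs Hc.
assert (He := exp_pos x).
apply Rmult_eq_reg_l in Hs; [|lra]. apply Rmult_eq_reg_l in Hc; [|lra].
assert (H1 : cos (y - y') = 1).
{ rewrite cos_minus, Hs, Hc. generalize (sin2_cos2 y'); unfold Rsqr; lra. }
destruct (cos_eq_1 _ H1) as [k Hk].
assert (HP := PI_RGT_0).
assert (k = 0%Z) as ->.
{ rewrite Hk in Hy. rewrite Rabs_mult, (Rabs_right (2 * PI)) in Hy by lra.
  assert (Hk1 : Rabs (IZR k) < 1).
  { apply Rmult_lt_reg_r with (2 * PI); lra. }
  apply Rabs_def2 in Hk1. destruct Hk1 as [K1 K2].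
  apply lt_IZR in K1. assert (K3 : IZR (-1) < IZR k) by lra. apply lt_IZR in K3. lia. }
f_equal. lra.
Qed.

Lemma polar_form (z : C) : z <> 0%C -> exists x y, z = Cexp (x, y).
Proof.
intros Hz. assert (Hm : 0 < Cmod z) by now apply Cmod_gt_0.
destruct z as [a b]. set (r := Cmod (a, b)) in *.
assert (Hr : a * a + b * b = r * r).
{ unfold r, Cmod. rewrite sqrt_sqrt; simpl; nra. }
assert (Ha : -1 <= a / r <= 1).
{ assert (-r <= a <= r) by nra. split; apply Rmult_le_reg_r with r; trivial;
  unfold Rdiv; rewrite Rmult_assoc, Rinv_l; lra. }
assert (Hc : cos (acos (a / r)) = a / r) by now apply cos_acos.
assert (Hs : sin (acos (a / r)) * r = Rabs b).
{ rewrite sin_acos by trivial. rewrite <- (sqrt_square r) at 2 by lra.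
  rewrite <- sqrt_mult_alt by (unfold Rsqr; nra).
  replace ((1 - (a / r)²) * (r * r)) with (Rsqr b).
  - apply sqrt_Rsqr_abs.
  - unfold Rsqr. replace (b * b) with (r * r - a * a) by lra. field. lra. }
destruct (Rle_lt_dec 0 b) as [Hb|Hb].
- exists (ln r), (acos (a / r)). unfold Cexp; simpl. rewrite exp_ln, Hc by trivial.
  rewrite Rabs_right in Hs by lra. f_equal; [field; lra|lra].
- exists (ln r), (- acos (a / r)). unfold Cexp; simpl.
  rewrite exp_ln, cos_neg, sin_neg, Hc by trivial.
  rewrite Rabs_left in Hs by lra. f_equal; [field; lra|lra].
Qed.

Lemma derivable_pt_lim_0 (f : R -> R) l : derivable_pt_lim f 0 l ->
  forall eps, 0 < eps -> exists delta, 0 < delta /\ forall h, Rabs h < delta ->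
    Rabs (f h - f 0 - h * l) <= eps * Rabs h.
Proof.
intros Hf eps Heps. destruct (Hf eps Heps) as [[d Hd] H]. exists d. split; trivial.
intros h Hh. destruct (Req_dec h 0) as [->|Hh0].
- replace (f 0 - f 0 - 0 * l) with 0 by ring. rewrite Rabs_R0. lra.
- specialize (H h Hh0 Hh). rewrite Rplus_0_l in H.
  replace (f h - f 0 - h * l) with (((f h - f 0) / h - l) * h) by (field; trivial).
  rewrite Rabs_mult. apply Rmult_le_compat_r; [apply Rabs_pos|lra].
Qed.

Lemma Cexp_near_0 eps : 0 < eps -> exists delta, 0 < delta /\ forall h : C, Cmod h < delta ->
  Cmod (Cexp h - 1 - h)%C <= eps * Cmod h.
Proof.
(* The errors of the real and imaginary parts add up to at most [9 * e * Cmod h]; [e <= 1] keeps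
   [exp x] below 3. *)
intros Heps. set (e := Rmin (eps / 20) 1).
assert (He : 0 < e) by (apply Rmin_pos; lra).
assert (He1 : e <= eps / 20) by apply Rmin_l. assert (He2 : e <= 1) by apply Rmin_r.
clearbody e.
destruct (derivable_pt_lim_0 exp 1) with (eps := e) as [d1 [Hd1 H1]]; trivial.
{ rewrite <- exp_0. apply derivable_pt_lim_exp. }
destruct (derivable_pt_lim_0 cos 0) with (eps := e) as [d2 [Hd2 H2]]; trivial.
{ replace 0 with (- sin 0) at 2 by (rewrite sin_0; ring). apply derivable_pt_lim_cos. }
destruct (derivable_pt_lim_0 sin 1) with (eps := e) as [d3 [Hd3 H3]]; trivial.
{ rewrite <- cos_0. apply derivable_pt_lim_sin. }
exists (Rmin (Rmin d1 d2) (Rmin d3 e)). split; [repeat apply Rmin_pos; trivial|].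
intros [x y] Hh.
assert (A1 := Rlt_le_trans _ _ _ Hh (Rmin_l _ _)).
assert (A2 := Rlt_le_trans _ _ _ Hh (Rmin_r _ _)).
assert (B1 := Rlt_le_trans _ _ _ A1 (Rmin_l _ _)).
assert (B2 := Rlt_le_trans _ _ _ A1 (Rmin_r _ _)).
assert (B3 := Rlt_le_trans _ _ _ A2 (Rmin_l _ _)).
assert (B4 := Rlt_le_trans _ _ _ A2 (Rmin_r _ _)).
assert (Hxy := Rmax_Cmod (x, y)). simpl in Hxy.
assert (Hx := Rle_trans _ _ _ (Rmax_l _ _) Hxy).
assert (Hy := Rle_trans _ _ _ (Rmax_r _ _) Hxy).
specialize (H1 x ltac:(lra)). specialize (H2 y ltac:(lra)). specialize (H3 y ltac:(lra)).
rewrite exp_0 in H1. rewrite cos_0 in H2. rewrite sin_0 in H3.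
rewrite Rmult_1_r in H1, H3. rewrite Rmult_0_r, Rminus_0_r in H2. rewrite Rminus_0_r in H3.
set (m := Cmod (x, y)) in *. assert (Hm : 0 <= m) by apply Cmod_ge_0.
assert (K1 : Rabs (exp x - 1 - x) <= e * m) by nra.
assert (K2 : Rabs (cos y - 1) <= e * m) by nra.
assert (K3 : Rabs (sin y - y) <= e * m) by nra.
assert (K4 : Rabs (exp x - 1) <= 2 * m).
{ replace (exp x - 1) with ((exp x - 1 - x) + x) by ring.
  eapply Rle_trans; [apply Rabs_triang|]. nra. }
assert (K5 : Rabs (exp x) <= 3).
{ replace (exp x) with ((exp x - 1) + 1) by ring.
  eapply Rle_trans; [apply Rabs_triang|]. rewrite Rabs_R1. lra. }
eapply Rle_trans; [apply Cmod_le_abs|].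
unfold Cexp; simpl.
replace (exp x * cos y + - (1) + - x) with ((exp x - 1 - x) + exp x * (cos y - 1)) by ring.
replace (exp x * sin y + - 0 + - y) with (exp x * (sin y - y) + (exp x - 1) * y) by ring.
apply Rle_trans with (e * m + 3 * (e * m) + (3 * (e * m) + 2 * m * e)); [|nra].
repeat apply Rplus_le_compat; eapply Rle_trans; try apply Rabs_triang; rewrite ?Rabs_mult.
- apply Rplus_le_compat; trivial. apply Rmult_le_compat; trivial; apply Rabs_pos.
- apply Rplus_le_compat; apply Rmult_le_compat; trivial; try apply Rabs_pos. lra.
Qed.

Lemma is_derive_Cexp (z : C) : is_derive (K := C_AbsRing) (V := C_NormedModule) Cexp z (Cexp z).
Proof.
apply (@is_derive_eps C_CompleteNormedModule). intros eps Heps.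
assert (Hz : 0 < Cmod (Cexp z)) by (apply Cmod_gt_0, Cexp_neq_0).
destruct (Cexp_near_0 (eps / Cmod (Cexp z))) as [d [Hd H]]; [now apply Rdiv_lt_0_compat|].
exists d. split; trivial. intros h Hh. specialize (H h Hh).
change (Cmod (Cexp (z + h) - Cexp z - h * Cexp z)%C <= eps * Cmod h).
rewrite Cexp_plus.
replace (Cexp z * Cexp h - Cexp z - h * Cexp z)%C with (Cexp z * (Cexp h - 1 - h))%C by ring.
rewrite Cmod_mult. apply Rmult_le_compat_l with (r := Cmod (Cexp z)) in H; [|lra].
replace (Cmod (Cexp z) * (eps / Cmod (Cexp z) * Cmod h)) with (eps * Cmod h) in H by (field; lra).
exact H.
Qed.

(** * Rules of complex differentiation *)

Section Rules.
Context {E : CompleteNormedModule C_AbsRing}.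
Implicit Types f : C -> E.

(* [C_NormedModule] and [AbsRing_NormedModule C_AbsRing] have the same norm but
   distinct uniform structures, so derivatives must be transferred by hand. *)
Lemma is_derive_C_AbsRing (g : C -> C) (z l : C) :
  is_derive (K := C_AbsRing) (V := C_NormedModule) g z l ->
  is_derive (K := C_AbsRing) (V := AbsRing_NormedModule C_AbsRing) g z l.
Proof. intros [_ H]. split; [apply @is_linear_scal_l|exact H]. Qed.

Lemma ex_derive_comp_C f (g : C -> C) (z : C) : ex_derive (K := C_AbsRing) f (g z) ->
  ex_derive (K := C_AbsRing) (V := C_NormedModule) g z ->
  ex_derive (K := C_AbsRing) (fun w => f (g w)) z.
Proof.
intros Hf [l Hl]. apply (@ex_derive_comp C_AbsRing E f g z Hf).
exists l. now apply is_derive_C_AbsRing.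
Qed.

Lemma ex_derive_scal_C (g : C -> C) f (z : C) :
  ex_derive (K := C_AbsRing) (V := C_NormedModule) g z ->
  ex_derive (K := C_AbsRing) f z ->
  ex_derive (K := C_AbsRing) (fun w => scal (g w) (f w)) z.
Proof.
intros [lg Hg] [lf Hf]. apply is_derive_C_AbsRing in Hg.
exists (plus (scal lg (f z)) (scal (g z) lf) : E).
generalize (@filterdiff_scal_fct C_AbsRing (AbsRing_NormedModule C_AbsRing) E z g f _ _
  Cmult_comm Hg Hf). intros [_ H]. split; [apply @is_linear_scal_l|].
intros x Hx eps. generalize (H x Hx eps). apply filter_imp. intros y Hy.
eapply Rle_trans; [|exact Hy]. apply Req_le. f_equal. f_equal.
change (@eq E (scal (@minus C_AbsRing y x) (plus (scal lg (f z)) (scal (g z) lf)))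
  (plus (scal (@minus C_AbsRing y x * lg)%C (f z)) (scal (g z) (scal (@minus C_AbsRing y x) lf)))).
vring.
Qed.

Lemma ex_derive_minus_C f (g : C -> E) (z : C) :
  ex_derive (K := C_AbsRing) f z -> ex_derive (K := C_AbsRing) g z ->
  ex_derive (K := C_AbsRing) (fun w => minus (f w) (g w)) z.
Proof. exact (@ex_derive_minus C_AbsRing E f g z). Qed.

Lemma ex_derive_const_C (v : E) (z : C) : ex_derive (K := C_AbsRing) (fun _ => v) z.
Proof. exact (@ex_derive_const C_AbsRing E v z). Qed.

Lemma ex_derive_ext_near f (g : C -> E) (z : C) delta : 0 < delta ->
  (forall w : C, Cmod (w - z)%C < delta -> f w = g w) ->
  ex_derive (K := C_AbsRing) f z -> ex_derive (K := C_AbsRing) g z.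
Proof.
intros Hd H. apply ex_derive_ext_loc. exists (mkposreal delta Hd). intros w Hw. now apply H.
Qed.
End Rules.

Lemma ex_derive_id_C (z : C) : ex_derive (K := C_AbsRing) (V := C_NormedModule) (fun w => w) z.
Proof.
exists (RtoC 1). apply (@is_derive_eps C_CompleteNormedModule). intros eps Heps.
exists 1. split; [lra|]. intros h _.
change (Cmod (z + h - z - h * 1)%C <= eps * Cmod h).
replace (z + h - z - h * 1)%C with (RtoC 0) by ring. rewrite Cmod_0.
generalize (Cmod_ge_0 h); nra.
Qed.

Lemma ex_derive_mult_C (f g : C -> C) (z : C) :
  ex_derive (K := C_AbsRing) (V := C_NormedModule) f z ->
  ex_derive (K := C_AbsRing) (V := C_NormedModule) g z ->
  ex_derive (K := C_AbsRing) (V := C_NormedModule) (fun w => f w * g w)%C z.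
Proof. exact (@ex_derive_scal_C C_CompleteNormedModule f g z). Qed.

Lemma ex_derive_inv_C (z : C) : z <> 0%C ->
  ex_derive (K := C_AbsRing) (V := C_NormedModule) (fun w => / w)%C z.
Proof.
intros Hz. exists (- (/ (z * z)))%C. apply (@is_derive_eps C_CompleteNormedModule).
intros eps Heps. assert (Hm : 0 < Cmod z) by now apply Cmod_gt_0.
assert (Hm3 : 0 < Cmod z ^ 3) by now apply pow_lt.
exists (Rmin (Cmod z / 2) (eps * Cmod z ^ 3 / 2)). split; [apply Rmin_pos; nra|].
intros h Hh. assert (H1 := Rlt_le_trans _ _ _ Hh (Rmin_l _ _)).
assert (H2 := Rlt_le_trans _ _ _ Hh (Rmin_r _ _)).
change (Cmod (/ (z + h) - / z - h * (- (/ (z * z))))%C <= eps * Cmod h).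
assert (Hzh : Cmod z / 2 < Cmod (z + h)%C).
{ generalize (Cmod_triangle (z + h)%C (- h)%C). rewrite Cmod_opp.
  replace (z + h + - h)%C with z by ring. lra. }
assert (Hn : (z + h <> 0)%C) by (apply Cmod_gt_0; lra).
replace (/ (z + h) - / z - h * (- (/ (z * z))))%C with (h * (h / (z * z * (z + h))))%C
  by (field; auto).
assert (Hzz : (z * z * (z + h) <> 0)%C) by (repeat apply Cmult_neq_0; trivial).
rewrite Cmod_mult, Cmod_div, !Cmod_mult by trivial. rewrite Rmult_comm.
apply Rmult_le_compat_r; [apply Cmod_ge_0|].
assert (Hp : Cmod z ^ 3 / 2 < Cmod z * Cmod z * Cmod (z + h)%C) by (simpl; nra).
apply Rmult_le_reg_r with (Cmod z * Cmod z * Cmod (z + h)%C); [nra|].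
unfold Rdiv at 1. rewrite Rmult_assoc, Rinv_l by nra. nra.
Qed.

Lemma ex_derive_minus_const_C (a z : C) :
  ex_derive (K := C_AbsRing) (V := C_NormedModule) (fun w => w - a)%C z.
Proof.
apply (@ex_derive_minus_C C_CompleteNormedModule (fun w => w) (fun _ => a)).
- apply ex_derive_id_C.
- apply (@ex_derive_const_C C_CompleteNormedModule).
Qed.

(** * Cauchy's formula and Taylor expansions *)

Section Cauchy.
Context {E : CompleteNormedModule C_AbsRing}.
Implicit Types f k : C -> E.

(** The two horizontal sides cancel by periodicity, leaving [Ci] times the difference of the
    vertical ones. In the coordinate [log w], integrals over circles thus do not depend on the
    radius. *)
Lemma oint_periodic k x1 x2 c : (forall x, k (x, c + 2 * PI) = k (x, c)) ->
  oint k x1 x2 c (c + 2 * PI) = zero ->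
  CInt (fun y => k (x2, y)) c (c + 2 * PI) = CInt (fun y => k (x1, y)) c (c + 2 * PI).
Proof.
intros Hp H. unfold oint in H.
rewrite (CInt_ext (fun x => k (x, c + 2 * PI)) (fun x => k (x, c))) in H by (intros; apply Hp).
set (h := CInt (fun x => k (x, c)) x1 x2) in *.
set (v1 := CInt (fun y => k (x1, y)) c (c + 2 * PI)) in *.
set (v2 := CInt (fun y => k (x2, y)) c (c + 2 * PI)) in *.
replace v2 with (plus v1 (scal (- Ci)%C (minus (plus h (scal Ci v2)) (plus h (scal Ci v1))))).
- rewrite H. vring.
- assert (Hi : (Ci * Ci = - (1))%C) by (unfold Ci, Cmult, Copp, RtoC; simpl; f_equal; ring).
  vcoefs; simpl; ring [Hi].
Qed.

Lemma CInt_shift (g : R -> E) a b v : Cex g (a + v) (b + v) ->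
  CInt g (a + v) (b + v) = CInt (fun t => g (t + v)) a b.
Proof.
intros Hg. assert (H := @RInt_comp_lin (ER E) g 1 v a b). rewrite !Rmult_1_l in H.
unfold CInt. rewrite <- (H Hg). apply (@RInt_ext (ER E)). intros t _.
rewrite Rmult_1_l. exact (scalR_one E (g (t + v))).
Qed.

Lemma CInt_period (g : R -> E) c : (forall t, continuous g t) ->
  (forall t, g (t + 2 * PI) = g t) -> CInt g c (c + 2 * PI) = CInt g 0 (2 * PI).
Proof.
intros Hc Hp. assert (HC : forall a b, Cex g a b) by (intros; apply Cex_continuous; auto).
rewrite <- (CInt_Chasles g c 0), <- (CInt_Chasles g 0 (2 * PI) (c + 2 * PI)) by trivial.
assert (Hs := CInt_shift g 0 c (2 * PI) (HC _ _)). rewrite Rplus_0_l in Hs. rewrite Hs.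
rewrite (CInt_ext (fun t => g (t + 2 * PI)) g) by (intros; apply Hp).
assert (H0 := CInt_Chasles g 0 c 0 (HC _ _) (HC _ _)).
assert (H1 := @RInt_point (ER E) 0 g). change (CInt g 0 0 = zero) in H1.
replace (CInt g c 0) with (opp (CInt g 0 c)); [vring|].
rewrite H1 in H0. replace (CInt g c 0) with (minus (plus (CInt g 0 c) (CInt g c 0)) (CInt g 0 c))
  by vring. rewrite H0. vring.
Qed.

Lemma CInt_circle_le (g : R -> E) M : Cex g 0 (2 * PI) -> (forall y, norm (g y) <= M) ->
  norm (CInt g 0 (2 * PI)) <= M * (2 * PI).
Proof.
intros Hg HM. assert (HP := PI_RGT_0).
replace (M * (2 * PI)) with ((2 * PI - 0) * M) by ring. apply CInt_norm_le; auto. lra.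
Qed.

Lemma ex_derive_exp_shift f (u z : C) : ex_derive (K := C_AbsRing) f (u + Cexp z)%C ->
  ex_derive (K := C_AbsRing) (fun z => f (u + Cexp z)%C) z.
Proof.
intros Hf. apply (ex_derive_comp_C (fun w => f (u + w)%C) Cexp).
- apply (ex_derive_comp_C f (fun w => u + w)%C); trivial.
  apply (ex_derive_ext (V := C_NormedModule) (fun w => w - (- u))%C).
  + intros w. change (@eq C (w - - u) (u + w))%C. ring.
  + apply ex_derive_minus_const_C.
- eexists. apply is_derive_Cexp.
Qed.

Lemma ex_derive_kernel (h z : C) : Cexp z <> h ->
  ex_derive (K := C_AbsRing) (V := C_NormedModule) (fun z => Cexp z / (Cexp z - h))%C z.
Proof.
intros Hz. apply (ex_derive_comp_C (E := C_CompleteNormedModule) (fun w => w / (w - h))%C Cexp).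
- apply ex_derive_mult_C; [apply ex_derive_id_C|].
  apply (ex_derive_comp_C (E := C_CompleteNormedModule) (fun w => / w)%C (fun w => w - h)%C).
  + apply ex_derive_inv_C. intros K. apply Hz.
    replace (Cexp z) with (Cexp z - h + h)%C by ring. rewrite K. ring.
  + apply ex_derive_minus_const_C.
- eexists. apply is_derive_Cexp.
Qed.

Lemma Cmod_minus_ge (z w : C) : Cmod z - Cmod w <= Cmod (z - w)%C.
Proof.
generalize (Cmod_triangle (z - w)%C w). replace (z - w + w)%C with z by ring. lra.
Qed.

(** The kernel minus 1 is [h / (w - h)], holomorphic for [|w| > |h|], so its circle mean is the same
    for all larger radii; it tends to 0 with [1 / |w|]. *)
Lemma kernel_mean (h : C) (x : R) (v : E) : Cmod h < exp x ->
  CInt (fun y => scal (Cexp (x, y) / (Cexp (x, y) - h))%C v) 0 (2 * PI) = scal (RtoC (2 * PI)) v.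
Proof.
intros Hh. assert (HP := PI_RGT_0).
set (g := (fun z : C => minus (scal (Cexp z / (Cexp z - h))%C v) v) : C -> E).
assert (Hne : forall X y, x <= X -> exp x - Cmod h <= Cmod (Cexp (X, y) - h)%C).
{ intros X y HX. eapply Rle_trans; [|apply Cmod_minus_ge]. rewrite Cmod_Cexp; simpl.
  destruct (Req_dec x X) as [->|]; [lra|]. generalize (exp_increasing x X); lra. }
assert (Hne' : forall X y, x <= X -> Cexp (X, y) <> h).
{ intros X y HX Heq. specialize (Hne X y HX). rewrite Heq in Hne.
  replace (h - h)%C with (RtoC 0) in Hne by ring. rewrite Cmod_0 in Hne. lra. }
assert (Hk : forall X y, x <= X ->
   ex_derive (K := C_AbsRing) (fun z : C => scal (Cexp z / (Cexp z - h))%C v) (X, y)).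
{ intros X y HX. apply ex_derive_scal_C; [|apply ex_derive_const_C].
  apply ex_derive_kernel. now apply Hne'. }
assert (Hg : forall X y, x <= X -> ex_derive (K := C_AbsRing) g (X, y)).
{ intros X y HX. apply ex_derive_minus_C; [now apply Hk|apply ex_derive_const_C]. }
assert (Hz : CInt (fun y => g (x, y)) 0 (2 * PI) = zero).
{ apply (norm_eps_zero _ (2 * PI)). intros eps Heps.
  assert (Hm := Cmod_ge_0 h). assert (Hv := norm_pos v).
  (* On the circle of radius [exp x + Cmod h + A], [|w - h|] is at least [A], whence the bound [eps]
     on the integrand. *)
  set (A := Cmod h * norm v / eps).
  assert (HA : 0 <= A) by (apply Rdiv_le_0_compat; nra).
  set (X := ln (exp x + Cmod h + A)).
  assert (Hex := exp_pos x).
  assert (HX : exp X = exp x + Cmod h + A) by (apply exp_ln; lra).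
  assert (HxX : x <= X).
  { unfold X. rewrite <- (ln_exp x) at 1. apply ln_le; lra. }
  assert (HS := oint_periodic g x X 0). rewrite Rplus_0_l in HS. rewrite <- HS.
  - apply CInt_circle_le.
    + apply (Cex_vline g); [lra|]. intros y _. now apply Hg.
    + intros y. unfold g.
      replace (minus (scal (Cexp (X, y) / (Cexp (X, y) - h))%C v) v)
        with (scal (h / (Cexp (X, y) - h))%C v).
      2:{ vcoefs; simpl; field. intros K. apply (Hne' X y HxX).
          replace (Cexp (X, y)) with (Cexp (X, y) - h + h)%C by ring. rewrite K. ring. }
      assert (Hd : exp X - Cmod h <= Cmod (Cexp (X, y) - h)%C).
      { eapply Rle_trans; [|apply Cmod_minus_ge]. rewrite Cmod_Cexp; simpl; lra. }
      eapply Rle_trans; [apply norm_scal_le|]. rewrite Cmod_div.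
      2:{ apply Cmod_gt_0. lra. }
      apply Rmult_le_reg_r with (Cmod (Cexp (X, y) - h)%C); [lra|].
      replace (Cmod h / Cmod (Cexp (X, y) - h)%C * norm v * Cmod (Cexp (X, y) - h)%C)
        with (eps * A) by (unfold A; field; lra).
      apply Rmult_le_compat_l; lra.
  - intros t. unfold g. rewrite <- (Rplus_0_l (2 * PI)), Cexp_period. reflexivity.
  - apply goursat; [trivial|lra|]. intros; apply Hg; lra. }
assert (Hz' : minus (CInt (fun y => scal (Cexp (x, y) / (Cexp (x, y) - h))%C v) 0 (2 * PI))
   (CInt (fun _ => v) 0 (2 * PI)) = zero).
{ rewrite <- CInt_minus; [exact Hz| |apply Cex_const].
  apply (Cex_vline (fun z : C => scal (Cexp z / (Cexp z - h))%C v)); [lra|].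
  intros; apply Hk; lra. }
rewrite (minus_zero_eq _ _ Hz'), CInt_const, Rminus_0_r. reflexivity.
Qed.

(* In the coordinate [log (w - u)], the integrand has at most one singularity in a period
   rectangle and stays bounded near it, so its circle means do not depend on the radius;
   they tend to [0] with the radius. *)
Lemma cauchy_difference f (u h : C) (x rho : R) : exp x < rho -> Cmod h < exp x ->
  (forall w : C, Cmod (w - u)%C < rho -> ex_derive (K := C_AbsRing) f w) ->
  CInt (fun y => scal (Cexp (x, y) / (Cexp (x, y) - h))%C
                      (minus (f (u + Cexp (x, y))%C) (f (u + h)%C))) 0 (2 * PI) = zero.
Proof.
intros Hx Hh Hf. assert (HP := PI_RGT_0).
set (g := (fun z : C => scal (Cexp z / (Cexp z - h))%C (minus (f (u + Cexp z)%C) (f (u + h)%C)))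
  : C -> E).
assert (Hexp : forall X, X <= x -> exp X <= exp x).
{ intros X HX. destruct (Req_dec X x) as [->|]; [lra|]. left. apply exp_increasing; lra. }
assert (Hfz : forall w : C, Cmod w < rho -> ex_derive (K := C_AbsRing) f (u + w)%C).
{ intros w Hw. apply Hf. replace (u + w - u)%C with w by ring. trivial. }
assert (Hg : forall X y, X <= x -> Cexp (X, y) <> h -> ex_derive (K := C_AbsRing) g (X, y)).
{ intros X y HX Hne. apply ex_derive_scal_C; [now apply ex_derive_kernel|].
  apply ex_derive_minus_C; [|apply ex_derive_const_C].
  apply ex_derive_exp_shift, Hfz. rewrite Cmod_Cexp. simpl. generalize (Hexp X HX). lra. }
assert (Hper : forall X c, g (X, c + 2 * PI) = g (X, c)).
{ intros X c. unfold g. now rewrite Cexp_period. }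
assert (Hcirc : forall X, X <= x -> (forall y, Cexp (X, y) <> h) ->
   forall c, CInt (fun y => g (X, y)) c (c + 2 * PI) = CInt (fun y => g (X, y)) 0 (2 * PI)).
{ intros X HX Hne c. apply CInt_period.
  - intros t. apply continuous_vline. now apply Hg.
  - intros t. apply Hper. }
assert (Hneq : forall X y, exp X <> Cmod h -> Cexp (X, y) <> h).
{ intros X y HX Heq. apply HX. rewrite <- Heq, Cmod_Cexp. reflexivity. }
change (CInt (fun y => g (x, y)) 0 (2 * PI) = zero).
assert (Hbound : forall X eps, X <= x -> exp X <> Cmod h ->
   (forall y, norm (g (X, y)) <= eps) -> norm (CInt (fun y => g (X, y)) 0 (2 * PI)) <= eps * (2 * PI)).
{ intros X eps HX Hne HB. apply CInt_circle_le; trivial.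
  apply (Cex_vline g); [lra|]. intros y _. apply Hg; auto. }
apply (norm_eps_zero _ (2 * PI)). intros eps Heps.
(* For [h = 0] the singularity has no logarithm, but the kernel is 1 and the integrand
   [f (u + w) - f u] is small on small circles. For other [h] the contour has to cross the
   singularity [log h]. *)
destruct (Ceq_dec h 0) as [->|Hh0].
- destruct (ex_derive_near f u) with (eps := eps) as [d [Hd Hnear]]; trivial.
  { apply Hf. replace (u - u)%C with (RtoC 0) by ring. rewrite Cmod_0.
    generalize (exp_pos x); lra. }
  set (X := Rmin x (ln (d / 2))).
  assert (HX : X <= x) by apply Rmin_l.
  assert (HXd : exp X < d).
  { assert (X <= ln (d / 2)) by apply Rmin_r. apply Rle_lt_trans with (d / 2); [|lra].
    rewrite <- (exp_ln (d / 2)) by lra.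
    destruct (Req_dec X (ln (d / 2))) as [->|]; [lra|]. left; apply exp_increasing; lra. }
  assert (Hn0 : forall Y, exp Y <> Cmod 0) by (intros Y; rewrite Cmod_0; generalize (exp_pos Y); lra).
  assert (HS := oint_periodic g X x 0). rewrite Rplus_0_l in HS. rewrite HS.
  + apply Hbound; trivial. intros y. unfold g.
    replace (Cexp (X, y) / (Cexp (X, y) - 0))%C with (RtoC 1).
    2:{ field. replace (Cexp (X, y) - 0)%C with (Cexp (X, y)) by ring. apply Cexp_neq_0. }
    replace (u + 0)%C with u by ring.
    eapply Rle_trans; [apply norm_scal_le|]. rewrite Cmod_1, Rmult_1_l. left.
    apply Hnear. now rewrite Cmod_Cexp.
  + intros t. rewrite <- (Rplus_0_l (2 * PI)). apply Hper.
  + apply goursat; [trivial|lra|]. intros; apply Hg; [lra|]. now apply Hneq.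
- destruct (polar_form h Hh0) as [p1 [p2 Hp]].
  assert (Hhm : Cmod h = exp p1) by now rewrite Hp, Cmod_Cexp.
  assert (Hp1x : p1 < x) by (apply exp_lt_inv; lra).
  assert (Hmh : 0 < Cmod h) by now apply Cmod_gt_0.
  destruct (ex_derive_near f u) with (eps := 1) as [d [Hd Hnear]]; [|lra|].
  { apply Hf. replace (u - u)%C with (RtoC 0) by ring. rewrite Cmod_0. lra. }
  set (B := norm (f u) + 1 + norm (f (u + h)%C)).
  assert (HB : 1 <= B) by (unfold B; generalize (norm_pos (f u)) (norm_pos (f (u + h)%C)); lra).
  (* Radius of the small circle: the first bound keeps [f] within 1 of [f u], the second gives
     [|w - h| >= |h| / 2], and with the third the integrand [|w| / |w - h| * B] is at most [eps]. *)
  set (e := Rmin (d / 2) (Rmin (Cmod h / 2) (eps * Cmod h / 2 / B))).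
  assert (H0 : 0 < eps * Cmod h / 2 / B) by (apply Rdiv_lt_0_compat; nra).
  assert (He : 0 < e) by (repeat apply Rmin_pos; lra).
  assert (He1 : e <= d / 2) by apply Rmin_l.
  assert (He2 : e <= Cmod h / 2) by (eapply Rle_trans; [apply Rmin_r|apply Rmin_l]).
  assert (He3 : e <= eps * Cmod h / 2 / B) by (eapply Rle_trans; [apply Rmin_r|apply Rmin_r]).
  set (X := ln e).
  assert (HeX : exp X = e) by now apply exp_ln.
  assert (HXp : X < p1) by (apply exp_lt_inv; lra).
  (* The period starts at [p2 - PI] so that the logarithm [(p1, p2)] of [h] is interior to the
     rectangle, and is the only one there. *)
  rewrite <- (Hcirc x) with (c := p2 - PI); [|lra|intros y; apply Hneq; lra].
  rewrite (oint_periodic g X x (p2 - PI)); auto.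
  + rewrite Hcirc; [|lra|intros y; apply Hneq; lra].
    apply Hbound; [lra|lra|]. intros y. unfold g.
    assert (Hw : Cmod (Cexp (X, y)) = e) by (rewrite Cmod_Cexp; exact HeX).
    assert (Hwh : Cmod h / 2 <= Cmod (Cexp (X, y) - h)%C).
    { replace (Cexp (X, y) - h)%C with (- (h - Cexp (X, y)))%C by ring. rewrite Cmod_opp.
      eapply Rle_trans; [|apply Cmod_minus_ge]. rewrite Hw. lra. }
    assert (Hfw : norm (minus (f (u + Cexp (X, y))%C) (f (u + h)%C)) <= B).
    { eapply Rle_trans; [apply norm_minus_le|]. unfold B. apply Rplus_le_compat_r.
      replace (f (u + Cexp (X, y))%C) with (plus (minus (f (u + Cexp (X, y))%C) (f u)) (f u)) by vring.
      eapply Rle_trans; [apply norm_plus_le|].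
      assert (norm (minus (f (u + Cexp (X, y))%C) (f u)) < 1) by (apply Hnear; lra). lra. }
    eapply Rle_trans; [apply norm_scal_le|]. rewrite Cmod_div by (apply Cmod_gt_0; lra).
    rewrite Hw. apply Rle_trans with (e / (Cmod h / 2) * B).
    * apply Rmult_le_compat; trivial; try apply norm_pos.
      -- apply Rdiv_le_0_compat; lra.
      -- apply Rmult_le_compat_l; [lra|]. apply Rinv_le_contravar; lra.
    * apply Rmult_le_compat_r with (r := B / (Cmod h / 2)) in He3.
      2:{ apply Rdiv_le_0_compat; lra. }
      replace (eps * Cmod h / 2 / B * (B / (Cmod h / 2))) with eps in He3 by (field; lra).
      replace (e / (Cmod h / 2) * B) with (e * (B / (Cmod h / 2))) by (field; lra). exact He3.
  + destruct (ex_derive_eps f (u + h)%C) as [l Hl]; [apply Hfz; lra|].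
    destruct (Hl 1 Rlt_0_1) as [d1 [Hd1 Hl1]].
    destruct (ex_derive_near (E := C_CompleteNormedModule) Cexp (p1, p2)) with (eps := d1)
      as [d2 [Hd2 Hl2]]; trivial.
    { eexists. apply is_derive_Cexp. }
    (* Within [d2 / 4] in each coordinate, [Cexp] stays [d1]-close to [h], so the secant bound
       [1 + norm l] applies; 1 keeps [Cexp] injective and [x - p1] keeps the radius at most
       [exp x]. *)
    apply goursat_exceptional with (p1 := p1) (p2 := p2) (eta0 := Rmin (Rmin (d2 / 4) 1) (x - p1))
      (B := exp x * (1 + norm l)); try lra.
    * repeat apply Rmin_pos; lra.
    * intros X' y HX' Hy Hne. apply Hg; [lra|]. intros Heq. apply Hne.
      apply Cexp_inj; [apply Rabs_def1; lra|]. now rewrite Heq.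
    * intros X' y HX' Hy Hne.
      assert (A1 := Rle_trans _ _ _ HX' (Rmin_l _ _)).
      assert (A2 := Rle_trans _ _ _ HX' (Rmin_r _ _)).
      assert (A3 := Rle_trans _ _ _ A1 (Rmin_l _ _)).
      assert (A4 := Rle_trans _ _ _ Hy (Rmin_l _ _)).
      assert (A5 := Rle_trans _ _ _ A4 (Rmin_l _ _)).
      assert (A6 := Rle_trans _ _ _ A4 (Rmin_r _ _)).
      apply Rabs_le_between in A2, A6. generalize PI2_1; intros HPI.
      assert (Hneh : Cexp (X', y) <> h).
      { intros Heq. apply Hne. apply Cexp_inj; [apply Rabs_def1; lra|]. now rewrite Heq. }
      assert (Hwd : Cmod (Cexp (X', y) - h)%C < d1).
      { specialize (Hl2 ((X', y) - (p1, p2))%C).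
        assert (Hr : forall p r : C, (p + (r - p))%C = r) by (intros; ring).
        rewrite Hr, <- Hp in Hl2. apply Hl2.
        eapply Rle_lt_trans; [apply Cmod_le_abs|]. simpl.
        change (Rabs (X' - p1) + Rabs (y - p2) < d2). lra. }
      assert (Hw0 : (Cexp (X', y) - h)%C <> 0%C).
      { intros K. apply Hneh. replace (Cexp (X', y)) with (Cexp (X', y) - h + h)%C by ring.
        rewrite K. ring. }
      assert (Hwp : 0 < Cmod (Cexp (X', y) - h)%C) by now apply Cmod_gt_0.
      specialize (Hl1 _ Hwd).
      replace (u + h + (Cexp (X', y) - h))%C with (u + Cexp (X', y))%C in Hl1 by ring.
      assert (Hfw : norm (minus (f (u + Cexp (X', y))%C) (f (u + h)%C)) <=
         Cmod (Cexp (X', y) - h)%C * (1 + norm l)).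
      { replace (minus (f (u + Cexp (X', y))%C) (f (u + h)%C)) with
         (plus (minus (minus (f (u + Cexp (X', y))%C) (f (u + h)%C)) (scal (Cexp (X', y) - h)%C l))
               (scal (Cexp (X', y) - h)%C l)) by vring.
        eapply Rle_trans; [apply norm_plus_le|].
        generalize (norm_scal_le (Cexp (X', y) - h)%C l). lra. }
      unfold g. eapply Rle_trans; [apply norm_scal_le|]. rewrite Cmod_div, Cmod_Cexp by trivial.
      simpl. apply Rle_trans with
       (exp X' / Cmod (Cexp (X', y) - h)%C * (Cmod (Cexp (X', y) - h)%C * (1 + norm l))).
      -- apply Rmult_le_compat_l; trivial. apply Rdiv_le_0_compat; trivial.
         generalize (exp_pos X'); lra.
      -- replace (exp X' / Cmod (Cexp (X', y) - h)%C * (Cmod (Cexp (X', y) - h)%C * (1 + norm l)))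
           with (exp X' * (1 + norm l)) by (field; lra).
         apply Rmult_le_compat_r; [generalize (norm_pos l); lra|]. apply Hexp; lra.
Qed.

Lemma circle_scal_continuous f (g : C -> C) (u : C) (x rho : R) : exp x < rho ->
  (forall w : C, Cmod (w - u)%C < rho -> ex_derive (K := C_AbsRing) f w) ->
  (forall y, ex_derive (K := C_AbsRing) (V := C_NormedModule) (fun z => g (Cexp z)) (x, y)) ->
  Cex (fun y => scal (g (Cexp (x, y))) (f (u + Cexp (x, y))%C)) 0 (2 * PI).
Proof.
intros Hx Hf Hg. assert (HP := PI_RGT_0).
apply (Cex_vline (fun z : C => scal (g (Cexp z)) (f (u + Cexp z)%C))); [lra|].
intros y _. apply ex_derive_scal_C; trivial. apply ex_derive_exp_shift, Hf.
replace (u + Cexp (x, y) - u)%C with (Cexp (x, y)) by ring. now rewrite Cmod_Cexp.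
Qed.

(** On the circle [w = u + Cexp (x, y)], the usual [dw / (w - u - h)] is [i] times this kernel in
    [dy]. The formula is [cauchy_difference] with the constant term evaluated by [kernel_mean]. *)
Theorem cauchy_formula f (u h : C) (x rho : R) : exp x < rho -> Cmod h < exp x ->
  (forall w : C, Cmod (w - u)%C < rho -> ex_derive (K := C_AbsRing) f w) ->
  f (u + h)%C = scal (RtoC (/ (2 * PI)))
   (CInt (fun y => scal (Cexp (x, y) / (Cexp (x, y) - h))%C (f (u + Cexp (x, y))%C)) 0 (2 * PI)).
Proof.
intros Hx Hh Hf. assert (HP := PI_RGT_0).
assert (Hk : forall y, ex_derive (K := C_AbsRing) (V := C_NormedModule)
   (fun z => Cexp z / (Cexp z - h))%C (x, y)).
{ intros y. apply ex_derive_kernel. intros Heq. rewrite <- Heq, Cmod_Cexp in Hh. simpl in Hh. lra. }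
assert (H := cauchy_difference f u h x rho Hx Hh Hf).
assert (HE : CInt (fun y => scal (Cexp (x, y) / (Cexp (x, y) - h))%C (f (u + Cexp (x, y))%C)) 0 (2 * PI)
  = scal (RtoC (2 * PI)) (f (u + h)%C)).
{ rewrite <- (kernel_mean h x (f (u + h)%C)) by trivial.
  apply minus_zero_eq. refine (eq_trans _ H). rewrite <- CInt_minus.
  - apply CInt_ext. intros y _. vring.
  - exact (circle_scal_continuous f (fun w => w / (w - h))%C u x rho Hx Hf Hk).
  - apply (Cex_vline (fun z : C => scal (Cexp z / (Cexp z - h))%C (f (u + h)%C))); [lra|].
    intros; apply ex_derive_scal_C; [apply Hk|apply ex_derive_const_C]. }
rewrite HE.
assert (Hpi : (RtoC (/ (2 * PI)) * RtoC (2 * PI) = 1)%C).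
{ rewrite <- RtoC_mult. f_equal. field. lra. }
vcoefs; simpl; ring [Hpi].
Qed.

Definition cauchy_coef f (u : C) (x : R) (n : nat) : E :=
  scal (RtoC (/ (2 * PI)))
   (CInt (fun y => scal (/ Cexp (x, y) ^ n)%C (f (u + Cexp (x, y))%C)) 0 (2 * PI)).

Lemma ex_derive_pow_C (n : nat) (z : C) :
  ex_derive (K := C_AbsRing) (V := C_NormedModule) (fun w => w ^ n)%C z.
Proof.
induction n as [|n IH]; simpl.
- apply (@ex_derive_const_C C_CompleteNormedModule).
- apply ex_derive_mult_C; trivial. apply ex_derive_id_C.
Qed.

Lemma Cpow_div (h w : C) (n : nat) : w <> 0%C -> ((h / w) ^ n = h ^ n * / w ^ n)%C.
Proof. intros Hw. unfold Cdiv. now rewrite Cpow_mult_l, Cpow_inv. Qed.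

Lemma geometric_kernel_step (h w : C) (n : nat) : w <> 0%C -> (w - h)%C <> 0%C ->
  ((h / w) ^ n * (w / (w - h)) = h ^ n * / w ^ n + (h / w) ^ S n * (w / (w - h)))%C.
Proof.
intros Hw Hwh. simpl. rewrite Cpow_div by trivial. field.
repeat split; trivial. now apply Cpow_nz.
Qed.

(** Expanding the Cauchy kernel as a finite geometric sum with its remainder, one term per induction
    step, avoids exchanging an infinite sum with the integral. *)
Lemma cauchy_expansion f (u h : C) (x rho : R) (N : nat) : exp x < rho -> Cmod h < exp x ->
  (forall w : C, Cmod (w - u)%C < rho -> ex_derive (K := C_AbsRing) f w) ->
  f (u + h)%C = plus (lcomb (cauchy_coef f u x) (fun n => h ^ n)%C N)
   (scal (RtoC (/ (2 * PI)))
    (CInt (fun y => scal ((h / Cexp (x, y)) ^ N * (Cexp (x, y) / (Cexp (x, y) - h)))%C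
                         (f (u + Cexp (x, y))%C)) 0 (2 * PI))).
Proof.
intros Hx Hh Hf. assert (HP := PI_RGT_0).
assert (Hne : forall y, Cexp (x, y) <> h).
{ intros y Heq. rewrite <- Heq, Cmod_Cexp in Hh. simpl in Hh. lra. }
assert (Hne' : forall y, (Cexp (x, y) - h)%C <> 0%C).
{ intros y K. apply (Hne y). replace (Cexp (x, y)) with (Cexp (x, y) - h + h)%C by ring.
  rewrite K. ring. }
assert (Hinv : forall n y, ex_derive (K := C_AbsRing) (V := C_NormedModule)
  (fun z => / (Cexp z ^ n))%C (x, y)).
{ intros n y. apply (ex_derive_comp_C (E := C_CompleteNormedModule) (fun w => / (w ^ n))%C Cexp).
  2:{ eexists. apply is_derive_Cexp. }
  apply (ex_derive_comp_C (E := C_CompleteNormedModule) (fun w => / w)%C (fun w => w ^ n)%C).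
  - apply ex_derive_inv_C, Cpow_nz, Cexp_neq_0.
  - apply ex_derive_pow_C. }
induction N as [|N IH].
- simpl. rewrite (cauchy_formula f u h x rho Hx Hh Hf) at 1.
  rewrite (CInt_ext _ (fun y => scal (1 * (Cexp (x, y) / (Cexp (x, y) - h)))%C
     (f (u + Cexp (x, y))%C))) by (intros; f_equal; ring). vring.
- rewrite IH. simpl lcomb. unfold cauchy_coef at 3.
  set (F := (fun y => scal (/ Cexp (x, y) ^ N)%C (f (u + Cexp (x, y))%C)) : R -> E).
  set (G := (fun y => scal ((h / Cexp (x, y)) ^ S N * (Cexp (x, y) / (Cexp (x, y) - h)))%C
    (f (u + Cexp (x, y))%C)) : R -> E).
  assert (HF : Cex F 0 (2 * PI))
    by exact (circle_scal_continuous f (fun w => / w ^ N)%C u x rho Hx Hf (Hinv N)).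
  assert (HG : Cex G 0 (2 * PI)).
  { apply (circle_scal_continuous f (fun w => (h / w) ^ S N * (w / (w - h)))%C u x rho Hx Hf).
    intros y. apply ex_derive_mult_C; [|now apply ex_derive_kernel].
    apply (ex_derive_ext (V := C_NormedModule) (fun z => h ^ S N * / (Cexp z ^ S N))%C).
    - intros z. symmetry. apply Cpow_div, Cexp_neq_0.
    - apply ex_derive_mult_C; [apply (@ex_derive_const_C C_CompleteNormedModule)|apply Hinv]. }
  rewrite (CInt_ext _ (fun y => plus (scal (h ^ N)%C (F y) : E) (G y))).
  2:{ intros y _. rewrite geometric_kernel_step by (apply Cexp_neq_0 || apply Hne').
      unfold F, G. vring. }
  rewrite CInt_plus, CInt_scal by (trivial; now apply Cex_scal). vring.
Qed.

(** The factor 2 bounds [|w / (w - h)|] on [|w| = r], since [|h| <= r / 2]. *)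
Lemma taylor_cauchy_coef f (u : C) (r rho M : R) : 0 < r < rho ->
  (forall w : C, Cmod (w - u)%C < rho -> ex_derive (K := C_AbsRing) f w) ->
  (forall y, 0 <= y <= 2 * PI -> norm (f (u + Cexp (ln r, y))%C) <= M) ->
  forall (N : nat) (h : C), Cmod h <= r / 2 ->
    norm (minus (f (u + h)%C) (lcomb (cauchy_coef f u (ln r)) (fun n => h ^ n)%C N))
    <= 2 * M * (Cmod h / r) ^ N.
Proof.
intros Hr Hf HM. assert (HP := PI_RGT_0).
assert (Hx : exp (ln r) = r) by (apply exp_ln; lra).
intros N h Hh.
rewrite (cauchy_expansion f u h (ln r) rho N); trivial; try lra.
assert (Hab : forall v w : E, minus (plus v w) v = w) by (intros; vring).
rewrite Hab.
assert (Hw : forall y, Cmod (Cexp (ln r, y)) = r) by (intros y; rewrite Cmod_Cexp; exact Hx).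
assert (Hwh : forall y, r / 2 <= Cmod (Cexp (ln r, y) - h)%C).
{ intros y. eapply Rle_trans; [|apply Cmod_minus_ge]. rewrite Hw. lra. }
assert (Hm := Cmod_ge_0 h).
assert (HM0 : 0 <= M).
{ apply Rle_trans with (norm (f (u + Cexp (ln r, 0))%C)); [apply norm_pos|]. apply HM. lra. }
eapply Rle_trans; [apply norm_scal_le|]. rewrite Cmod_R, Rabs_right.
2:{ apply Rle_ge. left. apply Rinv_0_lt_compat; lra. }
replace (2 * M * (Cmod h / r) ^ N) with (/ (2 * PI) * ((2 * PI - 0) * (2 * M * (Cmod h / r) ^ N)))
  by (field; lra).
apply Rmult_le_compat_l; [left; apply Rinv_0_lt_compat; lra|].
apply CInt_norm_le; [lra| |].
- apply (circle_scal_continuous f (fun w => (h / w) ^ N * (w / (w - h)))%C u (ln r) rho); trivial; [lra|].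
  intros y. apply ex_derive_mult_C.
  + apply (ex_derive_comp_C (E := C_CompleteNormedModule) (fun w => w ^ N)%C (fun z => h / Cexp z)%C).
    * apply ex_derive_pow_C.
    * apply ex_derive_mult_C; [apply (@ex_derive_const_C C_CompleteNormedModule)|].
      apply (ex_derive_comp_C (E := C_CompleteNormedModule) (fun w => / w)%C Cexp).
      -- apply ex_derive_inv_C, Cexp_neq_0.
      -- eexists. apply is_derive_Cexp.
  + apply ex_derive_kernel. intros Heq. specialize (Hw y). rewrite Heq in Hw. lra.
- intros y Hy. eapply Rle_trans; [apply norm_scal_le|].
  rewrite Cmod_mult, Cmod_pow, !Cmod_div, Hw by (apply Cmod_gt_0; rewrite ?Hw; specialize (Hwh y); lra).
  assert (H1 : norm (f (u + Cexp (ln r, y))%C) <= M) by now apply HM.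
  replace (2 * M * (Cmod h / r) ^ N) with ((Cmod h / r) ^ N * 2 * M) by ring.
  assert (Hp : 0 <= (Cmod h / r) ^ N) by (apply pow_le, Rdiv_le_0_compat; lra).
  apply Rmult_le_compat; trivial; try apply norm_pos.
  + apply Rmult_le_pos; trivial. apply Rdiv_le_0_compat; [lra|]. specialize (Hwh y); lra.
  + apply Rmult_le_compat_l; trivial. specialize (Hwh y).
    apply Rmult_le_reg_r with (Cmod (Cexp (ln r, y) - h)%C); [lra|].
    unfold Rdiv. rewrite Rmult_assoc, Rinv_l; lra.
Qed.
Theorem taylor f (u : C) (r rho M : R) : 0 < r < rho ->
  (forall w : C, Cmod (w - u)%C < rho -> ex_derive (K := C_AbsRing) f w) ->
  (forall y, 0 <= y <= 2 * PI -> norm (f (u + Cexp (ln r, y))%C) <= M) ->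
  exists a : nat -> E, forall (N : nat) (h : C), Cmod h <= r / 2 ->
    norm (minus (f (u + h)%C) (lcomb a (fun n => h ^ n)%C N)) <= 2 * M * (Cmod h / r) ^ N.
Proof. intros Hr Hf HM. exists (cauchy_coef f u (ln r)). now apply taylor_cauchy_coef with rho. Qed.
End Cauchy.

(** * Parametric integrals and the identity theorem on a line *)

Section Consequences.
Context {E : CompleteNormedModule C_AbsRing}.
Implicit Types f g : C -> E.

Lemma complete_seq (s : nat -> E) :
  (forall eps, 0 < eps -> exists N, forall n m, (N <= n)%nat -> (N <= m)%nat ->
     norm (minus (s n) (s m)) < eps) ->
  exists l : E, forall eps, 0 < eps -> exists N, forall n, (N <= n)%nat ->
     norm (minus (s n) l) < eps.
Proof.
intros H. destruct (proj1 (@filterlim_locally_cauchy nat E eventually _ s)) as [l Hl].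
- intros [eps Heps]. destruct (H eps Heps) as [N HN].
  exists (fun n => (N <= n)%nat). split; [now exists N|].
  intros u v Hu Hv. apply (@norm_compat1 _ E). now apply HN.
- exists l. intros eps Heps.
  assert (Hn := @norm_factor_gt_0 _ E).
  assert (He : 0 < eps / @norm_factor _ E) by now apply Rdiv_lt_0_compat.
  destruct (Hl _ (locally_ball l (mkposreal _ He))) as [N HN]. exists N. intros n Hn'.
  assert (HB := @norm_compat2 _ E _ _ _ (HN n Hn')). simpl in HB.
  replace eps with (@norm_factor _ E * (eps / @norm_factor _ E)) by (field; lra).
  exact HB.
Qed.

(** The hypothesis is the Cauchy criterion for difference quotients, cleared of denominators. The
    derivative is produced by completeness, so no candidate has to be supplied, and the hypothesis
    is linear in [f], ready to be integrated. *)
Lemma ex_derive_of_secants f (z : C) (A r : R) : 0 < r ->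
  (forall h k : C, Cmod h < r -> Cmod k < r ->
     norm (minus (scal k (minus (f (z + h)%C) (f z))) (scal h (minus (f (z + k)%C) (f z))))
     <= A * (Cmod h * Cmod k * (Cmod h + Cmod k))) ->
  ex_derive (K := C_AbsRing) f z.
Proof.
intros Hr H.
assert (HA : 0 <= A).
{ assert (Hq : Cmod (RtoC (r / 2)) = r / 2) by (rewrite Cmod_R, Rabs_right; lra).
  specialize (H (RtoC (r / 2)) (RtoC (r / 2))). rewrite Hq in H.
  specialize (H ltac:(lra) ltac:(lra)).
  assert (H0 := Rle_trans _ _ _ (norm_pos _) H).
  assert (H1 : 0 < r / 2 * (r / 2) * (r / 2 + r / 2)) by (repeat apply Rmult_lt_0_compat; lra).
  apply Rmult_le_reg_r with (1 := H1). now rewrite Rmult_0_l. }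
set (Q := (fun h : C => scal (/ h)%C (minus (f (z + h)%C) (f z))) : C -> E).
assert (HQ : forall h k : C, h <> 0%C -> k <> 0%C -> Cmod h < r -> Cmod k < r ->
  norm (minus (Q h) (Q k)) <= A * (Cmod h + Cmod k)).
{ intros h k Hh Hk Hhr Hkr. specialize (H h k Hhr Hkr).
  assert (Hh' := proj1 (Cmod_gt_0 h) Hh). assert (Hk' := proj1 (Cmod_gt_0 k) Hk).
  replace (minus (Q h) (Q k)) with (scal (/ (h * k))%C
    (minus (scal k (minus (f (z + h)%C) (f z))) (scal h (minus (f (z + k)%C) (f z))))).
  2:{ unfold Q. vcoefs; simpl; field; auto. }
  rewrite norm_scal_eq, Cmod_inv, Cmod_mult by (apply Cmult_neq_0; trivial).
  apply Rmult_le_compat_l with (r := / (Cmod h * Cmod k)) in H.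
  2:{ left. apply Rinv_0_lt_compat. nra. }
  eapply Rle_trans; [exact H|]. apply Req_le. field. lra. }
(* The shift by 2 keeps every increment strictly below [r]. *)
set (e := fun n : nat => RtoC (r / INR (n + 2))).
assert (He : forall n, 0 < r / INR (n + 2) < r /\ Cmod (e n) = r / INR (n + 2)).
{ intros n. assert (Hn : 2 <= INR (n + 2)) by (rewrite plus_INR; simpl; generalize (pos_INR n); lra).
  assert (0 < r / INR (n + 2)) by (apply Rdiv_lt_0_compat; lra).
  split; [split; trivial|].
  - apply Rmult_lt_reg_r with (INR (n + 2)); [lra|]. unfold Rdiv.
    rewrite Rmult_assoc, Rinv_l by lra. nra.
  - unfold e. rewrite Cmod_R, Rabs_right; lra. }
assert (He0 : forall n, e n <> 0%C).
{ intros n. apply Cmod_gt_0. destruct (He n). lra. }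
assert (Hsmall : forall eps, 0 < eps -> exists N, forall n, (N <= n)%nat -> Cmod (e n) < eps).
{ intros eps Heps. destruct (INR_unbounded (r / eps)) as [N HN]. exists N. intros n Hn.
  destruct (He n) as [_ ->]. apply le_INR in Hn. rewrite plus_INR. simpl.
  assert (0 < r / eps) by (apply Rdiv_lt_0_compat; lra).
  apply Rmult_lt_reg_r with (INR n + (1 + 1)); [lra|]. unfold Rdiv at 1.
  rewrite Rmult_assoc, Rinv_l by lra.
  apply Rmult_lt_compat_l with (r := eps) in HN; trivial.
  replace (eps * (r / eps)) with r in HN by (field; lra). nra. }
destruct (complete_seq (fun n => Q (e n))) as [l Hl].
{ intros eps Heps. destruct (Hsmall (eps / (2 * (A + 1)))) as [N HN].
  { apply Rdiv_lt_0_compat; lra. }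
  exists N. intros n m Hn Hm.
  eapply Rle_lt_trans; [apply HQ; auto; destruct (He n), (He m); lra|].
  apply Rle_lt_trans with ((A + 1) * (Cmod (e n) + Cmod (e m))).
  { apply Rmult_le_compat_r; [generalize (Cmod_ge_0 (e n)) (Cmod_ge_0 (e m))|]; lra. }
  specialize (HN n Hn) as H1. specialize (HN m Hm) as H2.
  replace eps with ((A + 1) * (eps / (2 * (A + 1)) + eps / (2 * (A + 1)))) by (field; lra).
  apply Rmult_lt_compat_l; lra. }
assert (HQl : forall h : C, h <> 0%C -> Cmod h < r -> norm (minus (Q h) l) <= A * Cmod h).
{ intros h Hh Hhr. apply Rnot_lt_le. intros Hlt.
  set (gap := norm (minus (Q h) l) - A * Cmod h) in *.
  assert (Hgap : 0 < gap) by (unfold gap; lra).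
  destruct (Hl (gap / 2)) as [N1 HN1]; [lra|].
  destruct (Hsmall (gap / (4 * (A + 1)))) as [N2 HN2]; [apply Rdiv_lt_0_compat; lra|].
  set (n := (N1 + N2)%nat). specialize (HN1 n ltac:(lia)). specialize (HN2 n ltac:(lia)).
  assert (HQn : norm (minus (Q h) (Q (e n))) <= A * (Cmod h + Cmod (e n))).
  { apply HQ; auto. destruct (He n); lra. }
  assert (Ht : norm (minus (Q h) l) <= norm (minus (Q h) (Q (e n))) + norm (minus (Q (e n)) l)).
  { replace (minus (Q h) l) with (plus (minus (Q h) (Q (e n))) (minus (Q (e n)) l)) by vring.
    apply norm_plus_le. }
  assert ((A + 1) * Cmod (e n) <= gap / 4).
  { apply Rmult_lt_compat_l with (r := A + 1) in HN2; [|lra].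
    replace ((A + 1) * (gap / (4 * (A + 1)))) with (gap / 4) in HN2 by (field; lra). lra. }
  assert (Hgap' : norm (minus (Q h) l) = gap + A * Cmod h) by (unfold gap; ring).
  assert (Hen := Cmod_ge_0 (e n)). clearbody gap. lra. }
exists l. apply is_derive_eps. intros eps Heps.
exists (Rmin r (eps / (A + 1))). split.
{ apply Rmin_pos; trivial. apply Rdiv_lt_0_compat; lra. }
intros h Hh. assert (H1 := Rlt_le_trans _ _ _ Hh (Rmin_l _ _)).
assert (H2 := Rlt_le_trans _ _ _ Hh (Rmin_r _ _)).
destruct (Ceq_dec h 0) as [->|Hh0].
- replace (z + 0)%C with z by ring. replace (minus _ _) with (@zero E) by vring.
  rewrite norm_zero_E, Cmod_0. lra.
- replace (minus (minus (f (z + h)%C) (f z)) (scal h l)) with (scal h (minus (Q h) l)).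
  2:{ unfold Q. vcoefs; simpl; field; trivial. }
  rewrite norm_scal_eq, Rmult_comm. apply Rmult_le_compat_r; [apply Cmod_ge_0|].
  eapply Rle_trans; [now apply HQl|].
  apply Rmult_lt_compat_l with (r := A + 1) in H2; [|lra].
  replace ((A + 1) * (eps / (A + 1))) with eps in H2 by (field; lra).
  generalize (Cmod_ge_0 h). nra.
Qed.

(** Taylor at order 2 on radius [rho / 2] bounds [f (u + h) - f u - h a_1] by [8 M / rho^2 |h|^2];
    the unknown [a_1] cancels in the combination. The constant depends on [f] through [M] only. *)
Lemma second_order_estimate f (u : C) (rho M : R) : 0 < rho ->
  (forall w : C, Cmod (w - u)%C < rho ->
     ex_derive (K := C_AbsRing) f w /\ norm (f w) <= M) ->
  forall h k : C, Cmod h < rho / 4 -> Cmod k < rho / 4 ->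
     norm (minus (scal k (minus (f (u + h)%C) (f u))) (scal h (minus (f (u + k)%C) (f u))))
     <= 8 * M / rho ^ 2 * (Cmod h * Cmod k * (Cmod h + Cmod k)).
Proof.
intros Hrho Hf h k Hh Hk.
destruct (taylor f u (rho / 2) rho M) as [a Ha].
- lra.
- intros w Hw. now apply Hf.
- intros y _. apply Hf. replace (u + Cexp (ln (rho / 2), y) - u)%C with (Cexp (ln (rho / 2), y)) by ring.
  rewrite Cmod_Cexp. simpl. rewrite exp_ln; lra.
- specialize (Ha 2%nat).
  assert (H0 : f u = a O).
  { specialize (Ha 0%C). rewrite Cmod_0 in Ha. specialize (Ha ltac:(lra)).
    apply minus_zero_eq, norm_eq_zero_E. eapply Rle_trans; [|eapply Rle_trans; [exact Ha|]].
    - apply Req_le. f_equal. replace (u + 0)%C with u by ring. unfold lcomb. vring.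
    - apply Req_le. unfold Rdiv. simpl. ring. }
  assert (Hest : forall h : C, Cmod h < rho / 4 ->
    norm (minus (minus (f (u + h)%C) (f u)) (scal h (a 1%nat))) <= 8 * M / rho ^ 2 * (Cmod h * Cmod h)).
  { intros v Hv. specialize (Ha v ltac:(lra)).
    eapply Rle_trans; [|eapply Rle_trans; [exact Ha|]].
    - apply Req_le. f_equal. rewrite H0. unfold lcomb. vring.
    - apply Req_le. field. lra. }
  assert (H1 := Hest h Hh). assert (H2 := Hest k Hk).
  set (X := minus (minus (f (u + h)%C) (f u)) (scal h (a 1%nat))) in *.
  set (Y := minus (minus (f (u + k)%C) (f u)) (scal k (a 1%nat))) in *.
  replace (minus _ _) with (minus (scal k X) (scal h Y)) by (unfold X, Y; vring).
  eapply Rle_trans; [apply norm_minus_le|]. rewrite !norm_scal_eq.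
  assert (Hh0 := Cmod_ge_0 h). assert (Hk0 := Cmod_ge_0 k).
  apply Rmult_le_compat_l with (r := Cmod k) in H1; trivial.
  apply Rmult_le_compat_l with (r := Cmod h) in H2; trivial.
  eapply Rle_trans; [apply Rplus_le_compat; [exact H1|exact H2]|]. apply Req_le. ring.
Qed.

(** The secant estimate is uniform in [t], so it survives integration; the derivative of the
    integrand never has to be integrated. *)
Lemma ex_derive_CInt_param (g : C -> R -> E) (a b : R) (z : C) (rho M : R) : a <= b -> 0 < rho ->
  (forall w t, Cmod (w - z)%C < rho -> a <= t <= b ->
     ex_derive (K := C_AbsRing) (fun w => g w t) w /\ norm (g w t) <= M) ->
  (forall w : C, Cmod (w - z)%C < rho -> Cex (g w) a b) ->
  ex_derive (K := C_AbsRing) (fun w => CInt (g w) a b) z.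
Proof.
intros Hab Hrho Hg HC.
assert (Hz : forall h : C, Cmod h < rho -> Cmod (z + h - z)%C < rho).
{ intros h Hh. now replace (z + h - z)%C with h by ring. }
assert (HCz : Cex (g z) a b).
{ apply HC. replace (z - z)%C with (RtoC 0) by ring. now rewrite Cmod_0. }
apply (ex_derive_of_secants _ z ((b - a) * (8 * M / rho ^ 2)) (rho / 4)); [lra|].
intros h k Hh Hk. cbv beta. norm_struct E.
assert (HCh : Cex (g (z + h)%C) a b) by (apply HC, Hz; lra).
assert (HCk : Cex (g (z + k)%C) a b) by (apply HC, Hz; lra).
rewrite <- !CInt_minus by trivial.
assert (HCh' := Cex_minus _ _ _ _ HCh HCz). assert (HCk' := Cex_minus _ _ _ _ HCk HCz).
rewrite <- !CInt_scal by trivial.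
rewrite <- CInt_minus by (now apply Cex_scal).
rewrite Rmult_assoc. apply CInt_norm_le; trivial.
- apply Cex_minus; now apply Cex_scal.
- intros t Ht. apply (second_order_estimate (fun w => g w t) z rho M); trivial.
  intros w Hw. now apply Hg.
Qed.

(** Used for [{0}], where membership gives uniqueness theorems, and for a line [C e]. *)
Record closed_subspace (V : E -> Prop) : Prop := {
  subspace_zero : V zero;
  subspace_plus : forall x y, V x -> V y -> V (plus x y);
  subspace_scal : forall (c : C) x, V x -> V (scal c x);
  subspace_closed : forall x, (forall eps, 0 < eps -> exists v, V v /\ norm (minus x v) <= eps) -> V x }.

Lemma subspace_minus V x y : closed_subspace V -> V x -> V y -> V (minus x y).
Proof.
intros HV Hx Hy. replace (minus x y) with (plus x (scal (- (1))%C y)) by vring.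
apply (subspace_plus V HV); trivial. now apply (subspace_scal V HV).
Qed.

Lemma subspace_lcomb V (a : nat -> E) (c : nat -> C) N : closed_subspace V ->
  (forall n, (n < N)%nat -> V (a n)) -> V (lcomb a c N).
Proof.
intros HV. induction N as [|N IH]; simpl; intros Ha.
- apply (subspace_zero V HV).
- apply (subspace_plus V HV); [apply IH; auto with arith|].
  apply (subspace_scal V HV). auto with arith.
Qed.

(** By strong induction, [a n] is the limit of [f (u + t)] minus its first [n] terms, divided by
    [t ^ n], as [t] decreases to 0; these quotients lie in [V]. *)
Lemma coefficients_in_subspace V f (u : C) (a : nat -> E) (A r t0 : R) : closed_subspace V ->
  0 < r -> 0 < t0 -> 0 <= A ->
  (forall (N : nat) (h : C), Cmod h <= t0 ->
     norm (minus (f (u + h)%C) (lcomb a (fun n => h ^ n)%C N)) <= A * (Cmod h / r) ^ N) ->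
  (forall t, 0 < t <= t0 -> V (f (u + RtoC t)%C)) ->
  forall n, V (a n).
Proof.
intros HV Hr Ht0 HA Hest Hf n. induction n as [n IH] using (well_founded_induction lt_wf).
apply (subspace_closed V HV). intros eps Heps.
assert (Hrn : 0 < r ^ S n) by now apply pow_lt.
(* After division by [t ^ n] the remainder of order [S n] is at most [A * t / r ^ S n], hence at
   most [eps]. *)
set (t := Rmin t0 (eps * r ^ S n / (A + 1))).
assert (Hq : 0 < eps * r ^ S n / (A + 1)) by (apply Rdiv_lt_0_compat; nra).
assert (Ht : 0 < t) by now apply Rmin_pos.
assert (Ht1 : t <= t0) by apply Rmin_l.
assert (Ht2 : t <= eps * r ^ S n / (A + 1)) by apply Rmin_r.
assert (Hm : Cmod (RtoC t) = t) by (rewrite Cmod_R, Rabs_right; lra).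
assert (Htn : 0 < t ^ n) by now apply pow_lt.
assert (Hne : (RtoC t ^ n)%C <> 0%C) by (apply Cpow_nz; intros K; injection K; lra).
exists (scal (/ RtoC t ^ n)%C (minus (f (u + RtoC t)%C) (lcomb a (fun n => RtoC t ^ n)%C n))).
split.
- apply (subspace_scal V HV). apply subspace_minus; trivial; [apply Hf; lra|].
  now apply subspace_lcomb.
- specialize (Hest (S n) (RtoC t)). rewrite Hm in Hest. specialize (Hest Ht1). simpl lcomb in Hest.
  set (L := lcomb a (fun n => RtoC t ^ n)%C n) in *.
  replace (minus (a n) (scal (/ RtoC t ^ n)%C (minus (f (u + RtoC t)%C) L))) with
    (scal (- / RtoC t ^ n)%C (minus (f (u + RtoC t)%C) (plus L (scal (RtoC t ^ n)%C (a n))))).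
  2:{ vcoefs; simpl; field; trivial. }
  rewrite norm_scal_eq, Cmod_opp, Cmod_inv, Cmod_pow, Hm by trivial.
  apply Rmult_le_compat_l with (r := / t ^ n) in Hest.
  2:{ left; now apply Rinv_0_lt_compat. }
  eapply Rle_trans; [exact Hest|].
  replace (/ t ^ n * (A * (t / r) ^ S n)) with (A * t / r ^ S n).
  2:{ unfold Rdiv. rewrite Rpow_mult_distr, pow_inv. simpl. field. split; [|split]; try lra.
      apply pow_nonzero; lra. }
  apply Rmult_le_compat_r with (r := (A + 1) / r ^ S n) in Ht2.
  2:{ apply Rdiv_le_0_compat; lra. }
  replace (eps * r ^ S n / (A + 1) * ((A + 1) / r ^ S n)) with eps in Ht2 by (field; lra).
  eapply Rle_trans; [|exact Ht2].
  replace (t * ((A + 1) / r ^ S n)) with (A * t / r ^ S n + t / r ^ S n) by (field; lra).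
  assert (0 < t / r ^ S n) by now apply Rdiv_lt_0_compat. lra.
Qed.

Lemma circle_bounded f (u : C) (r rho : R) : 0 < r < rho ->
  (forall w : C, Cmod (w - u)%C < rho -> ex_derive (K := C_AbsRing) f w) ->
  exists M, 0 <= M /\ forall y, 0 <= y <= 2 * PI -> norm (f (u + Cexp (ln r, y))%C) <= M.
Proof.
intros Hr Hf. assert (HP := PI_RGT_0).
destruct (Cex_bounded (fun y => f (u + Cexp (ln r, y))%C) 0 (2 * PI)) as [M HM]; [lra| |].
- apply (Cex_vline (fun z => f (u + Cexp z)%C)); [lra|]. intros y _.
  apply ex_derive_exp_shift, Hf.
  replace (u + Cexp (ln r, y) - u)%C with (Cexp (ln r, y)) by ring.
  rewrite Cmod_Cexp; simpl; rewrite exp_ln; lra.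
- exists M. split; trivial. eapply Rle_trans; [|apply (HM 0); lra]. apply norm_pos.
Qed.

(** Analytic continuation along a ray in logarithmic coordinates: the values near the origin are
    those with [x <= x0], and each Taylor expansion carries membership in [V] a distance [eta / 8]
    further. *)
Lemma line_identity V f (y eta x0 x1 : R) : closed_subspace V -> 0 < eta ->
  (forall z : C, Rabs (snd z - y) < eta -> fst z < x1 + eta -> ex_derive (K := C_AbsRing) f z) ->
  (forall x, x <= x0 -> V (f (x, y))) ->
  forall x, x <= x1 -> V (f (x, y)).
Proof.
intros HV Heta Hf H0.
assert (Hn : forall n x, x <= x0 + INR n * (eta / 8) -> x <= x1 -> V (f (x, y))).
{ induction n as [|n IH].
  - intros x Hx _. apply H0. simpl in Hx. lra.
  - intros x Hx Hx1. rewrite S_INR in Hx.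
    destruct (Rle_lt_dec x (x0 + INR n * (eta / 8))) as [Hle|Hlt]; [now apply IH|].
    (* The centre lies [eta / 8] behind the known region, whose points to its right determine the
       coefficients; [x] is within [eta / 4] of it, half the Taylor radius [eta / 2], so the
       remainders decay like [(/ 2) ^ N]. *)
    set (c := x0 + INR n * (eta / 8) - eta / 8).
    assert (Hc : x - c <= eta / 4 /\ eta / 8 < x - c) by (unfold c; lra).
    assert (Hd : forall w : C, Cmod (w - (c, y))%C < eta -> ex_derive (K := C_AbsRing) f w).
    { intros [w1 w2] Hw. assert (HR := Rmax_Cmod ((w1, w2) - (c, y))%C). simpl in HR.
      assert (HR1 := Rle_trans _ _ _ (Rmax_l _ _) HR).
      assert (HR2 := Rle_trans _ _ _ (Rmax_r _ _) HR).
      apply Hf; simpl.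
      - change (w2 + - y) with (w2 - y) in HR2. lra.
      - assert (Hw1 := Rle_abs (w1 + - c)). lra. }
    destruct (circle_bounded f (c, y) (eta / 2) eta) as [M [HM0 HM]]; [lra|trivial|].
    destruct (taylor f (c, y) (eta / 2) eta M) as [a Ha]; trivial; [lra|].
    assert (Hline : forall t, ((c, y) + RtoC t)%C = (c + t, y)).
    { intros t. unfold Cplus, RtoC; simpl. f_equal; ring. }
    assert (HaV : forall n, V (a n)).
    { apply (coefficients_in_subspace V f (c, y) a (2 * M) (eta / 2) (eta / 8)); trivial; try lra.
      - intros N h Hh. apply Ha. lra.
      - intros t Ht. rewrite Hline. apply IH; unfold c in *; lra. }
    apply (subspace_closed V HV). intros eps Heps.
    destruct (pow_lt_1_zero (/ 2)) with (y := eps / (2 * M + 1)) as [N HN].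
    { rewrite Rabs_right; lra. }
    { apply Rdiv_lt_0_compat; lra. }
    specialize (HN N (le_n N)). rewrite Rabs_right in HN by (apply Rle_ge, pow_le; lra).
    exists (lcomb a (fun n => RtoC (x - c) ^ n)%C N). split.
    { apply subspace_lcomb; auto. }
    assert (Hm : Cmod (RtoC (x - c)) = x - c) by (rewrite Cmod_R, Rabs_right; lra).
    specialize (Ha N (RtoC (x - c))). rewrite Hm, Hline in Ha.
    replace (c + (x - c)) with x in Ha by ring.
    eapply Rle_trans; [apply Ha; lra|].
    assert (Hp : ((x - c) / (eta / 2)) ^ N <= (/ 2) ^ N).
    { apply pow_incr. split; [apply Rdiv_le_0_compat; lra|].
      apply Rmult_le_reg_r with (eta / 2); [lra|]. unfold Rdiv at 1.
      rewrite Rmult_assoc, Rinv_l; lra. }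
    apply Rmult_lt_compat_l with (r := 2 * M + 1) in HN; [|lra].
    replace ((2 * M + 1) * (eps / (2 * M + 1))) with eps in HN by (field; lra).
    assert (0 < (/ 2) ^ N) by (apply pow_lt; lra). nra. }
intros x Hx. destruct (INR_unbounded ((x - x0) / (eta / 8))) as [n Hn'].
apply (Hn n); trivial.
apply Rmult_lt_compat_r with (r := eta / 8) in Hn'; [|lra].
replace ((x - x0) / (eta / 8) * (eta / 8)) with (x - x0) in Hn' by (field; lra). lra.
Qed.

Lemma zero_closed_subspace : closed_subspace (fun x : E => x = zero).
Proof.
split; trivial.
- intros x y -> ->. vring.
- intros c x ->. vring.
- intros x H. apply (norm_eps_zero _ 1). intros eps Heps. rewrite Rmult_1_r.
  destruct (H eps Heps) as [v [-> Hv]].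
  now replace x with (minus x zero) by vring.
Qed.
End Consequences.

(** * Sectors and growth *)

Lemma in_sector_Cexp d delta z :
  in_sector d delta z <-> exists x y, Rabs (y - d) < delta / 2 /\ z = Cexp (x, y).
Proof.
split.
- intros [r [y [Hr [Hy ->]]]]. exists (ln r), y. split; trivial.
  unfold Cexp; simpl. now rewrite exp_ln.
- intros [x [y [Hy ->]]]. exists (exp x), y. split; [apply exp_pos|]. split; trivial.
Qed.

Lemma sector_neq_0 d delta z : in_sector d delta z -> z <> 0%C.
Proof. rewrite in_sector_Cexp. intros [x [y [_ ->]]]. apply Cexp_neq_0. Qed.

(** A small relative perturbation [1 + eta] turns angles by less than [eps], which makes sectors
    open. In the right half-plane the angle is an [atan], continuous at 0. *)
Lemma polar_near_1 eps : 0 < eps -> exists kappa, 0 < kappa < 1 /\ forall eta : C,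
  Cmod eta < kappa -> exists x y, Rabs y < eps /\ (1 + eta)%C = Cexp (x, y).
Proof.
intros Heps.
assert (Hc : continuity_pt atan 0) by (apply derivable_continuous_pt, derivable_pt_atan).
destruct (Hc eps Heps) as [d [Hd H]].
exists (Rmin (1 / 2) (d / 4)). split.
{ split; [apply Rmin_pos; lra|]. generalize (Rmin_l (1 / 2) (d / 4)); lra. }
intros [a b] Heta.
assert (H1 := Rlt_le_trans _ _ _ Heta (Rmin_l _ _)).
assert (H2 := Rlt_le_trans _ _ _ Heta (Rmin_r _ _)).
assert (HR := Rmax_Cmod (a, b)). simpl in HR.
assert (Ha := Rle_trans _ _ _ (Rmax_l _ _) HR). assert (Hb := Rle_trans _ _ _ (Rmax_r _ _) HR).
assert (Ha1 : 1 / 2 < 1 + a) by (destruct (Rabs_def2 a (1 / 2)); lra).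
set (t := b / (1 + a)).
assert (Ht : Rabs t < d).
{ unfold t. unfold Rdiv. rewrite Rabs_mult, (Rabs_right (/ (1 + a))).
  2:{ apply Rle_ge. left. apply Rinv_0_lt_compat. lra. }
  assert (/ (1 + a) <= 2).
  { replace 2 with (/ (1 / 2)) by field. apply Rinv_le_contravar; lra. }
  assert (0 < / (1 + a)) by (apply Rinv_0_lt_compat; lra).
  apply Rle_lt_trans with (Rabs b * 2); [|lra].
  apply Rmult_le_compat_l; trivial. apply Rabs_pos. }
assert (Hs : 0 < sqrt (1 + t²)) by (apply sqrt_lt_R0; generalize (Rle_0_sqr t); lra).
exists (ln ((1 + a) * sqrt (1 + t²))), (atan t). split.
- destruct (Req_dec t 0) as [Ht0|Ht0].
  + now rewrite Ht0, atan_0, Rabs_R0.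
  + specialize (H t). rewrite <- (Rminus_0_r (atan t)), <- atan_0. apply H. split.
    * split; [exact I|]. auto.
    * simpl. unfold Rdist. now rewrite Rminus_0_r.
- unfold Cexp; simpl. rewrite exp_ln by nra. rewrite cos_atan, sin_atan.
  unfold Cplus, RtoC; simpl. f_equal.
  + field. lra.
  + transitivity ((1 + a) * t); [unfold t; field; lra|field; lra].
Qed.

Lemma Cexp_add_angle x y x' y' : (Cexp (x, y) * Cexp (x', y'))%C = Cexp (x + x', y + y').
Proof. now rewrite <- Cexp_plus. Qed.

(* [logn z] replaces the [ln (Cmod z + h)] of the definition of q-exponential
   growth; it is nonnegative, which makes the normal form below monotone in both
   constants. *)
Definition logn (z : C) : R := ln (1 + Cmod z).

Lemma logn_pos z : 0 <= logn z.
Proof. unfold logn. rewrite <- ln_1. apply ln_le; generalize (Cmod_ge_0 z); lra. Qed.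

Lemma exp_le a b : a <= b -> exp a <= exp b.
Proof. intros [H| ->]; [left; now apply exp_increasing|lra]. Qed.

Section Growth.
Context {E : NormedModule C_AbsRing}.

(** Here [c] is meant to be [/ (2 * s * ln q)] and [L] to be [logn z]. *)
Definition qbound (c K beta L : R) : R := K * exp (c * L ^ 2 + beta * L).

Definition growth (c : R) (S : C -> Prop) (f : C -> E) : Prop :=
  exists K beta, 0 < K /\ 0 <= beta /\ forall z, S z -> norm (f z) <= qbound c K beta (logn z).

(** [ln (Cmod z + h)] and [logn z] differ by a bounded amount, so their squares differ by a term
    linear in [logn z], which [K] and [beta] absorb. *)
Lemma growth_q_exp q s S (f : C -> E) : 1 < q -> 0 < s ->
  q_exp_growth q s S f <-> growth (/ (2 * s * ln q)) S f.
Proof.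
intros Hq Hs.
assert (Hlq : 0 < ln q) by (rewrite <- ln_1; apply ln_increasing; lra).
assert (Hc : 0 < / (2 * s * ln q)) by (apply Rinv_0_lt_compat; nra).
set (c := / (2 * s * ln q)) in *.
split.
- intros [K [h [alpha [HK [Hh Hf]]]]].
  (* Comes from [(1 + |z|) * Rmin 1 h <= |z| + h <= (1 + |z|) * (1 + h)]. *)
  set (B := ln (1 + h) + Rabs (ln (Rmin 1 h))).
  assert (HB1 : 0 <= ln (1 + h)) by (rewrite <- ln_1; apply ln_le; lra).
  assert (HB : 0 <= B) by (unfold B; generalize (Rabs_pos (ln (Rmin 1 h))); lra).
  exists (K * exp (c * B ^ 2 + Rabs alpha * B)), (c * 2 * B + Rabs alpha).
  split; [apply Rmult_lt_0_compat; trivial; apply exp_pos|]. split.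
  { assert (0 <= c * 2 * B) by nra. generalize (Rabs_pos alpha); lra. }
  intros z Hz. eapply Rle_trans; [exact (Hf z Hz)|].
  assert (Hm := Cmod_ge_0 z). set (L := logn z). assert (HL : 0 <= L) by apply logn_pos.
  set (l := ln (Cmod z + h)).
  assert (Hup : l <= L + B).
  { apply Rle_trans with (ln ((1 + Cmod z) * (1 + h))); [apply ln_le; nra|].
    rewrite ln_mult by lra. unfold B, L, logn. generalize (Rabs_pos (ln (Rmin 1 h))). lra. }
  assert (Hmin : 0 < Rmin 1 h) by (apply Rmin_pos; lra).
  assert (Hlo : L - B <= l).
  { apply Rle_trans with (ln ((1 + Cmod z) * Rmin 1 h)).
    - rewrite ln_mult by lra. unfold B, L, logn.
      generalize (Rle_abs (- ln (Rmin 1 h))). rewrite Rabs_Ropp. lra.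
    - apply ln_le; [nra|]. generalize (Rmin_l 1 h) (Rmin_r 1 h). nra. }
  assert (Hl2 : l ^ 2 <= (L + B) ^ 2) by nra.
  assert (Hal : alpha * l <= Rabs alpha * (L + B)).
  { eapply Rle_trans; [apply Rle_abs|]. rewrite Rabs_mult.
    apply Rmult_le_compat_l; [apply Rabs_pos|]. apply Rabs_le. lra. }
  unfold Rpower, qbound. fold l.
  replace (l ^ 2 / (2 * s * ln q)) with (c * l ^ 2) by (unfold c; field; lra).
  rewrite !Rmult_assoc, <- !exp_plus. apply Rmult_le_compat_l; [lra|].
  apply exp_le.
  assert (c * l ^ 2 <= c * (L + B) ^ 2) by (apply Rmult_le_compat_l; lra).
  assert (c * (L + B) ^ 2 = c * L ^ 2 + c * 2 * B * L + c * B ^ 2) by ring. lra.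
- intros [K [beta [HK [Hb Hf]]]]. exists K, 1, beta. split; trivial. split; [lra|].
  intros z Hz. eapply Rle_trans; [exact (Hf z Hz)|]. apply Req_le.
  unfold qbound, logn, Rpower. rewrite exp_plus, Rmult_assoc, (Rplus_comm 1).
  unfold c. do 3 f_equal. field. lra.
Qed.

Lemma qbound_mono c K K' beta beta' L : 0 <= L -> 0 <= K <= K' -> beta <= beta' ->
  qbound c K beta L <= qbound c K' beta' L.
Proof.
intros HL HK Hb. unfold qbound. apply Rmult_le_compat; try lra.
- left; apply exp_pos.
- apply exp_le. apply Rplus_le_compat_l. apply Rmult_le_compat_r; lra.
Qed.

End Growth.

(** Heine-Borel for a property of intervals stable under concatenation, by the supremum of the
    points reached from [a]. *)
Lemma interval_covering (P : R -> R -> Prop) (a b : R) :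
  (forall u v w, u <= v -> v <= w -> P u v -> P v w -> P u w) ->
  (forall t, a <= t <= b -> exists eta, 0 < eta /\
     forall u v, t - eta < u -> u <= t -> t <= v -> v < t + eta -> P u v) ->
  a <= b -> P a b.
Proof.
intros Hadd Hloc Hab.
set (S := fun t => a <= t <= b /\ P a t).
destruct (Hloc a ltac:(lra)) as [e0 [He0 H0]].
destruct (completeness S) as [m [Hub Hlub]].
- exists b. intros t [Ht _]. lra.
- exists a. split; [lra|]. apply H0; lra.
- assert (Ham : a <= m) by (apply Hub; split; [lra|apply H0; lra]).
  assert (Hmb : m <= b) by (apply Hlub; intros t [Ht _]; lra).
  destruct (Hloc m ltac:(lra)) as [e [He Hm]].
  assert (Hex : exists t, S t /\ m - e < t).
  { apply NNPP. intros Hn. assert (m <= m - e); [|lra].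
    apply Hlub. intros t Ht. apply Rnot_lt_le. intros Hlt. apply Hn. now exists t. }
  destruct Hex as [t [[Ht HPt] Htm]].
  assert (Htm' : t <= m) by (apply Hub; split; trivial).
  (* [P] reaches [m'], so [m' <= m] as [m] is the supremum; this forces [m' = b]. *)
  set (m' := Rmin b (m + e / 2)).
  assert (Hm1 : m <= m') by (apply Rmin_glb; lra).
  assert (Hm2 : m' <= m + e / 2) by apply Rmin_r.
  assert (Hm3 : m' <= b) by apply Rmin_l.
  assert (HP : P a m').
  { apply Hadd with t; trivial; try lra. apply Hm; lra. }
  assert (Hm' : m' <= m) by (apply Hub; split; trivial; lra).
  replace b with m'; trivial. unfold m' in *.
  revert Hm1 Hm'. unfold Rmin; destruct (Rle_dec b (m + e / 2)); lra.
Qed.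

(** * Power series and uniqueness of extensions *)

Definition sector_disc (d delta rho : R) (z : C) : Prop := in_sector d delta z \/ in_disc rho z.

(** In the coordinate [log z] a sector is a strip and a disc a left half-plane, so the domain
    contains a half-strip to the left of each of its points: the setting of [line_identity]. The
    angle [y] may differ from the one in the sector by a period. *)
Lemma sector_disc_half_strip d delta rho x y : 0 < rho -> sector_disc d delta rho (Cexp (x, y)) ->
  exists eta, 0 < eta /\ forall z : C, Rabs (snd z - y) < eta -> fst z < x + eta ->
    sector_disc d delta rho (Cexp z).
Proof.
intros Hrho [H|H].
- apply in_sector_Cexp in H. destruct H as [x' [y' [Hy' Heq]]].
  exists (delta / 2 - Rabs (y' - d)). split; [lra|]. intros [a b] Hb _. simpl in Hb.
  left. apply in_sector_Cexp. exists (a + (x' - x)), (b + (y' - y)). split.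
  + replace (b + (y' - y) - d) with ((b - y) + (y' - d)) by ring.
    eapply Rle_lt_trans; [apply Rabs_triang|]. lra.
  + rewrite <- Cexp_add_angle.
    replace (x' - x, y' - y) with ((x', y') + - (x, y))%C.
    2:{ unfold Cplus, Copp; simpl. f_equal; ring. }
    rewrite Cexp_plus, Cexp_opp, <- Heq. field. apply Cexp_neq_0.
- unfold in_disc in H. rewrite Cmod_Cexp in H. simpl in H.
  assert (Hx : x < ln rho) by (apply exp_lt_inv; now rewrite exp_ln).
  exists (ln rho - x). split; [lra|]. intros z _ Hz. right. unfold in_disc.
  rewrite Cmod_Cexp, <- (exp_ln rho) by trivial. apply exp_increasing. lra.
Qed.

Lemma sector_open d delta z : in_sector d delta z ->
  exists kappa, 0 < kappa /\ forall w : C, Cmod (w - z)%C < kappa -> in_sector d delta w.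
Proof.
intros H. assert (Hz := sector_neq_0 _ _ _ H).
apply in_sector_Cexp in H. destruct H as [x [y [Hy ->]]].
destruct (polar_near_1 (delta / 2 - Rabs (y - d))) as [k [Hk H]]; [lra|].
assert (Hm := exp_pos x).
exists (k * exp x). split; [nra|]. intros w Hw.
destruct (H ((w - Cexp (x, y)) / Cexp (x, y))%C) as [x' [y' [Hy' Heq]]].
{ rewrite Cmod_div, Cmod_Cexp by trivial. simpl. apply Rmult_lt_reg_r with (exp x); trivial.
  unfold Rdiv. rewrite Rmult_assoc, Rinv_l; lra. }
apply in_sector_Cexp. exists (x + x'), (y + y'). split.
- replace (y + y' - d) with ((y - d) + y') by ring.
  eapply Rle_lt_trans; [apply Rabs_triang|]. lra.
- rewrite <- Cexp_add_angle, <- Heq. field. trivial.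
Qed.

Lemma sector_disc_open d delta rho z : sector_disc d delta rho z ->
  exists kappa, 0 < kappa /\ forall w : C, Cmod (w - z)%C < kappa -> sector_disc d delta rho w.
Proof.
intros [H|H].
- destruct (sector_open _ _ _ H) as [k [Hk Hw]]. exists k. split; trivial. intros w Hwz.
  left. auto.
- exists (rho - Cmod z). unfold in_disc in H. split; [lra|]. intros w Hw. right. unfold in_disc.
  replace w with (w - z + z)%C by ring. eapply Rle_lt_trans; [apply Cmod_triangle|]. lra.
Qed.

Section PowerSeries.
Context {E : CompleteNormedModule C_AbsRing}.

Lemma sum_n_lcomb (a : nat -> E) (z : C) n :
  sum_n (fun k => scal (pow_n (K := C_AbsRing) z k) (a k)) n = lcomb a (fun k => z ^ k)%C (S n).
Proof.
assert (Hp : forall k, pow_n (K := C_AbsRing) z k = (z ^ k)%C).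
{ reflexivity. }
induction n as [|n IH].
- rewrite sum_O, Hp. simpl. vring.
- rewrite sum_Sn, IH, Hp. reflexivity.
Qed.

Lemma is_pseries_lcomb (a : nat -> E) (z : C) (l : E) :
  is_pseries (K := C_AbsRing) a z l <->
  forall eps, 0 < eps -> exists N, forall n, (N <= n)%nat ->
    norm (minus (lcomb a (fun k => z ^ k)%C n) l) < eps.
Proof.
split.
- intros H eps Heps. assert (Hn := @norm_factor_gt_0 _ E).
  assert (He : 0 < eps / @norm_factor _ E) by now apply Rdiv_lt_0_compat.
  destruct (H _ (locally_ball l (mkposreal _ He))) as [N HN]. exists (S N). intros [|n] Hn'; [lia|].
  assert (HB := @norm_compat2 _ E _ _ _ (HN n ltac:(lia))). simpl pos in HB.
  rewrite sum_n_lcomb in HB.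
  replace eps with (@norm_factor _ E * (eps / @norm_factor _ E)) by (field; lra).
  exact HB.
- intros H P [[eps Heps] HP]. destruct (H eps Heps) as [N HN]. exists N. intros n Hn.
  apply HP. apply (@norm_compat1 _ E). rewrite sum_n_lcomb. apply HN. lia.
Qed.

Lemma is_pseries_unique_E (a : nat -> E) (z : C) (l l' : E) :
  is_pseries (K := C_AbsRing) a z l -> is_pseries (K := C_AbsRing) a z l' -> l = l'.
Proof. intros H H'. exact (filterlim_locally_unique _ l l' H H'). Qed.

Lemma eventually_bounded (u : nat -> R) (N : nat) (A : R) :
  (forall n, (N <= n)%nat -> u n <= A) -> exists M, 0 <= M /\ forall n, u n <= M.
Proof.
revert A. induction N as [|N IH]; intros A H.
- exists (Rmax A 0). split; [apply Rmax_r|]. intros n. eapply Rle_trans; [|apply Rmax_l]. auto with arith.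
- apply (IH (Rmax A (u N))). intros n Hn. destruct (Nat.eq_dec n N) as [->|]; [apply Rmax_r|].
  eapply Rle_trans; [|apply Rmax_l]. apply H. lia.
Qed.

(** Convergence at [r] bounds [norm (a n) * r ^ n] by some [M]; for [|z| <= r / 2] the tail is
    dominated by a geometric series of ratio at most [1 / 2], whence the factor 2. *)
Lemma pseries_tail (a : nat -> E) (f : C -> E) (r rho : R) : 0 < r < rho ->
  (forall z, in_disc rho z -> is_pseries (K := C_AbsRing) a z (f z)) ->
  exists M, 0 <= M /\ forall (N : nat) (z : C), Cmod z <= r / 2 ->
    norm (minus (f z) (lcomb a (fun n => z ^ n)%C N)) <= 2 * M * (Cmod z / r) ^ N.
Proof.
intros Hr Hf.
assert (Hmr : Cmod (RtoC r) = r) by (rewrite Cmod_R, Rabs_right; lra).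
assert (Hr' : in_disc rho (RtoC r)) by (unfold in_disc; lra).
destruct (proj1 (is_pseries_lcomb _ _ _) (Hf _ Hr') 1 Rlt_0_1) as [N0 HN0].
(* Two consecutive partial sums are within 1 of the limit, so the term between them has norm at most
   2. *)
destruct (eventually_bounded (fun n => norm (a n) * r ^ n) N0 2) as [M [HM0 HM]].
{ intros n Hn. assert (H1 := HN0 n Hn). assert (H2 := HN0 (S n) ltac:(lia)). simpl lcomb in H2.
  set (L := lcomb a (fun k => RtoC r ^ k)%C n) in *.
  replace (norm (a n) * r ^ n) with (norm (scal (RtoC r ^ n)%C (a n))).
  2:{ rewrite norm_scal_eq, Cmod_pow, Hmr. ring. }
  replace (scal (RtoC r ^ n)%C (a n)) with
   (minus (minus (plus L (scal (RtoC r ^ n)%C (a n))) (f r)) (minus L (f r))) by vring.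
  eapply Rle_trans; [apply norm_minus_le|]. norm_struct E. lra. }
exists M. split; trivial. intros N z Hz.
set (t := Cmod z / r).
assert (Hm := Cmod_ge_0 z).
assert (Ht : 0 <= t <= / 2).
{ unfold t. split; [apply Rdiv_le_0_compat; lra|].
  apply Rmult_le_reg_r with r; [lra|]. unfold Rdiv. rewrite Rmult_assoc, Rinv_l; lra. }
(* The subtracted term makes the induction close: [M t^n <= 2 M t^n - 2 M t^(n+1)] because
   [t <= 1 / 2]. *)
assert (Hpart : forall k, norm (minus (lcomb a (fun n => z ^ n)%C (N + k)) (lcomb a (fun n => z ^ n)%C N))
   <= 2 * M * t ^ N - 2 * M * t ^ (N + k)).
{ induction k as [|k IH].
  - rewrite Nat.add_0_r. replace (minus _ _) with (@zero E) by vring. rewrite norm_zero_E. lra.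
  - rewrite Nat.add_succ_r. simpl lcomb. norm_struct E.
    set (Lk := lcomb a (fun n => z ^ n)%C (N + k)) in *.
    set (L := lcomb a (fun n => z ^ n)%C N) in *.
    assert (Hplus : forall u v w : E, minus (plus u v) w = plus (minus u w) v) by (intros; vring).
    rewrite Hplus. eapply Rle_trans; [apply norm_plus_le|]. rewrite norm_scal_eq, Cmod_pow.
    assert (Hterm : Cmod z ^ (N + k) * norm (a (N + k)%nat) <= M * t ^ (N + k)).
    { replace (Cmod z ^ (N + k) * norm (a (N + k)%nat)) with
        ((norm (a (N + k)%nat) * r ^ (N + k)) * t ^ (N + k)).
      - apply Rmult_le_compat_r; [apply pow_le; lra|]. apply HM.
      - unfold t, Rdiv. rewrite Rpow_mult_distr, pow_inv. field. apply pow_nonzero; lra. }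
    simpl. assert (0 <= t ^ (N + k)) by (apply pow_le; lra).
    assert (M * t ^ (N + k) <= 2 * M * t ^ (N + k) - 2 * M * (t * t ^ (N + k))).
    { assert (0 <= M * t ^ (N + k) * (1 - 2 * t)); [|lra].
      apply Rmult_le_pos; [nra|lra]. }
    norm_struct E. lra. }
apply Rnot_lt_le. intros Hlt.
assert (Hz' : in_disc rho z) by (unfold in_disc; lra).
set (gap := norm (minus (f z) (lcomb a (fun n => z ^ n)%C N)) - 2 * M * t ^ N) in *.
assert (Hgap : 0 < gap) by (unfold gap; lra).
destruct (proj1 (is_pseries_lcomb _ _ _) (Hf _ Hz') gap Hgap) as [N1 HN1].
specialize (HN1 (N + N1)%nat ltac:(lia)). specialize (Hpart N1).
set (Lk := lcomb a (fun n => z ^ n)%C (N + N1)) in *.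
set (L := lcomb a (fun n => z ^ n)%C N) in *.
assert (Htri : forall u v w : E, norm (minus u w) <= norm (minus v u) + norm (minus v w)).
{ intros u v w. rewrite (norm_minus_sym v u).
  replace (minus u w) with (plus (minus u v) (minus v w)) by vring. apply norm_plus_le. }
specialize (Htri (f z) Lk L).
assert (0 <= 2 * M * t ^ (N + N1)) by (apply Rmult_le_pos; [lra|apply pow_le; lra]).
unfold gap in HN1. norm_struct E. lra.
Qed.
End PowerSeries.

Section Extensions.
Context {E : CompleteNormedModule C_AbsRing}.

Definition extension (c : R) (a : nat -> E) (d delta rho : R) (f : C -> E) : Prop :=
  0 < delta /\ 0 < rho /\
  holomorphic_on (sector_disc d delta rho) f /\
  (forall z : C, in_disc rho z -> is_pseries (K := C_AbsRing) a z (f z)) /\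
  growth c (in_sector d delta) f.

Lemma extends_extension q s d (a : nat -> E) : 1 < q -> 0 < s ->
  extends_with_q_exp_growth q s d a <->
  exists delta rho f, extension (/ (2 * s * ln q)) a d delta rho f.
Proof.
intros Hq Hs; split; intros [delta [rho [f [H1 [H2 [H3 [H4 H5]]]]]]];
  exists delta, rho, f; apply growth_q_exp in H5 || apply (growth_q_exp q s) in H5; trivial;
  exact (conj H1 (conj H2 (conj H3 (conj H4 H5)))).
Qed.

(** Both domains contain the segment from 0 to [z], and continuation along it suffices, whatever the
    two directions are. *)
Lemma extension_unique c c' (a : nat -> E) d d' delta delta' rho rho' f f' z :
  extension c a d delta rho f -> extension c' a d' delta' rho' f' ->
  sector_disc d delta rho z -> sector_disc d' delta' rho' z -> f z = f' z.
Proof.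
intros [_ [Hrho [Hf [Hs _]]]] [_ [Hrho' [Hf' [Hs' _]]]] Hz Hz'.
destruct (Ceq_dec z 0) as [->|Hz0].
- apply (is_pseries_unique_E a 0%C).
  + apply Hs. unfold in_disc. now rewrite Cmod_0.
  + apply Hs'. unfold in_disc. now rewrite Cmod_0.
- destruct (polar_form z Hz0) as [x [y ->]].
  destruct (sector_disc_half_strip _ _ _ _ _ Hrho Hz) as [e [He H]].
  destruct (sector_disc_half_strip _ _ _ _ _ Hrho' Hz') as [e' [He' H']].
  apply minus_zero_eq.
  apply (line_identity (fun x : E => x = zero) (fun z => minus (f (Cexp z)) (f' (Cexp z)))
    y (Rmin e e') (ln (Rmin rho rho') - 1) x zero_closed_subspace).
  + now apply Rmin_pos.
  + intros w Hw1 Hw2. assert (Hl := Rmin_l e e'). assert (Hr := Rmin_r e e').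
    apply ex_derive_minus_C; apply (ex_derive_comp_C _ Cexp);
      try (eexists; apply is_derive_Cexp).
    * apply Hf, H; lra.
    * apply Hf', H'; lra.
  + intros t Ht. assert (Hm : 0 < Rmin rho rho') by now apply Rmin_pos.
    assert (Hl := Rmin_l rho rho'). assert (Hr := Rmin_r rho rho').
    assert (Hd : exp t < Rmin rho rho').
    { rewrite <- (exp_ln (Rmin rho rho')) by trivial. apply exp_increasing. lra. }
    replace (f (Cexp (t, y))) with (f' (Cexp (t, y))); [vring|].
    apply (is_pseries_unique_E a (Cexp (t, y))); [apply Hs'|apply Hs];
      unfold in_disc; rewrite Cmod_Cexp; simpl; lra.
  + lra.
Qed.

(** [G] picks the value of any extension defined at the point; [extension_unique] makes the choice
    immaterial. Covering the compact interval of angles by finitely many sectors turns the constants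
    of each direction into common ones. *)
Lemma glue_extensions c (b : nat -> E) :
  (forall theta, (forall k : Z, theta <> IZR k * (2 * PI)) ->
     exists delta rho f, extension c b theta delta rho f) ->
  exists (G : C -> E) rho, 0 < rho /\
    (forall z, in_disc rho z -> ex_derive (K := C_AbsRing) G z) /\
    (forall z, in_disc rho z -> is_pseries (K := C_AbsRing) b z (G z)) /\
    (forall x y, 0 < y < 2 * PI -> ex_derive (K := C_AbsRing) G (Cexp (x, y))) /\
    (forall eps, 0 < eps <= PI -> exists K beta, 0 < K /\ 0 <= beta /\
       forall x y, eps <= y <= 2 * PI - eps ->
       norm (G (Cexp (x, y))) <= qbound c K beta (logn (Cexp (x, y)))).
Proof.
intros Hb. assert (HP := PI_RGT_0).
set (val := fun z (v : E) => exists theta delta rho f,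
   extension c b theta delta rho f /\ sector_disc theta delta rho z /\ v = f z).
set (G := fun z => epsilon (inhabits (@zero E)) (val z)).
assert (HG : forall theta delta rho f z, extension c b theta delta rho f ->
   sector_disc theta delta rho z -> G z = f z).
{ intros theta delta rho f z Hext Hz.
  assert (Hv : val z (G z)).
  { apply epsilon_spec. exists (f z), theta, delta, rho, f. auto. }
  destruct Hv as [theta' [delta' [rho' [f' [Hext' [Hz' ->]]]]]].
  eapply extension_unique; eauto. }
assert (HGd : forall theta delta rho f z, extension c b theta delta rho f ->
   sector_disc theta delta rho z -> ex_derive (K := C_AbsRing) G z).
{ intros theta delta rho f z Hext Hz.
  destruct (sector_disc_open _ _ _ _ Hz) as [k [Hk Ho]].
  apply (ex_derive_ext_near f G z k Hk).
  - intros w Hw. symmetry. eapply HG; eauto.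
  - now apply Hext. }
assert (Hdir : forall y, 0 < y < 2 * PI -> forall k : Z, y <> IZR k * (2 * PI)).
{ intros y Hy k Heq. rewrite Heq in Hy.
  assert (0 < IZR k < 1) as [K1 K2] by (split; apply Rmult_lt_reg_r with (2 * PI); lra).
  apply lt_IZR in K1. apply lt_IZR in K2. lia. }
(* Any admissible direction would do here: only its disc is used. *)
destruct (Hb PI (Hdir PI ltac:(lra))) as [delta0 [rho0 [f0 Hext0]]].
assert (Hrho0 : 0 < rho0) by apply Hext0.
exists G, rho0. split; [trivial|]. split; [|split; [|split]].
- intros z Hz. eapply HGd; [exact Hext0|]. now right.
- intros z Hz. replace (G z) with (f0 z); [now apply Hext0|].
  symmetry. eapply HG; [exact Hext0|]. now right.
- intros x y Hy. destruct (Hb y (Hdir y Hy)) as [delta [rho [f Hext]]].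
  eapply HGd; [exact Hext|]. left. apply in_sector_Cexp. exists x, y. split; trivial.
  unfold Rminus. rewrite Rplus_opp_r, Rabs_R0. destruct Hext as [Hd _]. lra.
- intros eps Heps.
  apply (interval_covering (fun u v => exists K beta, 0 < K /\ 0 <= beta /\
     forall x y, u <= y <= v -> norm (G (Cexp (x, y))) <= qbound c K beta (logn (Cexp (x, y))))
     eps (2 * PI - eps)); [| |lra].
  + intros u v w Huv Hvw [K1 [b1 [HK1 [Hb1 H1]]]] [K2 [b2 [HK2 [Hb2 H2]]]].
    exists (Rmax K1 K2), (Rmax b1 b2).
    assert (A1 := Rmax_l K1 K2). assert (A2 := Rmax_r K1 K2).
    assert (A3 := Rmax_l b1 b2). assert (A4 := Rmax_r b1 b2).
    split; [lra|]. split; [lra|]. intros x y Hy.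
    destruct (Rle_lt_dec y v).
    * eapply Rle_trans; [apply H1; lra|]. apply qbound_mono; trivial; [apply logn_pos|lra].
    * eapply Rle_trans; [apply H2; lra|]. apply qbound_mono; trivial; [apply logn_pos|lra].
  + intros t Ht. destruct (Hb t (Hdir t ltac:(lra))) as [delta [rho [f Hext]]].
    assert (Hd : 0 < delta) by apply Hext.
    assert (Hext' := Hext). destruct Hext' as [_ [_ [_ [_ [K [beta [HK [Hbeta Hbd]]]]]]]].
    exists (delta / 2). split; [lra|]. intros u v H1 H2 H3 H4. exists K, beta.
    split; trivial. split; trivial. intros x y Hy.
    assert (Hin : in_sector t delta (Cexp (x, y))).
    { apply in_sector_Cexp. exists x, y. split; trivial. apply Rabs_def1; lra. }
    rewrite (HG _ _ _ _ _ Hext (or_introl Hin)). now apply Hbd.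
Qed.
End Extensions.

(** * Hadamard products *)

Section CircleMeans.
Context {E : CompleteNormedModule C_AbsRing}.

Lemma lcomb_minus_l (a b : nat -> E) (c : nat -> C) N :
  lcomb (fun n => minus (a n) (b n)) c N = minus (lcomb a c N) (lcomb b c N).
Proof.
induction N as [|N IH]; simpl; norm_struct E; [vring|]. rewrite IH. norm_struct E. vring.
Qed.

(** The differences of the two coefficient sequences expand the zero function with geometric
    remainders, so they lie in the subspace [{0}]. *)
Lemma cauchy_coef_pseries (a : nat -> E) (F : C -> E) (x rho : R) : 2 * exp x < rho ->
  (forall w, in_disc rho w -> ex_derive (K := C_AbsRing) F w) ->
  (forall w, in_disc rho w -> is_pseries (K := C_AbsRing) a w (F w)) ->
  forall n, cauchy_coef F 0%C x n = a n.
Proof.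
intros Hx HF Hs n. assert (He := exp_pos x).
assert (HF0 : forall w : C, Cmod (w - 0)%C < rho -> ex_derive (K := C_AbsRing) F w).
{ intros w Hw. apply HF. unfold in_disc. now replace w with (w - 0)%C by ring. }
destruct (circle_bounded F 0%C (exp x) rho) as [M [HM0 HM]]; [lra|trivial|].
assert (HT := taylor_cauchy_coef F 0%C (exp x) rho M ltac:(lra) HF0 HM). rewrite ln_exp in HT.
destruct (pseries_tail a F (exp x) rho ltac:(lra) Hs) as [M' [HM0' HT']].
apply minus_zero_eq.
apply (coefficients_in_subspace (fun v : E => v = zero) (fun _ => zero) 0%C
  (fun n => minus (cauchy_coef F 0%C x n) (a n)) (2 * M + 2 * M') (exp x) (exp x / 2)
  zero_closed_subspace); try lra.
- intros N h Hh. rewrite lcomb_minus_l.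
  specialize (HT N h Hh). specialize (HT' N h Hh). replace (0 + h)%C with h in HT by ring.
  set (A := lcomb (cauchy_coef F 0%C x) _ N) in *. set (B := lcomb a _ N) in *.
  assert (Hm : forall u v w : E, minus zero (minus u v) = minus (minus w u) (minus w v))
    by (intros; vring).
  refine (Rle_trans _ _ _ (Req_le _ _ (f_equal (fun v : E => norm v) (Hm A B (F h)))) _).
  eapply Rle_trans; [apply norm_minus_le|]. norm_struct E. lra.
- reflexivity.
Qed.

(** With [G] replaced by a partial sum of its series, the mean is a sum of [b n * z ^ n] times
    Cauchy coefficients of [F], which are the [a n]. The replacement is uniform on the circle:
    [|z / w| < rhoG / 8] is a quarter of the radius [rhoG / 2] used for the tail. *)
Lemma circle_mean_hadamard (a : nat -> E) (b : nat -> C) (F : C -> E) (G : C -> C)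
    (x rho rhoG : R) (z : C) : 2 * exp x < rho -> 0 < rhoG ->
  (forall w, in_disc rho w -> ex_derive (K := C_AbsRing) F w) ->
  (forall w, in_disc rho w -> is_pseries (K := C_AbsRing) a w (F w)) ->
  (forall w, in_disc rhoG w -> ex_derive (K := C_AbsRing) (V := C_NormedModule) G w) ->
  (forall w, in_disc rhoG w -> is_pseries (K := C_AbsRing) (V := C_NormedModule) b w (G w)) ->
  Cmod z < exp x * (rhoG / 8) ->
  is_pseries (K := C_AbsRing) (fun n => scal (b n) (a n)) z
    (scal (RtoC (/ (2 * PI)))
      (CInt (fun y => scal (G (z * Cexp (- (x, y)))%C) (F (Cexp (x, y)))) 0 (2 * PI))).
Proof.
intros Hx HrG HF Hsa HG Hsb Hz. assert (HP := PI_RGT_0). assert (He := exp_pos x).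
assert (Hcoef := cauchy_coef_pseries a F x rho Hx HF Hsa).
destruct (pseries_tail (E := C_CompleteNormedModule) b G (rhoG / 2) rhoG ltac:(lra) Hsb)
  as [MG [HMG HTG]].
assert (HFd : forall y, ex_derive (K := C_AbsRing) (fun t => F (Cexp t)) (x, y)).
{ intros y. apply (ex_derive_comp_C F Cexp); [|eexists; apply is_derive_Cexp].
  apply HF. unfold in_disc. rewrite Cmod_Cexp. simpl. lra. }
assert (Hmod : forall y, Cmod (z * Cexp (- (x, y)))%C < rhoG / 8).
{ intros y. rewrite Cexp_opp, Cmod_mult, Cmod_inv, Cmod_Cexp by apply Cexp_neq_0. simpl.
  apply Rmult_lt_reg_r with (exp x); trivial. rewrite Rmult_assoc, Rinv_l; lra. }
assert (Hinv : forall y, ex_derive (K := C_AbsRing) (V := C_NormedModule)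
   (fun t => z * Cexp (- t))%C (x, y)).
{ intros y. apply (ex_derive_ext (V := C_NormedModule) (fun t => z * / Cexp t)%C).
  - intros t. now rewrite Cexp_opp.
  - apply ex_derive_mult_C; [apply (@ex_derive_const_C C_CompleteNormedModule)|].
    apply (ex_derive_comp_C (E := C_CompleteNormedModule) (fun w => / w)%C Cexp).
    + apply ex_derive_inv_C, Cexp_neq_0.
    + eexists. apply is_derive_Cexp. }
assert (HGF : Cex (fun y => scal (G (z * Cexp (- (x, y)))%C) (F (Cexp (x, y)))) 0 (2 * PI)).
{ apply (Cex_vline (fun t => scal (G (z * Cexp (- t))%C) (F (Cexp t)))); [lra|]. intros y _.
  apply ex_derive_scal_C; trivial.
  apply (ex_derive_comp_C (E := C_CompleteNormedModule) G (fun t => z * Cexp (- t))%C); trivial.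
  apply HG. unfold in_disc. specialize (Hmod y). lra. }
assert (HSF : forall N, Cex (fun y =>
    scal (lcomb b (fun n => (z * Cexp (- (x, y))) ^ n)%C N : C) (F (Cexp (x, y)))) 0 (2 * PI)).
{ intros N. apply (Cex_vline (fun t => scal (lcomb b (fun n => (z * Cexp (- t)) ^ n)%C N : C)
     (F (Cexp t)))); [lra|]. intros y _. apply ex_derive_scal_C; trivial.
  induction N as [|N IH]; simpl.
  - apply (@ex_derive_const_C C_CompleteNormedModule).
  - apply (@ex_derive_plus C_AbsRing C_NormedModule); trivial.
    apply ex_derive_mult_C; [|apply (@ex_derive_const_C C_CompleteNormedModule)].
    apply (ex_derive_comp_C (E := C_CompleteNormedModule) (fun w => w ^ N)%C
      (fun t => z * Cexp (- t))%C); trivial. apply ex_derive_pow_C. }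
assert (HS : forall N, lcomb (fun n => scal (b n) (a n)) (fun n => z ^ n)%C N =
   scal (RtoC (/ (2 * PI))) (CInt (fun y =>
    scal (lcomb b (fun n => (z * Cexp (- (x, y))) ^ n)%C N : C) (F (Cexp (x, y)))) 0 (2 * PI))).
{ induction N as [|N IH].
  - simpl. rewrite (CInt_ext _ (fun _ => zero)).
    + rewrite CInt_const. norm_struct E. vring.
    + intros y _. exact (@scal_zero_l C_AbsRing E _).
  - simpl lcomb at 1. rewrite IH. rewrite <- (Hcoef N). unfold cauchy_coef.
    set (A := (fun y => scal (/ Cexp (x, y) ^ N)%C (F (0 + Cexp (x, y))%C)) : R -> E).
    set (B := (fun y => scal (lcomb b (fun n => (z * Cexp (- (x, y))) ^ n)%C N : C) (F (Cexp (x, y))))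
       : R -> E).
    assert (HA : Cex A 0 (2 * PI)).
    { apply (Cex_vline (fun t => scal (/ Cexp t ^ N)%C (F (0 + Cexp t)%C))); [lra|]. intros y _.
      apply ex_derive_scal_C.
      - apply (ex_derive_comp_C (E := C_CompleteNormedModule) (fun w => / (w ^ N))%C Cexp).
        2:{ eexists. apply is_derive_Cexp. }
        apply (ex_derive_comp_C (E := C_CompleteNormedModule) (fun w => / w)%C (fun w => w ^ N)%C).
        + apply ex_derive_inv_C, Cpow_nz, Cexp_neq_0.
        + apply ex_derive_pow_C.
      - apply ex_derive_exp_shift. apply HF. replace (0 + Cexp (x, y))%C with (Cexp (x, y)) by ring.
        unfold in_disc. rewrite Cmod_Cexp. simpl. lra. }
    rewrite (CInt_ext (fun y => scal (lcomb b (fun n => (z * Cexp (- (x, y))) ^ n)%C (S N) : C)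
       (F (Cexp (x, y)))) (fun y => plus (B y) (scal (b N * z ^ N)%C (A y) : E))).
    2:{ intros y _. unfold A, B.
        change (lcomb b (fun n : nat => ((z * Cexp (- (x, y))) ^ n)%C) (S N) : C)
         with (lcomb b (fun n : nat => ((z * Cexp (- (x, y))) ^ n)%C) N + (z * Cexp (- (x, y))) ^ N * b N)%C.
        replace (0 + Cexp (x, y))%C with (Cexp (x, y)) by ring.
        rewrite Cpow_mult_l, Cexp_opp, Cpow_inv by apply Cexp_neq_0.
        set (L := lcomb b _ N : C). vring. }
    rewrite (CInt_plus B (fun y => scal (b N * z ^ N)%C (A y)) 0 (2 * PI) (HSF N)
      (Cex_scal _ A _ _ HA)).
    rewrite (CInt_scal (b N * z ^ N)%C A 0 (2 * PI) HA). fold B.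
    set (IA := CInt A 0 (2 * PI)). set (IB := CInt B 0 (2 * PI)). norm_struct E. vring. }
destruct (Cex_bounded (fun y => F (Cexp (x, y))) 0 (2 * PI)) as [MF HMF]; [lra| |].
{ apply (Cex_vline (fun t => F (Cexp t))); [lra|]. intros; apply HFd. }
assert (HMF0 : 0 <= MF) by (eapply Rle_trans; [exact (norm_pos (F (Cexp (x, 0))))|apply HMF; lra]).
apply is_pseries_lcomb. intros eps Heps.
set (A := 2 * MG * MF + 1).
assert (HA : 0 < A) by (unfold A; nra).
destruct (pow_lt_1_zero (/ 4)) with (y := eps / A) as [N0 HN0].
{ rewrite Rabs_right; lra. }
{ now apply Rdiv_lt_0_compat. }
exists N0. intros N HN. specialize (HN0 N HN). rewrite Rabs_right in HN0 by (apply Rle_ge, pow_le; lra).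
rewrite HS.
set (I1 := CInt (fun y => scal (G (z * Cexp (- (x, y)))%C) (F (Cexp (x, y)))) 0 (2 * PI)).
set (I2 := CInt _ 0 (2 * PI)).
change (norm (minus (scal (RtoC (/ (2 * PI))) I2 : E) (scal (RtoC (/ (2 * PI))) I1)) < eps).
assert (Hm : forall u v : E, minus (scal (RtoC (/ (2 * PI))) v) (scal (RtoC (/ (2 * PI))) u)
   = scal (- RtoC (/ (2 * PI)))%C (minus u v)) by (intros; vring).
refine (Rle_lt_trans _ _ _ (Req_le _ _ (f_equal (fun v : E => norm v) (Hm I1 I2))) _).
cbv beta.
assert (HI : norm (minus I1 I2) <= 2 * MG * MF * (/ 4) ^ N * (2 * PI)).
{ unfold I1, I2. rewrite <- CInt_minus by trivial.
  replace (2 * MG * MF * (/ 4) ^ N * (2 * PI)) with ((2 * PI - 0) * (2 * MG * MF * (/ 4) ^ N)) by ring.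
  apply CInt_norm_le; [lra|now apply Cex_minus|]. intros y Hy.
  set (u := (z * Cexp (- (x, y)))%C) in *.
  assert (Hu : Cmod u <= rhoG / 2 / 2) by (specialize (Hmod y); fold u in Hmod; lra).
  specialize (HTG N u Hu).
  set (L := lcomb b (fun n => (u ^ n)%C) N : C) in *.
  assert (Hml : forall (c d : C) (v : E), minus (scal c v) (scal d v) = scal (c - d)%C v)
    by (intros; vring).
  refine (Rle_trans _ _ _ (Req_le _ _ (f_equal (fun v : E => norm v) (Hml (G u) L _))) _).
  eapply Rle_trans; [apply norm_scal_le|].
  change (Cmod (G u - L)%C <= 2 * MG * (Cmod u / (rhoG / 2)) ^ N) in HTG.
  assert (Hp : (Cmod u / (rhoG / 2)) ^ N <= (/ 4) ^ N).
  { apply pow_incr. split; [apply Rdiv_le_0_compat; [apply Cmod_ge_0|lra]|].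
    apply Rmult_le_reg_r with (rhoG / 2); [lra|]. unfold Rdiv at 1.
    rewrite Rmult_assoc, Rinv_l by lra. specialize (Hmod y). fold u in Hmod. lra. }
  replace (2 * MG * MF * (/ 4) ^ N) with (2 * MG * (/ 4) ^ N * MF) by ring.
  apply Rmult_le_compat; [apply Cmod_ge_0|apply norm_pos| |now apply HMF].
  eapply Rle_trans; [exact HTG|]. apply Rmult_le_compat_l; lra. }
rewrite norm_scal_eq, Cmod_opp, Cmod_R, Rabs_right.
2:{ apply Rle_ge. left. apply Rinv_0_lt_compat; lra. }
apply Rmult_lt_compat_l with (r := A) in HN0; trivial.
replace (A * (eps / A)) with eps in HN0 by (field; lra).
assert (H4 : 0 < (/ 4) ^ N) by (apply pow_lt; lra).
apply Rle_lt_trans with (2 * MG * MF * (/ 4) ^ N); [|unfold A in *; lra].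
apply Rmult_le_compat_l with (r := / (2 * PI)) in HI; [|left; apply Rinv_0_lt_compat; lra].
eapply Rle_trans; [exact HI|]. apply Req_le. field. lra.
Qed.
End CircleMeans.

(** The order [c] is kept because [x ^ 2 + y ^ 2 <= (x + y) ^ 2] for nonnegative [x] and [y];
    expanding [(L + B) ^ 2] gives the new constants. *)
Lemma qbound_mul c K1 b1 x K2 b2 y L B : 0 <= c -> 0 <= K1 -> 0 <= K2 -> 0 <= b1 -> 0 <= b2 ->
  0 <= x -> 0 <= y -> 0 <= B -> x + y <= L + B ->
  qbound c K1 b1 x * qbound c K2 b2 y <=
  qbound c (K1 * K2 * exp (c * B ^ 2 + (b1 + b2) * B)) (2 * c * B + b1 + b2) L.
Proof.
intros Hc HK1 HK2 Hb1 Hb2 Hx Hy HB Hs. unfold qbound.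
replace (K1 * exp (c * x ^ 2 + b1 * x) * (K2 * exp (c * y ^ 2 + b2 * y)))
  with (K1 * K2 * exp (c * (x ^ 2 + y ^ 2) + b1 * x + b2 * y)).
2:{ replace (c * (x ^ 2 + y ^ 2) + b1 * x + b2 * y)
      with ((c * x ^ 2 + b1 * x) + (c * y ^ 2 + b2 * y)) by ring. rewrite exp_plus. ring. }
rewrite (Rmult_assoc (K1 * K2)), <- exp_plus. apply Rmult_le_compat_l; [nra|].
apply exp_le.
assert (x ^ 2 + y ^ 2 <= (L + B) ^ 2) by nra.
assert (c * (x ^ 2 + y ^ 2) <= c * (L + B) ^ 2) by (apply Rmult_le_compat_l; trivial).
assert (b1 * x <= b1 * (L + B)) by nra. assert (b2 * y <= b2 * (L + B)) by nra.
replace (c * B ^ 2 + (b1 + b2) * B + (c * L ^ 2 + (2 * c * B + b1 + b2) * L))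
  with (c * (L + B) ^ 2 + b1 * (L + B) + b2 * (L + B)) by ring. lra.
Qed.

(** With [|w| = exp x], [(1 + |w|) (1 + |z / w|) = 1 + |w| + |z / w| + |z|], where
    [|w| <= exp X1 * (1 + |z|)] and [|z / w| <= exp (- x0) * |z|]. *)
Lemma logn_product_le (X1 x0 x y : R) (z : C) : x0 <= x <= X1 + logn z ->
  logn (Cexp (x, y)) + logn (z * Cexp (- (x, y)))%C <= logn z + ln (1 + exp X1 + exp (- x0)).
Proof.
intros Hx. unfold logn in *. assert (Hm := Cmod_ge_0 z).
rewrite Cexp_opp, Cmod_mult, Cmod_inv, Cmod_Cexp by apply Cexp_neq_0. simpl.
assert (Hex := exp_pos x). assert (He1 := exp_pos X1). assert (He0 := exp_pos (- x0)).
rewrite <- exp_Ropp. assert (Hex' := exp_pos (- x)).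
assert (Hzx : 0 <= Cmod z * exp (- x)) by nra.
rewrite <- !ln_mult by lra. apply ln_le; [apply Rmult_lt_0_compat; lra|].
assert (H1 : exp x <= exp X1 * (1 + Cmod z)).
{ rewrite <- (exp_ln (1 + Cmod z)) by lra. rewrite <- exp_plus. apply exp_le. lra. }
assert (H2 : exp (- x) <= exp (- x0)) by (apply exp_le; lra).
assert (H3 : exp x * exp (- x) = 1) by (rewrite <- exp_plus, Rplus_opp_r; apply exp_0).
replace ((1 + exp x) * (1 + Cmod z * exp (- x)))
  with (1 + exp x + Cmod z * exp (- x) + Cmod z * (exp x * exp (- x))) by ring.
rewrite H3. nra.
Qed.

(** * The deformed contour of the Hadamard integral *)

Section Hadamard.
Context {E : CompleteNormedModule C_AbsRing}.
Context (F : C -> E) (G : C -> C).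

Definition kernel (z t : C) : E := scal (G (z * Cexp (- t))%C) (F (Cexp t)).

(* The contour consists of the arc [d+e, d+2pi-e] of the circle of radius [exp x0],
   completed inside the sector by two rays and an arc of radius [exp X]; all in the
   coordinate [t] with [w = Cexp t], where [dw / w] becomes [dt]. *)
Definition contour (d e x0 X : R) (z : C) : E :=
  plus (CInt (fun y => kernel z (x0, y)) (d + e) (d - e + 2 * PI))
   (minus (CInt (fun y => kernel z (X, y)) (d - e) (d + e))
     (scal Ci (minus (CInt (fun x => kernel z (x, d - e)) x0 X)
                     (CInt (fun x => kernel z (x, d + e)) x0 X)))).

Lemma ex_derive_kernel_t (z t : C) :
  ex_derive (K := C_AbsRing) F (Cexp t) ->
  ex_derive (K := C_AbsRing) (V := C_NormedModule) G (z * Cexp (- t))%C ->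
  ex_derive (K := C_AbsRing) (kernel z) t.
Proof.
intros HF HG. apply ex_derive_scal_C.
- apply (ex_derive_comp_C (E := C_CompleteNormedModule) G (fun t => z * Cexp (- t))%C); trivial.
  apply (ex_derive_ext (V := C_NormedModule) (fun t => z * / Cexp t)%C).
  + intros u. now rewrite Cexp_opp.
  + apply ex_derive_mult_C; [apply (@ex_derive_const_C C_CompleteNormedModule)|].
    apply (ex_derive_comp_C (E := C_CompleteNormedModule) (fun w => / w)%C Cexp).
    * apply ex_derive_inv_C, Cexp_neq_0.
    * eexists. apply is_derive_Cexp.
- apply (ex_derive_comp_C F Cexp); trivial. eexists. apply is_derive_Cexp.
Qed.

Lemma ex_derive_kernel_z (z t : C) :
  ex_derive (K := C_AbsRing) (V := C_NormedModule) G (z * Cexp (- t))%C ->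
  ex_derive (K := C_AbsRing) (fun z => kernel z t) z.
Proof.
intros HG. apply ex_derive_scal_C; [|apply ex_derive_const_C].
apply (ex_derive_comp_C (E := C_CompleteNormedModule) G (fun z => z * Cexp (- t))%C); trivial.
apply ex_derive_mult_C; [apply ex_derive_id_C|apply (@ex_derive_const_C C_CompleteNormedModule)].
Qed.

Lemma norm_kernel_le z t A B : Cmod (G (z * Cexp (- t))%C) <= A -> norm (F (Cexp t)) <= B ->
  norm (kernel z t) <= A * B.
Proof.
intros HA HB. eapply Rle_trans; [apply norm_scal_le|].
apply Rmult_le_compat; trivial; [apply Cmod_ge_0|apply norm_pos].
Qed.

(** Measured by [|dt|], the two arcs have total length [2 * PI] and the two rays [2 * (X - x0)]. *)
Lemma norm_contour_le d e x0 X z M : 0 < e < PI -> x0 <= X -> 0 <= M ->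
  Cex (fun y => kernel z (x0, y)) (d + e) (d - e + 2 * PI) ->
  Cex (fun y => kernel z (X, y)) (d - e) (d + e) ->
  Cex (fun x => kernel z (x, d - e)) x0 X -> Cex (fun x => kernel z (x, d + e)) x0 X ->
  (forall y, d + e <= y <= d - e + 2 * PI -> norm (kernel z (x0, y)) <= M) ->
  (forall y, d - e <= y <= d + e -> norm (kernel z (X, y)) <= M) ->
  (forall x, x0 <= x <= X -> norm (kernel z (x, d - e)) <= M /\ norm (kernel z (x, d + e)) <= M) ->
  norm (contour d e x0 X z) <= 2 * (PI + (X - x0)) * M.
Proof.
intros He HX HM C1 C2 C3 C4 B1 B2 B3. unfold contour.
assert (L1 : d + e <= d - e + 2 * PI) by lra. assert (L2 : d - e <= d + e) by lra.
assert (N1 := CInt_norm_le _ _ _ M L1 C1 B1).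
assert (N2 := CInt_norm_le _ _ _ M L2 C2 B2).
assert (N3 := CInt_norm_le _ _ _ M HX C3 (fun x Hx => proj1 (B3 x Hx))).
assert (N4 := CInt_norm_le _ _ _ M HX C4 (fun x Hx => proj2 (B3 x Hx))).
eapply Rle_trans; [apply norm_plus_le|].
eapply Rle_trans; [apply Rplus_le_compat_l, norm_minus_le|].
rewrite norm_scal_eq, Cmod_Ci, Rmult_1_l.
eapply Rle_trans; [apply Rplus_le_compat_l, Rplus_le_compat_l, norm_minus_le|]. norm_struct E. lra.
Qed.

(** Up to a unit factor the two contours differ by the boundary of a rectangle. The integrals are
    normalised by [dt / i], which is [dy] on arcs and [- i dx] on rays. *)
Lemma contour_indep d e x0 X X' z : 0 < e -> x0 <= X <= X' ->
  Cex (fun x => kernel z (x, d - e)) x0 X -> Cex (fun x => kernel z (x, d + e)) x0 X ->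
  (forall x y, X <= x <= X' -> d - e <= y <= d + e ->
     ex_derive (K := C_AbsRing) (kernel z) (x, y)) ->
  contour d e x0 X z = contour d e x0 X' z.
Proof.
intros He HX C1 C2 Hd. unfold contour.
assert (Hg := goursat (kernel z) X X' (d - e) (d + e) ltac:(lra) ltac:(lra) Hd).
unfold oint in Hg.
assert (C3 : Cex (fun x => kernel z (x, d - e)) X X') by
  (apply (Cex_hline (kernel z)); [lra|intros; apply Hd; lra]).
assert (C4 : Cex (fun x => kernel z (x, d + e)) X X') by
  (apply (Cex_hline (kernel z)); [lra|intros; apply Hd; lra]).
rewrite <- (CInt_Chasles _ x0 X X' C1 C3), <- (CInt_Chasles _ x0 X X' C2 C4).
set (A := CInt (fun y => kernel z (x0, y)) _ _) in *.
set (V := CInt (fun y => kernel z (X, y)) _ _) in *.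
set (V' := CInt (fun y => kernel z (X', y)) _ _) in *.
set (H1 := CInt (fun x => kernel z (x, d - e)) x0 X) in *.
set (H2 := CInt (fun x => kernel z (x, d + e)) x0 X) in *.
set (H1' := CInt (fun x => kernel z (x, d - e)) X X') in *.
set (H2' := CInt (fun x => kernel z (x, d + e)) X X') in *.
apply minus_zero_eq.
assert (Hi : (Ci * Ci = - (1))%C) by (unfold Ci, Cmult, Copp, RtoC; simpl; f_equal; ring).
refine (eq_trans (_ : _ = scal Ci (minus (plus H1' (scal Ci V')) (plus H2' (scal Ci V)))) _).
- vcoefs; simpl; ring [Hi].
- rewrite Hg. vring.
Qed.

Lemma ex_derive_piece (t : R -> C) a b (z : C) rho A B : a <= b -> 0 < rho ->
  (forall w s, Cmod (w - z)%C < rho -> a <= s <= b ->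
     ex_derive (K := C_AbsRing) (V := C_NormedModule) G (w * Cexp (- t s))%C /\
     Cmod (G (w * Cexp (- t s))%C) <= A) ->
  (forall s, a <= s <= b -> norm (F (Cexp (t s))) <= B) ->
  (forall w, Cmod (w - z)%C < rho -> Cex (fun s => kernel w (t s)) a b) ->
  ex_derive (K := C_AbsRing) (fun w => CInt (fun s => kernel w (t s)) a b) z.
Proof.
intros Hab Hrho HG HF HC.
apply (ex_derive_CInt_param (fun w s => kernel w (t s)) a b z rho (A * B)); trivial.
intros w s Hw Hs. split.
- apply ex_derive_kernel_z. now apply HG.
- apply norm_kernel_le; [now apply HG|now apply HF].
Qed.

Lemma ex_derive_contour d e x0 X (z : C) rho A : 0 < e < PI -> x0 <= X -> 0 < rho ->
  (forall y, ex_derive (K := C_AbsRing) F (Cexp (x0, y))) ->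
  (forall x y, d - e <= y <= d + e -> ex_derive (K := C_AbsRing) F (Cexp (x, y))) ->
  (forall w x y, Cmod (w - z)%C < rho -> x0 <= x <= X -> d + e <= y <= d - e + 2 * PI ->
     ex_derive (K := C_AbsRing) (V := C_NormedModule) G (w * Cexp (- (x, y)))%C /\
     Cmod (G (w * Cexp (- (x, y)))%C) <= A) ->
  (forall w y, Cmod (w - z)%C < rho -> d - e <= y <= d + e ->
     ex_derive (K := C_AbsRing) (V := C_NormedModule) G (w * Cexp (- (X, y)))%C /\
     Cmod (G (w * Cexp (- (X, y)))%C) <= A) ->
  ex_derive (K := C_AbsRing) (contour d e x0 X) z.
Proof.
intros He HX Hrho HF0 HF HG HGX.
(* The ray of angle [d - e] is seen at [d - e + 2 * PI], the upper end of the range of angles in the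
   hypothesis on [G]. *)
assert (HG' : forall w x, Cmod (w - z)%C < rho -> x0 <= x <= X ->
     ex_derive (K := C_AbsRing) (V := C_NormedModule) G (w * Cexp (- (x, (d - e)%R)))%C /\
     Cmod (G (w * Cexp (- (x, (d - e)%R)))%C) <= A).
{ intros w x Hw Hx. rewrite Cexp_opp, <- Cexp_period, <- Cexp_opp. apply HG; trivial; lra. }
assert (HFe : forall t, ex_derive (K := C_AbsRing) F (Cexp t) ->
  ex_derive (K := C_AbsRing) (fun t => F (Cexp t)) t).
{ intros t Ht. apply (ex_derive_comp_C F Cexp); trivial. eexists. apply is_derive_Cexp. }
destruct (Cex_bounded (fun y => F (Cexp (x0, y))) (d + e) (d - e + 2 * PI)) as [B1 HB1]; [lra| |].
{ apply (Cex_vline (fun t => F (Cexp t))); [lra|]. intros; apply HFe, HF0. }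
destruct (Cex_bounded (fun y => F (Cexp (X, y))) (d - e) (d + e)) as [B2 HB2]; [lra| |].
{ apply (Cex_vline (fun t => F (Cexp t))); [lra|]. intros; apply HFe, HF; lra. }
destruct (Cex_bounded (fun x => F (Cexp (x, d - e))) x0 X) as [B3 HB3]; [lra| |].
{ apply (Cex_hline (fun t => F (Cexp t))); [lra|]. intros; apply HFe, HF; lra. }
destruct (Cex_bounded (fun x => F (Cexp (x, d + e))) x0 X) as [B4 HB4]; [lra| |].
{ apply (Cex_hline (fun t => F (Cexp t))); [lra|]. intros; apply HFe, HF; lra. }
apply (@ex_derive_plus C_AbsRing E); [|apply ex_derive_minus_C;
  [|apply ex_derive_scal_C; [apply (@ex_derive_const_C C_CompleteNormedModule)|apply ex_derive_minus_C]]].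
- apply (ex_derive_piece (fun y => (x0, y)) _ _ z rho A B1); trivial; [lra| |].
  + intros w y Hw Hy. apply HG; trivial; lra.
  + intros w Hw. apply (Cex_vline (kernel w)); [lra|]. intros y Hy.
    apply ex_derive_kernel_t; [apply HF0|]. apply HG; trivial; lra.
- apply (ex_derive_piece (fun y => (X, y)) _ _ z rho A B2); trivial; [lra|].
  intros w Hw. apply (Cex_vline (kernel w)); [lra|]. intros y Hy.
  apply ex_derive_kernel_t; [apply HF; lra|]. apply HGX; trivial; lra.
- apply (ex_derive_piece (fun x => (x, d - e)) _ _ z rho A B3); trivial.
  intros w Hw. apply (Cex_hline (kernel w)); [lra|]. intros x Hx.
  apply ex_derive_kernel_t; [apply HF; lra|]. now apply HG'.
- apply (ex_derive_piece (fun x => (x, d + e)) _ _ z rho A B4); trivial.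
  + intros w x Hw Hx. apply HG; trivial; lra.
  + intros w Hw. apply (Cex_hline (kernel w)); [lra|]. intros x Hx.
    apply ex_derive_kernel_t; [apply HF; lra|]. apply HG; trivial; lra.
Qed.
End Hadamard.

Lemma qbound_ge c K beta L : 0 <= c -> 0 <= K -> 0 <= beta -> 0 <= L -> K <= qbound c K beta L.
Proof.
intros Hc HK Hb HL. unfold qbound. rewrite <- (Rmult_1_r K) at 1.
apply Rmult_le_compat_l; trivial. rewrite <- exp_0. apply exp_le.
assert (0 <= L ^ 2) by nra. nra.
Qed.

Lemma qbound_mono_L c K beta L L' : 0 <= c -> 0 <= K -> 0 <= beta -> 0 <= L <= L' ->
  qbound c K beta L <= qbound c K beta L'.
Proof.
intros Hc HK Hb HL. unfold qbound. apply Rmult_le_compat_l; trivial. apply exp_le.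
assert (L ^ 2 <= L' ^ 2) by nra. nra.
Qed.

Lemma Cmod_mult_Cexp_opp z x y : Cmod (z * Cexp (- (x, y)))%C = Cmod z * exp (- x).
Proof. now rewrite Cmod_mult, Cmod_Cexp. Qed.

(** * Extension of Hadamard products with the same order of growth *)

Section HadamardExtension.
Context {E : CompleteNormedModule C_AbsRing}.

Theorem hadamard_extension (c d : R) (a : nat -> E) (b : nat -> C) : 0 <= c ->
  (exists delta rho F, extension c a d delta rho F) ->
  (forall theta, (forall k : Z, theta <> IZR k * (2 * PI)) ->
     exists delta rho f, extension (E := C_CompleteNormedModule) c b theta delta rho f) ->
  exists delta rho H, extension c (fun p => scal (b p) (a p)) d delta rho H.
Proof.
intros Hc [delta [rhoF [F [Hdelta [HrF [HF [HFs [KF1 [bF [HKF1 [HbF HFg]]]]]]]]]]] Hb.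
assert (HP := PI2_1). assert (HP0 := PI_RGT_0).
destruct (glue_extensions c b Hb) as [G [rG [HrG [HGd [HGs [HGray HGb]]]]]].
change (C -> C) in (type of G).
(* The rays at [d - e] and [d + e] lie in the sector of [F]. The product is built for [z] within
   [e / 2] of [d], so on the rays and the inner arc [z / w] has an angle in
   [[e / 2, 2 * PI - e / 2]]. *)
set (e := Rmin (delta / 4) 1).
assert (He : 0 < e) by (apply Rmin_pos; lra).
assert (He1 : e <= delta / 4) by apply Rmin_l. assert (He2 : e <= 1) by apply Rmin_r.
clearbody e.
destruct (HGb (e / 2)) as [KG1 [bG [HKG1 [HbG HGg]]]]; [lra|].
destruct (pseries_tail (E := C_CompleteNormedModule) b G (rG / 2) rG ltac:(lra) HGs)
  as [MG [HMG HTG]].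
assert (HGsmall : forall u, Cmod u <= rG / 4 -> Cmod (G u) <= 2 * MG).
{ intros u Hu. specialize (HTG O u ltac:(lra)). simpl in HTG. rewrite Rmult_1_r in HTG.
  change (Cmod (G u - 0)%C <= 2 * MG) in HTG. now replace (G u - 0)%C with (G u) in HTG by ring. }
clear HTG.
(* One constant for [G] both in the sector and near 0. *)
set (KG := Rmax KG1 (2 * MG)).
assert (HKG : 0 < KG) by (eapply Rlt_le_trans; [exact HKG1|apply Rmax_l]).
assert (HKGl : KG1 <= KG) by apply Rmax_l. assert (HKGr : 2 * MG <= KG) by apply Rmax_r.
clearbody KG.
(* The inner circle has radius [rhoF / 4], so that [2 * exp x0 < rhoF] as [circle_mean_hadamard]
   requires. *)
set (x0 := ln (rhoF / 4)).
assert (Hx0 : exp x0 = rhoF / 4) by (apply exp_ln; lra).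
clearbody x0.
(* The outer radius will be [exp X1 * (1 + |z|)]; then [|z / w| <= exp (- X1) <= rG / 8] on the
   outer arc, where the angle of [z / w] is uncontrolled but the disc of [G] suffices. *)
set (X1 := Rmax x0 (- ln (rG / 8))).
assert (HX1 : x0 <= X1) by apply Rmax_l.
assert (HX1' : exp (- X1) <= rG / 8).
{ rewrite <- (exp_ln (rG / 8)) by lra. apply exp_le.
  assert (- ln (rG / 8) <= X1) by apply Rmax_r. lra. }
clearbody X1.
set (Xf := fun z : C => X1 + logn z).
assert (HXf : forall z, x0 <= Xf z) by (intros z; unfold Xf; generalize (logn_pos z); lra).
assert (HFdisc : forall y, ex_derive (K := C_AbsRing) F (Cexp (x0, y))).
{ intros y. apply HF. right. unfold in_disc. rewrite Cmod_Cexp. simpl. lra. }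
assert (HFin : forall x y, d - e <= y <= d + e -> in_sector d delta (Cexp (x, y))).
{ intros x y Hy. apply in_sector_Cexp. exists x, y. split; trivial. apply Rabs_def1; lra. }
assert (HFsec : forall x y, d - e <= y <= d + e -> ex_derive (K := C_AbsRing) F (Cexp (x, y))).
{ intros x y Hy. apply HF. left. now apply HFin. }
assert (Hsmall : forall w x y, Xf w <= x -> Cmod (w * Cexp (- (x, y)))%C <= rG / 8).
{ intros w x y Hx. rewrite Cmod_mult_Cexp_opp. assert (Hm := Cmod_ge_0 w).
  apply Rle_trans with (exp (- X1)); trivial.
  replace (exp (- X1)) with (exp (logn w) * exp (- Xf w)).
  2:{ rewrite <- exp_plus. f_equal. unfold Xf. ring. }
  assert (exp (- x) <= exp (- Xf w)) by (apply exp_le; lra).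
  assert (Cmod w <= exp (logn w)) by (unfold logn; rewrite exp_ln; lra).
  apply Rmult_le_compat; trivial. left; apply exp_pos. }
assert (Hsec : forall w x y, in_sector d e w -> d + e <= y <= d - e + 2 * PI ->
   exists x' y', e / 2 <= y' <= 2 * PI - e / 2 /\ (w * Cexp (- (x, y)))%C = Cexp (x', y')).
{ intros w x y Hw Hy. apply in_sector_Cexp in Hw. destruct Hw as [xw [yw [Hyw ->]]].
  apply Rabs_def2 in Hyw. exists (xw - x), (yw - y + 2 * PI). split; [lra|].
  now rewrite Cexp_period, <- Cexp_plus. }
assert (HGsec : forall w x y, in_sector d e w -> d + e <= y <= d - e + 2 * PI ->
   ex_derive (K := C_AbsRing) (V := C_NormedModule) G (w * Cexp (- (x, y)))%C /\
   Cmod (G (w * Cexp (- (x, y)))%C) <= qbound c KG bG (logn (w * Cexp (- (x, y)))%C)).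
{ intros w x y Hw Hy. destruct (Hsec w x y Hw Hy) as [x' [y' [Hy' ->]]]. split.
  - apply HGray. lra.
  - eapply Rle_trans; [now apply HGg|]. apply qbound_mono; [apply logn_pos|lra|lra]. }
assert (HGdisc : forall u, Cmod u <= rG / 4 ->
   ex_derive (K := C_AbsRing) (V := C_NormedModule) G u /\
   Cmod (G u) <= 2 * MG /\ Cmod (G u) <= qbound c KG bG (logn u)).
{ intros u Hu. split; [apply HGd; unfold in_disc; lra|]. split; [now apply HGsmall|].
  eapply Rle_trans; [now apply HGsmall|]. eapply Rle_trans; [exact HKGr|].
  apply qbound_ge; try lra. apply logn_pos. }
(* For [z] in this disc, [z / w] stays in the disc of [G] as soon as [|w| >= exp x0], so the outer
   radius may shrink down to [exp x0]. *)
set (rho := exp x0 * (rG / 8)).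
assert (He0 := exp_pos x0).
assert (Hrho : 0 < rho) by (unfold rho; nra).
assert (Hdisc : forall w x y, in_disc rho w -> x0 <= x -> Cmod (w * Cexp (- (x, y)))%C <= rG / 8).
{ intros w x y Hw Hx. rewrite Cmod_mult_Cexp_opp. unfold in_disc, rho in Hw.
  assert (Hm := Cmod_ge_0 w).
  replace (rG / 8) with (exp x0 * (rG / 8) * exp (- x0)).
  2:{ rewrite exp_Ropp. field. lra. }
  apply Rmult_le_compat; try lra; [left; apply exp_pos|apply exp_le; lra]. }
assert (Hgood : forall w x y, sector_disc d e rho w -> x0 <= x -> d + e <= y <= d - e + 2 * PI ->
   ex_derive (K := C_AbsRing) (V := C_NormedModule) G (w * Cexp (- (x, y)))%C).
{ intros w x y [Hw|Hw] Hx Hy; [now apply HGsec|]. apply HGdisc.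
  assert (Hd := Hdisc w x y Hw Hx). lra. }
assert (Hper : forall x, Cexp (- (x, (d - e)%R)) = Cexp (- (x, (d - e + 2 * PI)%R))).
{ intros x. now rewrite !Cexp_opp, Cexp_period. }
assert (Hray1 : forall w X, sector_disc d e rho w -> x0 <= X ->
   Cex (fun x => kernel F G w (x, d - e)) x0 X).
{ intros w X Hw HX. apply (Cex_hline (kernel F G w)); trivial. intros x Hx.
  apply ex_derive_kernel_t; [apply HFsec; lra|]. rewrite Hper. apply Hgood; trivial; lra. }
assert (Hray2 : forall w X, sector_disc d e rho w -> x0 <= X ->
   Cex (fun x => kernel F G w (x, d + e)) x0 X).
{ intros w X Hw HX. apply (Cex_hline (kernel F G w)); trivial. intros x Hx.
  apply ex_derive_kernel_t; [apply HFsec; lra|]. apply Hgood; trivial; lra. }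
assert (Hindep : forall w X, sector_disc d e rho w -> Xf w <= X ->
   contour F G d e x0 (Xf w) w = contour F G d e x0 X w).
{ intros w X Hw HX. apply contour_indep; auto.
  intros x y Hx Hy. apply ex_derive_kernel_t; [now apply HFsec|]. apply HGdisc.
  assert (Hs := Hsmall w x y ltac:(lra)). lra. }
assert (Hindep0 : forall w, in_disc rho w ->
   contour F G d e x0 x0 w = contour F G d e x0 (Xf w) w).
{ intros w Hw. apply contour_indep; auto.
  - split; [lra|apply HXf].
  - apply Hray1; [now right|lra].
  - apply Hray2; [now right|lra].
  - intros x y Hx Hy. apply ex_derive_kernel_t; [now apply HFsec|]. apply HGdisc.
    assert (Hd := Hdisc w x y Hw ltac:(lra)). lra. }
set (H := (fun z => scal (RtoC (/ (2 * PI))) (contour F G d e x0 (Xf z) z)) : C -> E).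
exists e, rho, H. split; [trivial|]. split; [trivial|]. split; [|split].
- intros z [Hz|Hz].
  + destruct (sector_open _ _ _ Hz) as [k [Hk Hko]].
    set (k' := Rmin k 1). assert (Hk' : 0 < k') by (apply Rmin_pos; lra).
    assert (Hk1 : k' <= k) by apply Rmin_l. assert (Hk2 : k' <= 1) by apply Rmin_r.
    clearbody k'.
    (* [H] uses a radius that varies with the point. Near [z] it equals the contour integral of
       fixed radius [exp (Xf T)], larger than all the radii involved, to which [ex_derive_contour]
       applies. *)
    set (T := RtoC (Cmod z + 1)).
    assert (Hm := Cmod_ge_0 z).
    assert (HT : Cmod T = Cmod z + 1) by (unfold T; rewrite Cmod_R, Rabs_right; lra).
    assert (HwT : forall w : C, Cmod (w - z)%C < k' -> Cmod w <= Cmod T).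
    { intros w Hw. replace w with (w - z + z)%C by ring.
      eapply Rle_trans; [apply Cmod_triangle|]. lra. }
    assert (HXT : forall w : C, Cmod (w - z)%C < k' -> Xf w <= Xf T).
    { intros w Hw. unfold Xf, logn. apply Rplus_le_compat_l. specialize (HwT w Hw).
      apply ln_le; generalize (Cmod_ge_0 w); lra. }
    apply (ex_derive_ext_near (fun w => scal (RtoC (/ (2 * PI))) (contour F G d e x0 (Xf T) w)) H z k');
      trivial.
    * intros w Hw. unfold H. rewrite (Hindep w (Xf T)); auto. left. apply Hko. lra.
    * apply ex_derive_scal_C; [apply (@ex_derive_const_C C_CompleteNormedModule)|].
      set (A1 := qbound c KG bG (ln (1 + Cmod T * exp (- x0)))).
      assert (HA1 : 0 <= A1).
      { unfold A1, qbound. apply Rmult_le_pos; [lra|]. left. apply exp_pos. }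
      apply (ex_derive_contour F G d e x0 (Xf T) z k' (A1 + 2 * MG)); auto; [lra| |].
      -- intros w x y Hw Hx Hy.
         assert (Hws : in_sector d e w) by (apply Hko; lra).
         destruct (HGsec w x y Hws Hy) as [HG1 HG2]. split; trivial.
         eapply Rle_trans; [exact HG2|]. apply Rle_trans with A1; [|lra].
         apply qbound_mono_L; try lra. split; [apply logn_pos|].
         unfold logn. rewrite Cmod_mult_Cexp_opp.
         assert (Hex : exp (- x) <= exp (- x0)) by (apply exp_le; lra).
         assert (Hex0 := exp_pos (- x)). assert (Hw0 := Cmod_ge_0 w). specialize (HwT w Hw).
         assert (0 <= Cmod w * exp (- x)) by nra.
         apply ln_le; [lra|]. apply Rplus_le_compat_l. apply Rmult_le_compat; lra.
      -- intros w y Hw Hy. assert (Hs := Hsmall w (Xf T) y (HXT w Hw)).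
         destruct (HGdisc (w * Cexp (- (Xf T, y)))%C ltac:(lra)) as [HG1 [HG2 _]].
         split; trivial. lra.
  + assert (Hk : 0 < rho - Cmod z) by (unfold in_disc in Hz; lra).
    assert (Hw : forall w : C, Cmod (w - z)%C < rho - Cmod z -> in_disc rho w).
    { intros w Hw. unfold in_disc. replace w with (w - z + z)%C by ring.
      eapply Rle_lt_trans; [apply Cmod_triangle|]. lra. }
    apply (ex_derive_ext_near (fun w => scal (RtoC (/ (2 * PI))) (contour F G d e x0 x0 w)) H z _ Hk).
    * intros w Hwz. unfold H. rewrite Hindep0; auto.
    * apply ex_derive_scal_C; [apply (@ex_derive_const_C C_CompleteNormedModule)|].
      apply (ex_derive_contour F G d e x0 x0 z _ (2 * MG)) with (3 := Hk); auto; try lra.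
      -- intros w x y Hwz Hx Hy. assert (Hd := Hdisc w x y (Hw w Hwz) ltac:(lra)).
         destruct (HGdisc (w * Cexp (- (x, y)))%C ltac:(lra)) as [HG1 [HG2 _]]. auto.
      -- intros w y Hwz Hy. assert (Hd := Hdisc w x0 y (Hw w Hwz) ltac:(lra)).
         destruct (HGdisc (w * Cexp (- (x0, y)))%C ltac:(lra)) as [HG1 [HG2 _]]. auto.
- intros z Hz.
  assert (HS := circle_mean_hadamard a b F G x0 rhoF rG z ltac:(lra) HrG
    (fun w Hw => HF w (or_intror Hw)) HFs HGd HGs Hz).
  replace (H z) with (scal (RtoC (/ (2 * PI)))
      (CInt (fun y => scal (G (z * Cexp (- (x0, y)))%C) (F (Cexp (x0, y)))) 0 (2 * PI)) : E); trivial.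
  (* At outer radius [exp x0] the rays are reduced to points and the two arcs make up a full
     circle. *)
  unfold H. rewrite <- Hindep0 by trivial. f_equal.
  assert (Hcirc : forall y, ex_derive (K := C_AbsRing) (kernel F G z) (x0, y)).
  { intros y. apply ex_derive_kernel_t; [apply HFdisc|]. apply HGdisc.
    assert (Hd := Hdisc z x0 y Hz ltac:(lra)). lra. }
  change (CInt (fun y => kernel F G z (x0, y)) 0 (2 * PI) = contour F G d e x0 x0 z).
  rewrite <- (CInt_period _ (d - e)).
  2:{ intros y. apply continuous_vline, Hcirc. }
  2:{ intros y. unfold kernel. rewrite !Cexp_opp, !Cexp_period. reflexivity. }
  rewrite <- (CInt_Chasles (fun y => kernel F G z (x0, y)) (d - e) (d + e))
    by (apply (Cex_vline (kernel F G z)); [lra|intros; apply Hcirc]).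
  unfold contour.
  assert (Hpt : forall f : R -> E, CInt f x0 x0 = zero) by (intros f; exact (@RInt_point (ER E) x0 f)).
  rewrite !Hpt. vring.
- destruct (Cex_bounded (fun y => F (Cexp (x0, y))) (d + e) (d - e + 2 * PI)) as [MF HMF]; [lra| |].
  { apply (Cex_vline (fun t => F (Cexp t))); [lra|]. intros y _.
    apply (ex_derive_comp_C F Cexp); [apply HFdisc|]. eexists. apply is_derive_Cexp. }
  set (KF := Rmax KF1 MF).
  assert (HKFl : KF1 <= KF) by apply Rmax_l. assert (HKFr : MF <= KF) by apply Rmax_r.
  clearbody KF.
  set (B := ln (1 + exp X1 + exp (- x0))).
  assert (HB : 0 <= B).
  { unfold B. rewrite <- ln_1. apply ln_le; [lra|].
    generalize (exp_pos X1) (exp_pos (- x0)). lra. }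
  set (K' := KG * KF * exp (c * B ^ 2 + (bG + bF) * B)).
  set (b' := 2 * c * B + bG + bF).
  assert (HK' : 0 < K').
  { unfold K'. repeat apply Rmult_lt_0_compat; try lra. apply exp_pos. }
  assert (Hb' : 0 <= b') by (unfold b'; assert (0 <= c * B) by nra; lra).
  (* The length of the contour contributes at most [1 + (X1 - x0) + L <= (1 + (X1 - x0)) * exp L],
     which raises the linear exponent by 1. *)
  exists ((1 + (X1 - x0)) * K'), (b' + 1).
  split; [nra|]. split; [lra|]. intros z Hz.
  set (L := logn z). assert (HL : 0 <= L) by apply logn_pos.
  assert (HFb : forall x y, d - e <= y <= d + e ->
     norm (F (Cexp (x, y))) <= qbound c KF bF (logn (Cexp (x, y)))).
  { intros x y Hy. eapply Rle_trans; [apply HFg, HFin; lra|].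
    apply qbound_mono; try lra. apply logn_pos. }
  assert (HFb0 : forall y, d + e <= y <= d - e + 2 * PI ->
     norm (F (Cexp (x0, y))) <= qbound c KF bF (logn (Cexp (x0, y)))).
  { intros y Hy. eapply Rle_trans; [now apply HMF|]. eapply Rle_trans; [exact HKFr|].
    apply qbound_ge; try lra. apply logn_pos. }
  assert (Hker : forall x y, x0 <= x <= Xf z ->
     norm (F (Cexp (x, y))) <= qbound c KF bF (logn (Cexp (x, y))) ->
     Cmod (G (z * Cexp (- (x, y)))%C) <= qbound c KG bG (logn (z * Cexp (- (x, y)))%C) ->
     norm (kernel F G z (x, y)) <= qbound c K' b' L).
  { intros x y Hx H1 H2. eapply Rle_trans; [apply norm_kernel_le; [exact H2|exact H1]|].
    apply qbound_mul; try lra; try apply logn_pos.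
    assert (Hl := logn_product_le X1 x0 x y z Hx). unfold L, B. lra. }
  assert (HQ : 0 <= qbound c K' b' L).
  { unfold qbound. apply Rmult_le_pos; [lra|]. left. apply exp_pos. }
  assert (Hw : sector_disc d e rho z) by now left.
  assert (HN : norm (contour F G d e x0 (Xf z) z) <= 2 * (PI + (Xf z - x0)) * qbound c K' b' L).
  { apply norm_contour_le; auto; try lra.
    - apply (Cex_vline (kernel F G z)); [lra|]. intros y Hy.
      apply ex_derive_kernel_t; [apply HFdisc|]. apply Hgood; trivial; lra.
    - apply (Cex_vline (kernel F G z)); [lra|]. intros y Hy.
      apply ex_derive_kernel_t; [now apply HFsec|]. apply HGdisc.
      assert (Hs := Hsmall z (Xf z) y ltac:(lra)). lra.
    - intros y Hy. apply Hker; auto; [specialize (HXf z); lra|]. now apply HGsec.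
    - intros y Hy. apply Hker; auto; [specialize (HXf z); lra|]. apply HGdisc.
      assert (Hs := Hsmall z (Xf z) y ltac:(lra)). lra.
    - intros x Hx. split; apply Hker; auto; try (apply HFb; lra).
      + rewrite Hper. apply HGsec; trivial; lra.
      + apply HGsec; trivial; lra. }
  unfold H. rewrite norm_scal_eq, Cmod_R, Rabs_right.
  2:{ apply Rle_ge. left. apply Rinv_0_lt_compat. lra. }
  apply Rmult_le_compat_l with (r := / (2 * PI)) in HN; [|left; apply Rinv_0_lt_compat; lra].
  eapply Rle_trans; [exact HN|].
  replace (/ (2 * PI) * (2 * (PI + (Xf z - x0)) * qbound c K' b' L))
    with ((1 + (Xf z - x0) / PI) * qbound c K' b' L) by (field; lra).
  assert (Hdiv : (Xf z - x0) / PI <= (X1 - x0) + L).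
  { unfold Xf. fold L. apply Rmult_le_reg_r with PI; trivial. unfold Rdiv.
    rewrite Rmult_assoc, Rinv_l by lra. nra. }
  assert (HeL : 1 + L <= exp L) by apply exp_ineq1_le.
  apply Rle_trans with ((1 + (X1 - x0)) * exp L * qbound c K' b' L).
  + apply Rmult_le_compat_r; trivial. nra.
  + apply Req_le. unfold qbound.
    replace (c * L ^ 2 + (b' + 1) * L) with (L + (c * L ^ 2 + b' * L)) by ring.
    rewrite (exp_plus L). ring.
Qed.
End HadamardExtension.

(** * The equivalence *)

Section ScalarSeries.
Context {E : CompleteNormedModule C_AbsRing}.
Context (e : E) (e_neq_0 : e <> zero).

Lemma norm_e_pos : 0 < norm e.
Proof.
apply Rnot_le_lt. intros H. apply e_neq_0. now apply norm_eq_zero_E.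
Qed.

Lemma scal_minus_e (c d : C) : minus (scal c e) (scal d e) = scal (c - d)%C e.
Proof. vring. Qed.

(** [l] to [scal l e] multiplies distances by [norm e > 0], so the coordinates of a convergent
    sequence are Cauchy in [C]. *)
Lemma line_closed_subspace : closed_subspace (fun v : E => exists l : C, v = scal l e).
Proof.
assert (He := norm_e_pos).
split.
- exists 0%C. symmetry. exact (@scal_zero_l C_AbsRing E e).
- intros x y [l ->] [l' ->]. exists (l + l')%C. vring.
- intros c x [l ->]. exists (c * l)%C. vring.
- intros x H.
  assert (Hl : forall n : nat, exists l : C, norm (minus x (scal l e)) <= / INR (S n)).
  { intros n. destruct (H (/ INR (S n))) as [v [[l ->] Hv]]; [|now exists l].
    apply Rinv_0_lt_compat, lt_0_INR. lia. }
  set (l := fun n => proj1_sig (constructive_indefinite_description _ (Hl n))).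
  assert (Hln : forall n, norm (minus x (scal (l n) e)) <= / INR (S n)).
  { intros n. exact (proj2_sig (constructive_indefinite_description _ (Hl n))). }
  assert (Hsmall : forall eps, 0 < eps -> exists N, forall n, (N <= n)%nat -> / INR (S n) < eps).
  { intros eps Heps. destruct (INR_unbounded (/ eps)) as [N HN]. exists N. intros n Hn.
    apply le_INR in Hn. rewrite S_INR. rewrite <- (Rinv_inv eps).
    assert (0 < / eps) by now apply Rinv_0_lt_compat.
    apply Rinv_lt_contravar; [nra|lra]. }
  destruct (complete_seq (E := C_CompleteNormedModule) l) as [l0 Hl0].
  { intros eps Heps. destruct (Hsmall (eps * norm e / 2)) as [N HN]; [nra|].
    exists N. intros n p Hn Hp.
    change (Cmod (l n - l p)%C < eps).
    assert (Hd : norm (scal (l n - l p)%C e) <= / INR (S p) + / INR (S n)).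
    { rewrite <- scal_minus_e.
      assert (Ht : forall u v w : E, norm (minus u v) <= norm (minus w v) + norm (minus w u)).
      { intros u v w. replace (minus u v) with (minus (minus w v) (minus w u)) by vring.
        apply norm_minus_le. }
      eapply Rle_trans; [apply (Ht _ _ x)|]. apply Rplus_le_compat; apply Hln. }
    rewrite norm_scal_eq in Hd. assert (H1 := HN n Hn). assert (H2 := HN p Hp).
    apply Rmult_lt_reg_r with (norm e); trivial. lra. }
  exists l0. apply minus_zero_eq. apply (norm_eps_zero _ (1 + norm e)). intros eps Heps.
  destruct (Hl0 eps Heps) as [N1 HN1]. destruct (Hsmall eps Heps) as [N2 HN2].
  set (n := (N1 + N2)%nat). specialize (HN1 n ltac:(lia)). specialize (HN2 n ltac:(lia)).
  change (Cmod (l n - l0)%C < eps) in HN1. specialize (Hln n).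
  assert (Hd : norm (scal (l n - l0)%C e) <= eps * norm e).
  { rewrite norm_scal_eq. apply Rmult_le_compat_r; lra. }
  replace (minus x (scal l0 e)) with (plus (minus x (scal (l n) e)) (scal (l n - l0)%C e)) by vring.
  eapply Rle_trans; [apply norm_plus_le|]. lra.
Qed.

Lemma lcomb_scal_e (b : nat -> C) (c : nat -> C) N :
  lcomb (fun n => scal (b n) e) c N =
  scal (lcomb (V := C_NormedModule) b c N : C) e.
Proof.
induction N as [|N IH]; simpl.
- symmetry. exact (@scal_zero_l C_AbsRing E e).
- rewrite IH. set (L := lcomb (V := C_NormedModule) b c N : C).
  change (plus (scal L e) (scal (c N) (scal (b N) e)) = scal (L + c N * b N)%C e). vring.
Qed.

(** The values of [f] lie on the line [C e]: on the disc as limits of partial sums, further out by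
    [line_identity]. The coordinate along [e] is the scalar extension, and dividing by [norm e]
    transfers every estimate. *)
Lemma extension_scalar c d (b : nat -> C) delta rho f :
  extension c (fun p => scal (b p) e) d delta rho f ->
  exists g, extension (E := C_CompleteNormedModule) c b d delta rho g.
Proof.
intros [Hdelta [Hrho [Hf [Hs [K [beta [HK [Hbeta Hg]]]]]]]].
assert (He := norm_e_pos).
set (V := fun v : E => exists l : C, v = scal l e).
assert (HV := line_closed_subspace). fold V in HV.
assert (Hdisc : forall z, in_disc rho z -> V (f z)).
{ intros z Hz. apply (subspace_closed V HV). intros eps Heps.
  destruct (proj1 (is_pseries_lcomb _ _ _) (Hs z Hz) eps Heps) as [N HN].
  exists (lcomb (fun p => scal (b p) e) (fun k => z ^ k)%C N). split.
  - apply subspace_lcomb; trivial. intros n _. now exists (b n).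
  - rewrite norm_minus_sym. left. now apply HN. }
assert (HU : forall z, sector_disc d delta rho z -> V (f z)).
{ intros z [Hz|Hz]; [|now apply Hdisc].
  assert (Hz0 := sector_neq_0 _ _ _ Hz). destruct (polar_form z Hz0) as [x [y ->]].
  destruct (sector_disc_half_strip d delta rho x y Hrho (or_introl Hz)) as [eta [Heta Hstrip]].
  apply (line_identity V (fun t => f (Cexp t)) y eta (ln rho - 1) x HV Heta); [| |lra].
  - intros t H1 H2. apply (ex_derive_comp_C f Cexp).
    + apply Hf. now apply Hstrip.
    + eexists. apply is_derive_Cexp.
  - intros t Ht. apply Hdisc. unfold in_disc. rewrite Cmod_Cexp. simpl.
    rewrite <- (exp_ln rho) by trivial. apply exp_increasing. lra. }
set (g := fun z => epsilon (inhabits (RtoC 0)) (fun l => f z = scal l e)).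
assert (Hfg : forall z, sector_disc d delta rho z -> f z = scal (g z) e).
{ intros z Hz. exact (epsilon_spec _ _ (HU z Hz)). }
exists g. split; [trivial|]. split; [trivial|]. split; [|split].
- intros z Hz. destruct (ex_derive_eps f z (Hf z Hz)) as [l Hl].
  destruct (sector_disc_open _ _ _ _ Hz) as [k [Hk Hko]].
  assert (Hko' : forall h : C, Cmod h < k -> sector_disc d delta rho (z + h)%C).
  { intros h Hh. apply Hko. now replace (z + h - z)%C with h by ring. }
  (* The derivative is a limit of difference quotients, which lie on the line; its coordinate is the
     derivative of [g]. *)
  assert (HlV : V l).
  { apply (subspace_closed V HV). intros eps Heps.
    destruct (Hl eps Heps) as [r [Hr Hlr]].
    set (t := Rmin r k / 2).
    assert (Ht : 0 < t) by (assert (0 < Rmin r k) by (now apply Rmin_pos); unfold t; lra).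
    assert (Htr : t < r) by (unfold t in *; generalize (Rmin_l r k); lra).
    assert (Htk : t < k) by (unfold t in *; generalize (Rmin_r r k); lra).
    clearbody t.
    assert (Hm : Cmod (RtoC t) = t) by (rewrite Cmod_R, Rabs_right; lra).
    assert (Hne : RtoC t <> 0%C) by (apply Cmod_gt_0; lra).
    specialize (Hlr (RtoC t)). rewrite Hm in Hlr. specialize (Hlr Htr).
    exists (scal (/ RtoC t)%C (minus (f (z + RtoC t)%C) (f z))). split.
    - apply (subspace_scal V HV). apply subspace_minus; trivial; apply HU; trivial.
      apply Hko'. lra.
    - replace (minus l (scal (/ RtoC t)%C (minus (f (z + RtoC t)%C) (f z)))) with
        (scal (- / RtoC t)%C (minus (minus (f (z + RtoC t)%C) (f z)) (scal (RtoC t) l))).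
      2:{ vcoefs; simpl; field; trivial. }
      rewrite norm_scal_eq, Cmod_opp, Cmod_inv, Hm by trivial.
      apply Rmult_le_reg_l with t; trivial. rewrite <- Rmult_assoc, Rinv_r, Rmult_1_l; lra. }
  destruct HlV as [lambda ->]. exists lambda.
  apply (@is_derive_eps C_CompleteNormedModule). intros eps Heps.
  destruct (Hl (eps * norm e)) as [r [Hr Hlr]]; [now apply Rmult_lt_0_compat|].
  exists (Rmin r k). split; [now apply Rmin_pos|]. intros h Hh.
  assert (H1 := Rlt_le_trans _ _ _ Hh (Rmin_l _ _)).
  assert (H2 := Rlt_le_trans _ _ _ Hh (Rmin_r _ _)).
  specialize (Hlr h H1). rewrite (Hfg (z + h)%C (Hko' h H2)), (Hfg z Hz) in Hlr.
  change (Cmod (g (z + h) - g z - h * lambda)%C <= eps * Cmod h).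
  apply Rmult_le_reg_r with (norm e); trivial. rewrite <- norm_scal_eq.
  replace (scal (g (z + h) - g z - h * lambda)%C e) with
    (minus (minus (scal (g (z + h)%C) e) (scal (g z) e)) (scal h (scal lambda e))) by vring.
  eapply Rle_trans; [exact Hlr|]. apply Req_le. ring.
- intros z Hz. apply (@is_pseries_lcomb C_CompleteNormedModule). intros eps Heps.
  destruct (proj1 (is_pseries_lcomb _ _ _) (Hs z Hz) (eps * norm e)) as [N HN];
    [now apply Rmult_lt_0_compat|].
  exists N. intros n Hn. specialize (HN n Hn).
  rewrite (Hfg z (or_intror Hz)), lcomb_scal_e, scal_minus_e, norm_scal_eq in HN.
  apply Rmult_lt_reg_r in HN; trivial.
- exists (K / norm e), beta. split; [now apply Rdiv_lt_0_compat|]. split; trivial.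
  intros z Hz. specialize (Hg z Hz). rewrite (Hfg z (or_introl Hz)), norm_scal_eq in Hg.
  change (Cmod (g z) <= qbound c (K / norm e) beta (logn z)).
  apply Rmult_le_reg_r with (norm e); trivial. eapply Rle_trans; [exact Hg|].
  apply Req_le. unfold qbound. field. lra.
Qed.

Lemma lcomb_geometric (z : C) N : z <> 1%C ->
  lcomb (fun _ => e) (fun k => z ^ k)%C N = scal ((1 - z ^ N) / (1 - z))%C e.
Proof.
intros Hz. assert (Hz' : (1 - z)%C <> 0%C).
{ intros K. apply Hz. replace z with (1 - (1 - z))%C by ring. rewrite K. ring. }
induction N as [|N IH]; simpl.
- replace ((1 - 1) / (1 - z))%C with (RtoC 0) by (field; trivial).
  symmetry. exact (@scal_zero_l C_AbsRing E e).
- rewrite IH. set (p := (z ^ N)%C).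
  change (plus (scal ((1 - p) / (1 - z))%C e) (scal p e) = scal ((1 - z * p) / (1 - z))%C e).
  vcoefs; simpl; field; trivial.
Qed.

Lemma extension_geometric c theta : 0 <= c -> (forall k : Z, theta <> IZR k * (2 * PI)) ->
  exists delta rho f, extension c (fun _ => e) theta delta rho f.
Proof.
intros Hc Htheta. assert (He := norm_e_pos).
assert (Hcos : cos theta < 1).
{ destruct (COS_bound theta) as [_ [H|H]]; trivial. exfalso.
  destruct (cos_eq_1 _ H) as [k Hk]. now apply (Htheta k). }
(* A bound for [cos] on a neighbourhood of [theta], strictly above [cos theta] and below 1;
   nonnegativity ensures [k ^ 2 < 1]. *)
set (k := Rmax 0 ((1 + cos theta) / 2)).
assert (Hk0 : 0 <= k) by apply Rmax_l. assert (Hk1 : k < 1) by (apply Rmax_lub_lt; lra).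
assert (Hkc : cos theta < k) by (eapply Rlt_le_trans; [|apply Rmax_r]; lra).
destruct (continuity_cos theta (k - cos theta)) as [delta [Hdelta Hd]]; [lra|].
assert (Hck : forall y, Rabs (y - theta) < delta -> cos y <= k).
{ intros y Hy. destruct (Req_dec theta y) as [<-|Hne]; [lra|].
  assert (Hcy : Rdist (cos y) (cos theta) < k - cos theta).
  { apply Hd. split; [split; [exact I|trivial]|exact Hy]. }
  unfold Rdist in Hcy. apply Rabs_def2 in Hcy. lra. }
(* [|1 - r e^(iy)|^2 = 1 - 2 r cos y + r^2 >= (r - k)^2 + 1 - k^2]. As [m <= 1], the bound [m] on
   the square also bounds the modulus. *)
set (m := 1 - k ^ 2). assert (Hm : 0 < m <= 1) by (unfold m; nra).
assert (Hsec : forall z, in_sector theta delta z -> m <= Cmod (1 - z)%C).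
{ intros z Hz. apply in_sector_Cexp in Hz. destruct Hz as [x [y [Hy ->]]].
  assert (Hcy : cos y <= k) by (apply Hck; lra). assert (Hr := exp_pos x).
  assert (Hsq : m <= Cmod (1 - Cexp (x, y))%C ^ 2).
  { rewrite Cmod2_alt. unfold Cexp; simpl. assert (Hsc := sin2_cos2 y). unfold Rsqr in Hsc.
    set (r := exp x) in *. set (cy := cos y) in *. set (sy := sin y) in *.
    replace (_ + _) with (1 - 2 * r * cy + r * r * (sy * sy + cy * cy)) by ring.
    rewrite Hsc. unfold m. assert (H1 : r * cy <= r * k) by (apply Rmult_le_compat_l; lra).
    assert (H2 := Rle_0_sqr (r - k)). unfold Rsqr in H2. lra. }
  assert (H0 := Cmod_ge_0 (1 - Cexp (x, y))%C). nra. }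
assert (Hdisc : forall z, in_disc (1 / 2) z -> 1 / 2 <= Cmod (1 - z)%C).
{ intros z Hz. unfold in_disc in Hz. eapply Rle_trans; [|apply Cmod_minus_ge].
  rewrite Cmod_1. lra. }
assert (Hne : forall z, sector_disc theta delta (1 / 2) z -> z <> 1%C).
{ intros z Hz ->. assert (H0 : Cmod (1 - 1)%C = 0).
  { replace (1 - 1)%C with (RtoC 0) by ring. apply Cmod_0. }
  destruct Hz as [Hz|Hz]; [specialize (Hsec _ Hz)|specialize (Hdisc _ Hz)]; lra. }
assert (Hne' : forall z, sector_disc theta delta (1 / 2) z -> (1 - z)%C <> 0%C).
{ intros z Hz K. apply (Hne z Hz). replace z with (1 - (1 - z))%C by ring. rewrite K. ring. }
exists delta, (1 / 2), (fun z => scal (/ (1 - z))%C e).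
split; [trivial|]. split; [lra|]. split; [|split].
- intros z Hz. apply ex_derive_scal_C; [|apply ex_derive_const_C].
  apply (ex_derive_comp_C (E := C_CompleteNormedModule) (fun w => / w)%C (fun z => 1 - z)%C).
  + apply ex_derive_inv_C. now apply Hne'.
  + apply (@ex_derive_minus_C C_CompleteNormedModule (fun _ => RtoC 1) (fun z => z)).
    * apply (@ex_derive_const_C C_CompleteNormedModule).
    * apply ex_derive_id_C.
- intros z Hz. apply is_pseries_lcomb. intros eps Heps.
  destruct (pow_lt_1_zero (/ 2)) with (y := eps / (2 * norm e)) as [N0 HN0].
  { rewrite Rabs_right; lra. }
  { apply Rdiv_lt_0_compat; lra. }
  exists N0. intros N HN. specialize (HN0 N HN).
  rewrite Rabs_right in HN0 by (apply Rle_ge, pow_le; lra).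
  rewrite lcomb_geometric by (apply Hne; now right).
  rewrite scal_minus_e, norm_scal_eq.
  assert (Hz1 := Hne' z (or_intror Hz)). specialize (Hdisc z Hz).
  replace ((1 - z ^ N) / (1 - z) - / (1 - z))%C with (- (z ^ N / (1 - z)))%C by (field; trivial).
  rewrite Cmod_opp, Cmod_div, Cmod_pow by trivial.
  assert (Hp : Cmod z ^ N <= (/ 2) ^ N).
  { apply pow_incr. split; [apply Cmod_ge_0|]. unfold in_disc in Hz. lra. }
  assert (Hp0 : 0 <= Cmod z ^ N) by (apply pow_le, Cmod_ge_0).
  assert (Hi : / Cmod (1 - z)%C <= 2).
  { replace 2 with (/ (1 / 2)) by field. apply Rinv_le_contravar; lra. }
  apply Rmult_lt_compat_r with (r := 2 * norm e) in HN0; [|lra].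
  replace (eps / (2 * norm e) * (2 * norm e)) with eps in HN0 by (field; lra).
  eapply Rle_lt_trans; [|exact HN0].
  replace ((/ 2) ^ N * (2 * norm e)) with ((/ 2) ^ N * 2 * norm e) by ring.
  apply Rmult_le_compat_r; [lra|]. unfold Rdiv. apply Rmult_le_compat; trivial.
  left. apply Rinv_0_lt_compat. lra.
- assert (HK : 0 < norm e / m) by (apply Rdiv_lt_0_compat; lra).
  exists (norm e / m), 0. split; [trivial|]. split; [lra|]. intros z Hz.
  eapply Rle_trans; [|apply qbound_ge; try lra; apply logn_pos].
  specialize (Hsec z Hz). rewrite norm_scal_eq, Cmod_inv by (apply Hne'; now left).
  rewrite Rmult_comm. apply Rmult_le_compat_l; [lra|]. apply Rinv_le_contravar; lra.
Qed.
End ScalarSeries.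

Lemma extends_convergent {E : NormedModule C_AbsRing} q s d (a : nat -> E) :
  extends_with_q_exp_growth q s d a -> convergent_ps a.
Proof.
intros [delta [rho [f [_ [Hrho [_ [Hs _]]]]]]]. exists rho. split; trivial.
intros z Hz. exists (f z). now apply Hs.
Qed.

Lemma q_exp_order_pos q s : 1 < q -> 0 < s -> 0 <= / (2 * s * ln q).
Proof.
intros Hq Hs. assert (0 < ln q) by (rewrite <- ln_1; apply ln_increasing; lra).
left. apply Rinv_0_lt_compat. nra.
Qed.

Lemma hadamard_extends {E : CompleteNormedModule C_AbsRing} q s d (a : nat -> E) (b : nat -> C) :
  1 < q -> 0 < s -> extends_with_q_exp_growth q s d a ->
  (forall theta, (forall k : Z, theta <> IZR k * (2 * PI)) ->
     extends_with_q_exp_growth (E := C_NormedModule) q s theta b) ->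
  extends_with_q_exp_growth q s d (fun p => scal (b p) (a p)).
Proof.
intros Hq Hs Ha Hb. apply extends_extension; trivial. apply hadamard_extension.
- now apply q_exp_order_pos.
- now apply extends_extension.
- intros theta Htheta. apply (@extends_extension C_CompleteNormedModule); auto.
Qed.

Lemma scalar_extends {E : CompleteNormedModule C_AbsRing} q s d (e : E) (b : nat -> C) :
  1 < q -> 0 < s -> e <> zero ->
  extends_with_q_exp_growth q s d (fun p => scal (b p) e) ->
  extends_with_q_exp_growth (E := C_NormedModule) q s d b.
Proof.
intros Hq Hs He H. apply extends_extension in H; trivial.
destruct H as [delta [rho [f Hf]]]. destruct (extension_scalar e He _ _ _ _ _ _ Hf) as [g Hg].
apply (@extends_extension C_CompleteNormedModule); trivial. now exists delta, rho, g.
Qed.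

Lemma geometric_extends {E : CompleteNormedModule C_AbsRing} q s theta (e : E) :
  1 < q -> 0 < s -> e <> zero -> (forall k : Z, theta <> IZR k * (2 * PI)) ->
  extends_with_q_exp_growth q s theta (fun _ => e).
Proof.
intros Hq Hs He Htheta. apply extends_extension; trivial.
apply extension_geometric; trivial. now apply q_exp_order_pos.
Qed.

Theorem theorem2 (q : R) (E : CompleteNormedModule C_AbsRing) (m : nat -> R) :
  1 < q ->
  (exists e : E, e <> zero) ->
  (forall p : nat, 0 < m p) ->
  m 0%nat = 1 ->
  (preserves_q_Gevrey q E m
   <->
   (forall s theta : R, 0 < s ->
      (forall k : Z, theta <> IZR k * (2 * PI)) ->
      (convergent_ps (formal_borel m geometric_ps) /\
       extends_with_q_exp_growth q s theta (formal_borel m geometric_ps)) /\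
      (convergent_ps (formal_borel (fun p => / m p) geometric_ps) /\
       extends_with_q_exp_growth q s theta
         (formal_borel (fun p => / m p) geometric_ps)))).
Proof.
intros Hq [e He] Hm _.
assert (Hmc : forall p, RtoC (m p) <> 0%C).
{ intros p K. injection K. specialize (Hm p). lra. }
assert (Hm' : forall p, m p <> 0) by (intros p; specialize (Hm p); lra).
split.
- intros Hpres s theta Hs Htheta.
  set (Q := fun p : nat => Rpower q (s * (INR p * (INR p - 1) / 2))).
  assert (HQ' : forall p, Q p <> 0).
  { intros p. generalize (exp_pos (s * (INR p * (INR p - 1) / 2) * ln q)). unfold Q, Rpower. lra. }
  assert (HQ : forall p, RtoC (Q p) <> 0%C) by (intros p K; injection K; apply HQ').
  assert (Hgeo := geometric_extends q s theta e Hq Hs He Htheta).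
  assert (Hconv := extends_convergent _ _ _ _ Hgeo).
  (* The coefficients [Q p] cancel the q-Borel weights: the first statement is about [e / (1 - t)],
     the second about the series with coefficients [e / m p]. *)
  assert (H1 : extends_with_q_exp_growth (E := C_NormedModule) q s theta
    (formal_borel m geometric_ps)).
  { apply (scalar_extends q s theta e); trivial.
    destruct (Hpres s theta (fun p => scal (RtoC (Q p)) e) Hs) as [Hp _].
    replace (q_borel q s (fun p => scal (RtoC (Q p)) e)) with ((fun _ => e) : nat -> E) in Hp.
    2:{ apply functional_extensionality. intros p. unfold q_borel, formal_borel. fold (Q p).
        rewrite RtoC_inv by auto. vcoefs; simpl; field; apply HQ. }
    destruct (Hp (conj Hconv Hgeo)) as [_ Hext].
    match type of Hext with extends_with_q_exp_growth _ _ _ ?x =>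
      replace x with ((fun p => scal (formal_borel m geometric_ps p : C) e) : nat -> E) in Hext end;
      trivial.
    apply functional_extensionality. intros p. unfold q_borel, formal_borel, geometric_ps. fold (Q p).
    change (scal (RtoC (/ m p) * 1)%C e
      = scal (RtoC (/ Q p)) (scal (RtoC (/ m p)) (scal (RtoC (Q p)) e))).
    rewrite !RtoC_inv by auto. vcoefs; simpl; field; auto. }
  (* Same test for the converse implication: with coefficients [Q p * m p], it is the second
     statement that is about [e / (1 - t)]. *)
  assert (H2 : extends_with_q_exp_growth (E := C_NormedModule) q s theta
    (formal_borel (fun p => / m p) geometric_ps)).
  { apply (scalar_extends q s theta e); trivial.
    destruct (Hpres s theta (fun p => scal (RtoC (Q p) * RtoC (m p))%C e) Hs) as [_ Hp].
    match type of Hp with _ /\ extends_with_q_exp_growth _ _ _ ?x -> _ =>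
      replace x with ((fun _ => e) : nat -> E) in Hp end.
    2:{ apply functional_extensionality. intros p. unfold q_borel, formal_borel. fold (Q p).
        rewrite !RtoC_inv by auto. vcoefs; simpl; field; auto. }
    destruct (Hp (conj Hconv Hgeo)) as [_ Hext].
    match type of Hext with extends_with_q_exp_growth _ _ _ ?x =>
      replace x with ((fun p => scal (formal_borel (fun p => / m p) geometric_ps p : C) e) : nat -> E)
        in Hext end; trivial.
    apply functional_extensionality. intros p. unfold q_borel, formal_borel, geometric_ps. fold (Q p).
    change (scal (RtoC (/ / m p) * 1)%C e = scal (RtoC (/ Q p)) (scal (RtoC (Q p) * RtoC (m p))%C e)).
    rewrite Rinv_inv, !RtoC_inv by auto. vcoefs; simpl; field; auto. }
  split; split; trivial; eapply extends_convergent; eassumption.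
- intros Hdir s d u Hs.
  (* Formal Borel operators multiply coefficients, so each of the two series of the definition is a
     termwise product of the other with [Hb1] or [Hb2]; the order [s] is the same in both
     factors. *)
  assert (Hb1 := fun theta Htheta => proj2 (proj1 (Hdir s theta Hs Htheta))).
  assert (Hb2 := fun theta Htheta => proj2 (proj2 (Hdir s theta Hs Htheta))).
  split; intros [_ Hext].
  + assert (Hprod := hadamard_extends q s d _ _ Hq Hs Hext Hb1).
    replace (q_borel q s (formal_borel m u)) with
      ((fun p => scal (formal_borel m geometric_ps p : C) (q_borel q s u p)) : nat -> E).
    * split; [eapply extends_convergent|]; eassumption.
    * apply functional_extensionality. intros p. unfold q_borel, formal_borel, geometric_ps.
      set (x := RtoC (/ Rpower q (s * (INR p * (INR p - 1) / 2)))). set (y := RtoC (/ m p)).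
      change (scal (y * 1)%C (scal x (u p)) = scal x (scal y (u p))). vring.
  + assert (Hprod := hadamard_extends q s d _ _ Hq Hs Hext Hb2).
    replace (q_borel q s u) with
      ((fun p => scal (formal_borel (fun p => / m p) geometric_ps p : C)
         (q_borel q s (formal_borel m u) p)) : nat -> E).
    * split; [eapply extends_convergent|]; eassumption.
    * apply functional_extensionality. intros p. unfold q_borel, formal_borel, geometric_ps.
      set (x := RtoC (/ Rpower q (s * (INR p * (INR p - 1) / 2)))).
      change (scal (RtoC (/ / m p) * 1)%C (scal x (scal (RtoC (/ m p)) (u p))) = scal x (u p)).
      rewrite Rinv_inv, RtoC_inv by auto. vcoefs; simpl; field; auto.
Qed.
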